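(* Let $n\ge 1$ and $q\in(0,1)$. In each case below $C(X_q)$ is a C$^*$-algebra of a quantum space, $L$ is the indicated finite directed graph, $C(X_q)$ is identified with the Cuntz--Krieger algebra $\mathcal O_L$ through a $*$-isomorphism, $\mathcal A_L$ is the non-self-adjoint algebra of $L$, and $\Pi$ is the Pythagorean functor from $\mathcal A_L$-modules to representations of $\mathcal O_L$. (a) (Odd-dimensional quantum spheres.) Let $C(X_q)=C(S_q^{2n-1})$ and $L=L_{2n-1}$. Then for each $(j,z)$ with $1\le j\le n$ and $z\in S_1=\{z\in\mathbb C:|z|=1\}$ there is a one-dimensional $\mathcal A_L$-module $M_{j,z}$ such that $(j,z)\mapsto \Pi(M_{j,z})$ parametrises the spectrum of $C(S_q^{2n-1})$, i.e. it induces a bijection from $\{1,\dots,n\}\times S_1$ onto the set of unitary equivalence classes of irreducible representations. (b) (Odd-dimensional quantum real projective spaces.) Let $C(X_q)=C(P_q)$, the quantum real projective space of dimension $2n-1$, and $L=L_{2n-1}^{(2)}$. Then there are one-dimensional $\mathcal A_L$-modules $M_{j,z}$, $(j,z)\in\{1,\dots,n\}\times S_1$, such that $(j,z)\mapsto\Pi(M_{j,z})$ induces a bijection from $\{1,\dots,n\}\times S_1$ onto the spectrum of $C(P_q)$. (c) (Quantum lens spaces.) Let $p\ge 1$, $\mathbf m=(m_1,\dots,m_n)\in\mathbb N^n$, $C(X_q)=C(L_q(p;\mathbf m))$, and let $L=G$ be a graph associated to $L_q(p;\mathbf m)$ as in the context, with vertex set $\{v_i^s: 1\le i\le n,\ s\in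 E_i\}$. Then there are one-dimensional $\mathcal A_G$-modules $M_{v,z}$, $(v,z)\in G^0\times S_1$, such that $(v,z)\mapsto \Pi(M_{v,z})$ induces a bijection from $G^0\times S_1$ onto the spectrum of $C(L_q(p;\mathbf m))$; thus the spectrum is parametrised by $N=\sum_{i=1}^n|E_i|$ circles (in particular by $n$ circles when all $E_i$ are singletons, as for the graph used when all $m_i$ are relatively prime to $p$). (d) (Even-dimensional quantum spheres.) Let $C(X_q)=C(S_q^{2n})$ and $L=L_{2n}$. Then there are one-dimensional $\mathcal A_L$-modules $M_{j,z}$, $(j,z)\in\{1,\dots,n\}\times S_1$, and $M_{n+1}$, $M_{n+2}$, such that the representations $\Pi(M_{j,z})$, $\Pi(M_{n+1})$, $\Pi(M_{n+2})$ are irreducible, pairwise inequivalent, and exhaust the spectrum of $C(S_q^{2n})$; thus the spectrum is parametrised by $n$ circles and two additional isolated points.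
   Context: **Graphs.** All graphs $L$ are nonempty, finite and directed, with vertex set $L^0$, edge set $L^1$, and source and range maps $s,r:L^1\to L^0$. A path of length $m\ge1$ is written from right to left as $\lambda=\lambda_m\cdots\lambda_1$ with $\lambda_k\in L^1$ and $s(\lambda_{k+1})=r(\lambda_k)$; put $s(\lambda)=s(\lambda_1)$, $r(\lambda)=r(\lambda_m)$. Vertices are paths of length $0$ with $s(v)=r(v)=v$. $L^*$ is the set of all paths, $\lambda L^*$ the set of paths of the form $\lambda\mu$, and $wL^1$ the set of edges with range $w$. **Cuntz--Krieger algebra.** $\mathcal O_L$ is the universal unital C$^*$-algebra with generators $x_v$ ($v\in L^0$), $x_\lambda$ ($\lambda\in L^1$) such that: the $x_v$ are mutually orthogonal projections with $\sum_v x_v=1$; $\sum_{\lambda\in wL^1}x_\lambda x_\lambda^*=x_w$ for every $w\in L^0$ with $wL^1\ne\emptyset$, and $x_\lambda=x_{r(\lambda)}x_\lambda$ for $\lambda \in L^1$; $x_\lambda^*x_\lambda=x_{s(\lambda)}$ for $\lambda\in L^1$. For a path, $x_{\lambda_m\cdots\lambda_1}=x_{\lambda_m}\cdots x_{\lambda_1}$. Representations are unital $*$-representations on Hilbert spaces. The spectrum of a C$^*$-algebra is the set of unitary equivalence classes of its irreducible representations. **Non-self-adjoint algebra.** $\mathcal P_L$ is the universal unital C$^*$-algebra with generators $a_v$ ($v\in L^0$), $a_\lambda$ ($\lambda\in L^1$) such that the $a_v$ are mutually orthogonal projections summing to $1$, $a_\lambda=a_{s(\lambda)}a_\lambda a_{r(\lambda)}$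 for $\lambda\in L^1$, and $\sum_{\lambda\in wL^1}a_\lambda^*a_\lambda=a_w$ for every $w$ with $wL^1\neq\emptyset$. $\mathcal A_L\subset\mathcal P_L$ is the norm-closed (non-self-adjoint) subalgebra generated by all $a_v,a_\lambda$. An $\mathcal A_L$-module is the restriction to $\mathcal A_L$ of a unital $*$-representation of $\mathcal P_L$; concretely, it is a Hilbert space $H=\bigoplus_{v\in L^0}H_v$ with bounded operators $A_\lambda:H_{r(\lambda)}\to H_{s(\lambda)}$, $\lambda\in L^1$, such that for every $w$ with $wL^1\ne\emptyset$ the map $\bigoplus_{\lambda\in wL^1}A_\lambda:H_w\to\bigoplus_{\lambda\in wL^1}H_{s(\lambda)}$ is an isometry. It is one-dimensional if $\dim H=1$. For paths, $A_{\lambda_m\cdots\lambda_1}=A_{\lambda_1}\circ\cdots\circ A_{\lambda_m}$, and $A_v$ is the projection onto $H_v$. **Pythagorean functor $\Pi$ (on objects).** Given an $\mathcal A_L$-module $H$, take the algebraic direct sum over $\lambda\in L^*$ of copies of $H_{s(\lambda)}$, writing $(\lambda,\xi)$ for $\xi\in H_{s(\lambda)}$ in the copy indexed by $\lambda$. Quotient by the subspace spanned by all $(\lambda,\xi)-\sum_{\mu\in s(\lambda)L^1}(\lambda\mu,A_\mu\xi)$ with $s(\lambda)L^1\ne\emptyset$; write $[\lambda,\xi]$ for the class of $(\lambda,\xi)$. There is a unique inner product on the quotient with $\langle[\lambda,\xi],[\mu,\eta]\rangle=0$ if $\lambda\notin\mu L^*$ and $\mu\notin\lambda L^*$, and $\langle[\gamma,\xi],[\gamma\nu,\eta]\rangle=\langle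 A_\nu\xi,\eta\rangle_H$. $\Pi(H)$ is the Hilbert space completion, on which $\mathcal O_L$ acts by $x_\lambda\mapsto X_\lambda$, where $X_\lambda[\mu,\xi]=[\lambda\mu,\xi]$ if $s(\lambda)=r(\mu)$ and $X_\lambda[\mu,\xi]=0$ otherwise (for $\lambda$ a vertex or an edge). **Quantum spaces and their graphs.** - $C(S_q^{2n-1})$ is the universal unital C$^*$-algebra with generators $z_1,\dots,z_n$ and relations $z_jz_i=qz_iz_j$ for $i<j$; $z_j^*z_i=qz_iz_j^*$ for $i\ne j$; $z_i^*z_i=z_iz_i^*+(1-q^2)\sum_{j>i}z_jz_j^*$ for $1\le i\le n$; $\sum_{k=1}^n z_kz_k^*=1$. The graph $L_{2n-1}$ has vertices $1,\dots,n$ and exactly one edge $ji$, with source $i$ and range $j$, for each pair $1\le i\le j\le n$. It is known (Hong--Szymański) that $\mathcal O_{L_{2n-1}}\cong C(S_q^{2n-1})$. - $C(P_q)$ is the fixed-point subalgebra of $C(S_q^{2n-1})$ under the order-two automorphism $z_i\mapsto -z_i$ ($1\le i\le n$). The graph $L_{2n-1}^{(2)}$ has vertices $1,\dots,n$ and its edges are the paths of length two of $L_{2n-1}$, with their source and range. It is known that $\mathcal O_{L_{2n-1}^{(2)}}\cong C(P_q)$. - $C(L_q(p;\mathbf m))$ is the fixed-point subalgebra of $C(S_q^{2n-1})$ under the action of $\mathbb Z/p\mathbb Z$ generated by $z_i\mapsto\theta^{m_i}z_i$, where $\theta$ is a primitive $p$-th root of unity. A graph $G$ associated to $L_q(p;\mathbf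 m)$ means a finite directed graph with vertex set $\{v_i^s:1\le i\le n,\ s\in E_i\}$, the $E_i$ being finite nonempty sets, such that $\mathcal O_G\cong C(L_q(p;\mathbf m))$ and such that the number $N(v,w)$ of edges from $v$ to $w$ satisfies: $N(v_i^s,v_j^t)=0$ for all $s,t$ if $i>j$; $N(v_i^s,v_i^t)=0$ if $s\ne t$; $N(v_i^s,v_i^s)=1$. Such a graph is known to exist (Hong--Szymański, Brzeziński--Szymański, Gotfredsen--Zegers). - $C(S_q^{2n})$ is the universal unital C$^*$-algebra with generators $z_1,\dots,z_{n+1}$ satisfying the relations defining $C(S_q^{2n+1})$, namely $z_jz_i=qz_iz_j$ for $1\le i<j\le n+1$; $z_j^*z_i=qz_iz_j^*$ for $i\ne j$ in $\{1,\dots,n+1\}$; $z_i^*z_i=z_iz_i^*+(1-q^2)\sum_{j=i+1}^{n+1}z_jz_j^*$ for $1\le i\le n+1$; $\sum_{k=1}^{n+1}z_kz_k^*=1$; together with $z_{n+1}=z_{n+1}^*$. The graph $L_{2n}$ has vertices $1,\dots,n+2$ and exactly the following edges: one loop at each $i\in\{1,\dots,n\}$; one edge from $i$ to $j$ for each $1\le i<j\le n$; and for each $1\le i\le n$ one edge from $n+1$ to $i$ and one edge from $n+2$ to $i$. It is known (Hong--Szymański) that $\mathcal O_{L_{2n}}\cong C(S_q^{2n})$. *)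

(* Defs.v *)
From HB Require Import structures.
From mathcomp Require Import all_boot all_order all_algebra.
From mathcomp Require Import all_classical all_reals all_analysis.
From mathcomp Require Import complex.

Set Implicit Arguments.
Unset Strict Implicit.
Unset Printing Implicit Defensive.

Import Order.TTheory GRing.Theory Num.Theory.
Import numFieldNormedType.Exports.

Local Open Scope classical_set_scope.
Local Open Scope ring_scope.
Local Open Scope complex_scope.

(* {dot H for Num.conj} is linear in its first argument. *)
HB.mixin Record CompleteNormedModule_isHilbert (R : realType) H
    & CompleteNormedModule R[i] H := {
  dotp : {dot H for Num.conj};
  dotp_norm : forall x : H, `|x| ^+ 2 = dotp x x
}.

#[short(type="hilbertType")]
HB.structure Definition Hilbert (R : realType) :=
  {H of CompleteNormedModule R[i] H & CompleteNormedModule_isHilbert R H}.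

(* Algebras and normed modules have no common extension in the hierarchy, so
   the norm of a C*-algebra and its completeness are given by hand.  [algType]
   requires 1 != 0; leaving out the zero algebra does not affect universal
   properties, as every map into it is a morphism. *)
HB.mixin Record isCstarAlgebra (R : realType) A & GRing.Algebra R[i] A := {
  star : A -> A;
  starK : involutive star;
  starD : {morph star : a b / a + b};
  starZ : forall (k : R[i]) (a : A), star (k *: a) = Num.conj k *: star a;
  starM : forall a b : A, star (a * b) = star b * star a;
  cnorm : A -> R;
  cnorm0_eq0 : forall a : A, cnorm a = 0 -> a = 0;
  cnormD : forall a b : A, cnorm (a + b) <= cnorm a + cnorm b;
  cnormZ : forall (k : R[i]) (a : A), (cnorm (k *: a))%:C = `|k| * (cnorm a)%:C;
  cnormM : forall a b : A, cnorm (a * b) <= cnorm a * cnorm b;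
  cnorm_starM : forall a : A, cnorm (star a * a) = cnorm a ^+ 2;
  cnorm_complete : forall u : nat -> A,
    (forall e : R, 0 < e -> exists N : nat, forall m k : nat,
       (N <= m)%N -> (N <= k)%N -> cnorm (u m - u k) < e) ->
    exists l : A, forall e : R, 0 < e -> exists N : nat, forall k : nat,
       (N <= k)%N -> cnorm (u k - l) < e
}.

#[short(type="cstarAlgType")]
HB.structure Definition CstarAlgebra (R : realType) :=
  {A of GRing.Algebra R[i] A & isCstarAlgebra R A}.

Record starHom (R : realType) (A B : cstarAlgType R) := StarHom {
  star_fun :> A -> B;
  star_fun_linear : linear star_fun;
  star_fun_monoid : monoid_morphism star_fun;
  star_fun_star : {morph star_fun : a / star a}
}.

(* [g] exhibits [A] as the universal unital C*-algebra generated by a family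
   indexed by [G] subject to the relations [rel]. *)
Definition universal (R : realType) (G : Type)
    (rel : forall B : cstarAlgType R, (G -> B) -> Prop)
    (A : cstarAlgType R) (g : G -> A) : Prop :=
  rel A g /\
  forall (B : cstarAlgType R) (b : G -> B), rel B b ->
    (exists f : starHom A B, forall i, f (g i) = b i) /\
    (forall f f' : starHom A B,
       (forall i, f (g i) = b i) -> (forall i, f' (g i) = b i) -> f =1 f').

Definition bounded_op (R : realType) (H K : hilbertType R) (T : H -> K) : Prop :=
  linear T /\ exists c : R[i], forall x, `|T x| <= c * `|x|.

Record rep (R : realType) (A : cstarAlgType R) := Rep {
  rep_space : hilbertType R;
  rep_op :> A -> rep_space -> rep_space;
  rep_bounded : forall a, bounded_op (rep_op a);
  rep_linear : forall (k : R[i]) (a b : A) x,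
    rep_op (k *: a + b) x = k *: rep_op a x + rep_op b x;
  rep_one : forall x, rep_op 1 x = x;
  rep_mul : forall a b x, rep_op (a * b) x = rep_op a (rep_op b x);
  rep_star : forall a x y, dotp (rep_op a x) y = dotp x (rep_op (star a) y)
}.

Section RepPullback.
Variables (R : realType) (A B : cstarAlgType R) (phi : starHom A B) (rho : rep B).

Let op (a : A) : rep_space rho -> rep_space rho := rho (phi a).

Let op_linear k a b x : op (k *: a + b) x = k *: op a x + op b x.
Proof. by rewrite /op star_fun_linear rep_linear. Qed.

Let op_one x : op 1 x = x.
Proof. by rewrite /op (star_fun_monoid phi).1 rep_one. Qed.

Let op_mul a b x : op (a * b) x = op a (op b x).
Proof. by rewrite /op (star_fun_monoid phi).2 rep_mul. Qed.

Let op_star a x y : dotp (op a x) y = dotp x (op (star a) y).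
Proof. by rewrite /op star_fun_star rep_star. Qed.

Definition rep_pullback : rep A :=
  Rep (fun a => rep_bounded rho (phi a)) op_linear op_one op_mul op_star.
End RepPullback.

Definition subspace (K : pzRingType) (V : lmodType K) (S : set V) : Prop :=
  S 0 /\ forall (k : K) u v, S u -> S v -> S (k *: u + v).

Definition irreducible (R : realType) (A : cstarAlgType R) (rho : rep A) : Prop :=
  (exists x : rep_space rho, x != 0) /\
  forall S : set (rep_space rho), subspace S -> closed S ->
    (forall a x, S x -> S (rho a x)) -> S = [set 0] \/ S = setT.

Definition unitarily_equivalent (R : realType) (A : cstarAlgType R)
    (rho sigma : rep A) : Prop :=
  exists U : rep_space rho -> rep_space sigma,
    [/\ linear U, forall x y, dotp (U x) (U y) = dotp x y,
        forall y, exists x, U x = y & forall a x, U (rho a x) = sigma a (U x)].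

(* The classes of the [rho i] form the spectrum, without repetition. *)
Definition parametrises_spectrum (R : realType) (A : cstarAlgType R) (I : Type)
    (rho : I -> rep A) : Prop :=
  [/\ forall i, irreducible (rho i),
      forall i j, unitarily_equivalent (rho i) (rho j) -> i = j &
      forall sigma : rep A, irreducible sigma ->
        exists i, unitarily_equivalent sigma (rho i)].

Record digraph := Digraph {
  vert : finType;
  edge : finType;
  src : edge -> vert;
  rng : edge -> vert
}.

Definition n_edges (L : digraph) (v w : vert L) : nat :=
  #|[set e : edge L | (src e == v) && (rng e == w)]|.

(* [inl v] and [inr e] index the generators x_v and x_e. *)
Definition ck_relations (L : digraph) (R : realType) (B : cstarAlgType R)
    (x : vert L + edge L -> B) : Prop :=
  [/\ forall v, star (x (inl v)) = x (inl v) /\ x (inl v) * x (inl v) = x (inl v),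
      forall v w, v != w -> x (inl v) * x (inl w) = 0
    & \sum_v x (inl v) = 1] /\
  [/\ forall w, (exists e, rng e = w) ->
        \sum_(e | rng e == w) x (inr e) * star (x (inr e)) = x (inl w),
      forall e, x (inr e) = x (inl (rng e)) * x (inr e)
    & forall e, star (x (inr e)) * x (inr e) = x (inl (src e))].

Definition is_cuntz_krieger (L : digraph) (R : realType) (O : cstarAlgType R)
    (x : vert L + edge L -> O) : Prop :=
  universal (fun B => @ck_relations L R B) x.

(* A path l_m ... l_1 is the pair of its range and of [:: l_m; ...; l_1]; a
   vertex v is (v, [::]).  The type also contains pairs that are not paths,
   which [is_path] excludes. *)
Definition walk (L : digraph) : Type := (vert L * seq (edge L))%type.

Fixpoint composable (L : digraph) (v : vert L) (es : seq (edge L)) : bool :=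
  if es is e :: es' then (rng e == v) && composable (src e) es' else true.

Definition is_path (L : digraph) (p : walk L) : bool := composable p.1 p.2.
Definition path_rng (L : digraph) (p : walk L) : vert L := p.1.
Definition path_src (L : digraph) (p : walk L) : vert L :=
  last p.1 (map (@src L) p.2).

(* Meaningful when path_src p = path_rng q. *)
Definition path_cat (L : digraph) (p q : walk L) : walk L := (p.1, p.2 ++ q.2).

Definition short_path (L : digraph) (g : vert L + edge L) : walk L :=
  match g with inl v => (v, [::]) | inr e => (rng e, [:: e]) end.

(* [p] belongs to [q L^*]. *)
Definition path_extends (L : digraph) (p q : walk L) : Prop :=
  exists r : walk L,
    [/\ is_path r, path_src q = path_rng r & p = path_cat q r].

(* The Hilbert space is the orthogonal direct sum of the ranges H_v of the
   projections [mod_v v], and [mod_e e] : H_(rng e) -> H_(src e) is extended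
   by zero to the whole space. *)
Record ped_module (R : realType) (L : digraph) := PedModule {
  mod_space : hilbertType R;
  mod_v : vert L -> mod_space -> mod_space;
  mod_e : edge L -> mod_space -> mod_space;
  mod_v_bounded : forall v, bounded_op (mod_v v);
  mod_v_idem : forall v x, mod_v v (mod_v v x) = mod_v v x;
  mod_v_selfadj : forall v x y, dotp (mod_v v x) y = dotp x (mod_v v y);
  mod_v_orth : forall v w x, v != w -> mod_v v (mod_v w x) = 0;
  mod_v_sum : forall x, \sum_v mod_v v x = x;
  mod_e_bounded : forall e, bounded_op (mod_e e);
  mod_e_supp : forall e x, mod_e e x = mod_v (src e) (mod_e e (mod_v (rng e) x));
  mod_e_isometry : forall w, (exists e, rng e = w) ->
    forall x, mod_v w x = x -> \sum_(e | rng e == w) `|mod_e e x| ^+ 2 = `|x| ^+ 2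
}.

Definition mod_fiber (R : realType) (L : digraph) (M : ped_module R L)
    (v : vert L) : set (mod_space M) := [set x | mod_v v x = x].

Definition one_dimensional (R : realType) (L : digraph) (M : ped_module R L) : Prop :=
  exists2 x : mod_space M, x != 0 & forall y, exists k : R[i], y = k *: x.

Definition mod_path (R : realType) (L : digraph) (M : ped_module R L)
    (p : walk L) (x : mod_space M) : mod_space M :=
  foldl (fun y e => mod_e e y) (mod_v p.1 x) p.2.

Definition linear_span (K : pzRingType) (V : lmodType K) (S : set V) : set V :=
  [set u | exists (k : nat) (c : 'I_k -> K) (v : 'I_k -> V),
     (forall i, S (v i)) /\ u = \sum_i c i *: v i].

Section PythagoreanFunctor.
Variables (R : realType) (L : digraph) (M : ped_module R L).
Local Notation H := (mod_space M).

(* The algebraic direct sum of the H_(s(p)), p in L^*, as families indexed by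
   [walk L], and the element (p, x) of it. *)
Definition direct_sum : set (walk L -> H) :=
  [set f | finite_set [set p | f p != 0] /\
     forall p, if is_path p then mod_fiber (path_src p) (f p) else f p = 0].

Definition ds_elt (p : walk L) (x : H) : walk L -> H :=
  fun q => if q == p then x else 0.

Definition pyth_relators : set (walk L -> H) :=
  [set f | exists (p : walk L) (x : H),
     [/\ is_path p, mod_fiber (path_src p) x, exists e, rng e = path_src p
       & f = ds_elt p x -
             \sum_(e | rng e == path_src p)
                ds_elt (path_cat p (short_path (inr e))) (mod_e e x)]].

(* [rho] is Pi(M): cls p x is the class [p, x], and the map induced by cls on
   the direct sum identifies its quotient by the span of the relators with a
   dense subspace of the Hilbert space of [rho]. *)
Definition is_Pi (O : cstarAlgType R) (x : vert L + edge L -> O) (rho : rep O) : Prop :=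
  exists cls : walk L -> H -> rep_space rho,
    let quot (f : walk L -> H) := \sum_(p \in [set p | f p != 0]) cls p (f p) in
    [/\ forall p (k : R[i]) xi eta, is_path p ->
          mod_fiber (path_src p) xi -> mod_fiber (path_src p) eta ->
          cls p (k *: xi + eta) = k *: cls p xi + cls p eta,
        forall f, direct_sum f -> (quot f = 0 <-> linear_span pyth_relators f)
      & dense (quot @` direct_sum)] /\
    [/\ forall p r xi eta, is_path p -> is_path r ->
          mod_fiber (path_src p) xi -> mod_fiber (path_src r) eta ->
          ~ path_extends p r -> ~ path_extends r p ->
          dotp (cls p xi) (cls r eta) = 0,
        forall p r xi eta, is_path p -> is_path r -> path_src p = path_rng r ->
          mod_fiber (path_src p) xi -> mod_fiber (path_src r) eta ->
          dotp (cls p xi) (cls (path_cat p r) eta) = dotp (mod_path r xi) eta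
      & forall (g : vert L + edge L) p xi, is_path p ->
          mod_fiber (path_src p) xi ->
          rho (x g) (cls p xi) =
            if path_src (short_path g) == path_rng p
            then cls (path_cat (short_path g) p) xi else 0].
End PythagoreanFunctor.

(* The identification [phi] transports representations of O_L to representations
   of [A]; [I] indexes the one-dimensional modules. *)
Definition Pi_parametrises (R : realType) (L : digraph) (O : cstarAlgType R)
    (x : vert L + edge L -> O) (A : cstarAlgType R) (phi : starHom A O)
    (I : Type) (M : I -> ped_module R L) : Prop :=
  exists2 rho : I -> rep O, forall i, is_Pi (M i) x (rho i)
    & parametrises_spectrum (fun i => rep_pullback phi (rho i)).

Definition circle (R : realType) := {z : R[i] | `|z| == 1}.

Definition sphere_relations (n : nat) (R : realType) (q : R)
    (B : cstarAlgType R) (z : 'I_n -> B) : Prop :=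
  [/\ forall i j : 'I_n, (i < j)%N -> z j * z i = q%:C *: (z i * z j),
      forall i j : 'I_n, i != j -> star (z j) * z i = q%:C *: (z i * star (z j)),
      forall i : 'I_n, star (z i) * z i =
        z i * star (z i) +
        (1 - q ^+ 2)%:C *: \sum_(j < n | (i < j)%N) z j * star (z j)
    & \sum_k z k * star (z k) = 1].

(* C(S_q^(2n-1)), with [n] generators. *)
Definition is_odd_sphere (n : nat) (R : realType) (q : R) (A : cstarAlgType R)
    (z : 'I_n -> A) : Prop :=
  universal (@sphere_relations n R q) z.

(* C(S_q^(2n)), with [n.+1] generators. *)
Definition is_even_sphere (n : nat) (R : realType) (q : R) (A : cstarAlgType R)
    (z : 'I_n.+1 -> A) : Prop :=
  universal (fun B (b : 'I_n.+1 -> B) =>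
    sphere_relations q b /\ star (b ord_max) = b ord_max) z.

(* [iota] identifies [B] with the fixed-point subalgebra of [sigma]. *)
Definition is_fixed_algebra (R : realType) (A B : cstarAlgType R)
    (sigma : starHom A A) (iota : starHom B A) : Prop :=
  injective iota /\ range iota = [set a | sigma a = a].

Definition is_projective_space (n : nat) (R : realType) (q : R)
    (A B : cstarAlgType R) (z : 'I_n -> A) (iota : starHom B A) : Prop :=
  is_odd_sphere q z /\
  exists sigma : starHom A A,
    [/\ bijective sigma, forall i, sigma (z i) = - z i & is_fixed_algebra sigma iota].

(* The fixed points of the Z/p-action are those of its generator [sigma]. *)
Definition is_lens_space (n : nat) (R : realType) (q : R) (p : nat)
    (m : 'I_n -> nat) (A B : cstarAlgType R) (z : 'I_n -> A) (iota : starHom B A) :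
    Prop :=
  is_odd_sphere q z /\
  exists (theta : R[i]) (sigma : starHom A A),
    [/\ p.-primitive_root theta, bijective sigma,
        forall i, sigma (z i) = theta ^+ m i *: z i & is_fixed_algebra sigma iota].

(* An edge of the three graphs below, except in [path2_graph], is the pair of
   its source and its range, and vertex k is the ordinal k - 1. *)
Definition odd_sphere_graph (n : nat) : digraph :=
  @Digraph 'I_n {e : 'I_n * 'I_n | (e.1 <= e.2)%N}
    (fun e => (val e).1) (fun e => (val e).2).

Definition path2_graph (L : digraph) : digraph :=
  @Digraph (vert L) {l : edge L * edge L | src l.1 == rng l.2}
    (fun l => src (val l).2) (fun l => rng (val l).1).

(* Ranges are < n; a source < n gives the loops and the edges i -> j with
   i < j, and the sources n and n + 1 are the two extra vertices. *)
Definition even_sphere_graph (n : nat) : digraph :=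
  @Digraph 'I_n.+2
    {e : 'I_n.+2 * 'I_n.+2 | (e.2 < n)%N && ((e.1 <= e.2)%N || (n <= e.1)%N)}
    (fun e => (val e).1) (fun e => (val e).2).

(* [v] labels the vertices v_i^s of [G] by pairs (i, s) with s in E i. *)
Definition lens_graph_shape (n : nat) (E : 'I_n -> finType) (G : digraph)
    (v : {i : 'I_n & E i} -> vert G) : Prop :=
  [/\ bijective v,
      forall i, (0 < #|E i|)%N,
      forall (i j : 'I_n) (s : E i) (t : E j), (j < i)%N ->
        n_edges (v (Tagged E s)) (v (Tagged E t)) = 0%N,
      forall (i : 'I_n) (s t : E i), s != t ->
        n_edges (v (Tagged E s)) (v (Tagged E t)) = 0%N
    & forall (i : 'I_n) (s : E i),
        n_edges (v (Tagged E s)) (v (Tagged E s)) = 1%N].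

(* Main.v *)
(* The four graphs have no cycles besides loops, a vertex receiving an edge
   carries exactly one loop, and only the isomorphism with the Cuntz-Krieger
   algebra is used of the quantum spaces.  For such a graph, let [rho] be an
   irreducible representation and [v] a vertex of least height with
   [rho x_v <> 0].  No edge from another vertex into [v] acts, so the loop at [v]
   acts by a unitary on the range of [x_v].  A subspace of this range reducing the
   loop generates an invariant subspace of [rho], so it is trivial; spectral
   theory, replaced by square roots in the C*-algebra, makes the loop a scalar,
   and the range is a line.  A unit vector of it behaves as the class of [v] in
   Pi(M_{v,z}), whose orthonormal basis is formed by the paths starting at [v] that do
   not begin with the loop; on this basis the shift operators give the model to
   which [rho] is equivalent.  The models are told apart by [v], and by the
   eigenvalue of the loop at [v]. *)
From HB Require Import structures.
Require Import Defs.
From mathcomp Require Import all_boot all_order all_algebra.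
From mathcomp Require Import all_classical all_reals all_analysis.
From mathcomp Require Import complex finmap ring lra zify.
From mathcomp.analysis.showcase Require Import summability.

Set Implicit Arguments.
Unset Strict Implicit.
Unset Printing Implicit Defensive.

Import Order.TTheory GRing.Theory Num.Theory.
Import numFieldNormedType.Exports.

Local Open Scope classical_set_scope.
Local Open Scope ring_scope.
Local Open Scope complex_scope.

(** * The Hilbert space l2 *)

(** The universal property of [O] speaks of C*-algebras alone, so a representation on a given
    Hilbert space is available only after its bounded operators have been made into a C*-algebra.
    The same property is also the only access to the elements of [O]: what holds on the generators
    spreads through norm-closed subalgebras, and taking norm limits inside a representation requires
    representations to be contractive. This is one use of square roots. The other is at the loop
    [u]. Where a spectral projection would split the range of [x_v], a sign argument takes its
    place: for each unimodular [w] the real part of [w u] is plus or minus a positive square root,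
    so the numerical range of [u] lies on one side of every line through 0, which confines it to one
    such line. [is_Pi] asks for classes with dense span, hence no completion is formed: l2 over the
    reduced paths already carries the classes. At a vertex without loop the parameter [z] does not
    act, whence the two isolated points of the even spheres. *)

Section CauchySchwarz.
Variables (C : numClosedFieldType) (U : lmodType C) (form : {dot U for Num.conj}).

Lemma form_conj u v : form u v = (form v u)^*%R.
Proof. by rewrite hermC expr0 mul1r. Qed.

Lemma Cauchy_Schwarz u v : `|form u v| ^+ 2 <= form u u * form v v.
Proof.
have [->|v0] := eqVneq v 0.
  by rewrite (linear0r form u) (linear0r form 0) normr0 expr0n mulr0.
have vv : 0 < form v v by rewrite dnorm_gt0.
have vr : (form v v)^*%R = form v v by rewrite -form_conj.
have := dnorm_ge0 form (u - (form u v / form v v) *: v).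
rewrite dnormB dnormZ linearZr_LR /= !rmorphM /= !fmorphV /= !vr ?conjCK -form_conj.
rewrite normrM normfV (ger0_norm (ltW vv)) expr_div_n.
rewrite [form v u]form_conj.
set a := form u v; set b := form v v.
have -> : `|a| ^+ 2 = a * a^*%R by rewrite normCK.
have b0 : b != 0 by rewrite gt_eqF.
have -> : form u u + a * a^*%R / b ^+ 2 * b - (a^*%R / b * a + a / b * a^*%R) =
   form u u - a * a^*%R / b by field.
by rewrite subr_ge0 ler_pdivrMr.
Qed.
End CauchySchwarz.

(** * Unordered sums of real families *)

Section UnorderedSum.
Variables (R : realType) (T : choiceType).
Implicit Types (h g : T -> R) (A B : {fset T}).

#[local] Existing Instance totally_filter.

Definition psum h A : R := \sum_(i <- A) h i.

Definition usummable h := cvg (psum h @ totally).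

Definition usum h : R := lim (psum h @ totally).

Lemma le_psum h A B : (forall i, 0 <= h i) -> (A `<=` B)%fset ->
  psum h A <= psum h B.
Proof.
move=> h0 AB; rewrite /psum [leRHS](big_fsetID _ (mem A)) /=.
have -> : [fset x in B | x \in A]%fset = A.
  by apply/fsetP => x; rewrite !inE /= andbC; case: (boolP (x \in A)) => //= /(fsubsetP AB).
by rewrite lerDl sumr_ge0.
Qed.

(** Partial sums of a nonnegative family increase with the finite set, so a bounded net of them
    converges to its supremum. *)
Lemma usum_bounded h c : (forall i, 0 <= h i) -> (forall A, psum h A <= c) ->
  psum h @ totally --> sup (range (psum h)).
Proof.
move=> h0 hc.
have hs : has_sup (range (psum h)).
  split; first by exists (psum h fset0), fset0.
  by exists c => _ [A _ <-].
apply/cvgrPdist_lt => e e0.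
have [_ [A _ <-] hA] := sup_adherent e0 hs.
exists A => // B AB /=; rewrite ger0_norm ?subr_ge0; last first.
  by apply: ub_le_sup; [exact: hs.2|exists B].
by rewrite ltrBlDr -ltrBlDl; apply: lt_le_trans hA _; exact: le_psum.
Qed.

Lemma usummable_bounded h c : (forall i, 0 <= h i) -> (forall A, psum h A <= c) ->
  usummable h.
Proof. by move=> h0 /(usum_bounded h0) H; apply/cvg_ex; eexists; exact: H. Qed.

Lemma psum_le_usum h c A : (forall i, 0 <= h i) -> (forall A, psum h A <= c) ->
  psum h A <= usum h.
Proof.
move=> h0 hc; rewrite /usum (cvg_lim _ (usum_bounded h0 hc))//.
apply: ub_le_sup; last by exists A.
by exists c => _ [B _ <-].
Qed.

Lemma usum_le h c : usummable h -> (forall A, psum h A <= c) -> usum h <= c.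
Proof. by move=> hs hc; apply: limr_le => //; apply: nearW. Qed.

Lemma cvg_usum h : usummable h -> psum h @ totally --> usum h.
Proof. by []. Qed.

Lemma cvg_usumD h g k : usummable h -> usummable g ->
  psum (fun i => k * h i + g i) @ totally --> k * usum h + usum g.
Proof.
move=> hs gs.
rewrite (_ : psum _ = fun A => k * psum h A + psum g A); last first.
  by apply/funext => A; rewrite /psum big_split /= mulr_sumr.
exact: cvgD (cvgM (cvg_cst k) (cvg_usum hs)) (cvg_usum gs).
Qed.

Lemma usummableD h g k : usummable h -> usummable g ->
  usummable (fun i => k * h i + g i).
Proof. by move=> hs gs; apply/cvg_ex; eexists; exact: cvg_usumD. Qed.

Lemma usumD h g k : usummable h -> usummable g ->
  usum (fun i => k * h i + g i) = k * usum h + usum g.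
Proof. by move=> hs gs; rewrite /usum (cvg_lim _ (@cvg_usumD _ _ k hs gs)). Qed.

(** [h] is the difference of the nonnegative families [h + g] and [g], whose partial sums are
    bounded. *)
Lemma usummable_dominated h g c : (forall i, `|h i| <= g i) ->
  (forall A, psum g A <= c) -> usummable h.
Proof.
move=> hg gc.
have g0 i : 0 <= g i by apply: le_trans (hg i).
have gs := usummable_bounded g0 gc.
(* The coefficients [-1] and [1] match the shape [k * h + g] of [usummableD]. *)
rewrite (_ : h = fun i => (-1) * g i + (1 * h i + g i)); last first.
  by apply/funext => i; rewrite mulN1r mul1r addrCA addNr addr0.
apply: usummableD => //; apply: (@usummable_bounded _ (c + c)) => [i|A].
  by have := hg i; rewrite ler_norml mul1r => /andP[]; rewrite lerNl -subr_ge0 opprK addrC.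
apply: le_trans (lerD (gc A) (gc A)); rewrite /psum -big_split; apply: ler_sum => i _.
by rewrite mul1r lerD2r; apply: le_trans (ler_norm _) (hg i).
Qed.

Lemma usum_finite h A : (forall i, i \notin A -> h i = 0) -> usum h = psum h A.
Proof.
move=> hA; apply: cvg_lim => //; apply: cvg_near_cst.
exists A => // B AB /=; rewrite /psum (big_fsetID _ (mem A)) /=.
rewrite [X in _ + X]big1_fset ?addr0 => [|i]; last first.
  by rewrite !inE => /andP[_ /hA].
congr (\sum_(i <- enum_fset _) _).
by apply/fsetP => x; rewrite !inE /= andbC; case: (boolP (x \in A)) => //= /(fsubsetP AB).
Qed.
End UnorderedSum.

Section NormSquare.
Variable R : realType.
Implicit Types z w : R[i].

(** The squared modulus as an element of [R], since the norm of [R[i]] takes values in [R[i]] while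
    unordered sums are real. *)
Definition nsq z : R := complex.Re z ^+ 2 + complex.Im z ^+ 2.

Lemma nsqE z : (nsq z)%:C = `|z| ^+ 2.
Proof. exact: add_Re2_Im2. Qed.

Lemma nsq_ge0 z : 0 <= nsq z.
Proof. by rewrite addr_ge0 ?sqr_ge0. Qed.

Lemma nsq0 : nsq 0 = 0.
Proof. by rewrite /nsq /= expr0n addr0. Qed.

Lemma nsqM z w : nsq (z * w) = nsq z * nsq w.
Proof. by case: z w => [a b] [c d]; rewrite /nsq /=; ring. Qed.

Lemma nsq_eq0 z : (nsq z == 0) = (z == 0).
Proof.
by rewrite -(inj_eq (@complexI _)) nsqE sqrf_eq0 normr_eq0.
Qed.

Lemma nsqD_le z w : nsq (z + w) <= 2 * nsq z + 2 * nsq w.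
Proof.
case: z w => [a b] [c d]; rewrite /nsq /=.
by move: (sqr_ge0 (a - c)) (sqr_ge0 (b - d)); nra.
Qed.

Lemma Re_mulJ_le z w : `|complex.Re (z * w^*)| <= nsq z + nsq w.
Proof. by case: z w => [a b] [c d]; rewrite /nsq /= ler_norml; apply/andP; split;
  move: (sqr_ge0 (a - c)) (sqr_ge0 (a + c)) (sqr_ge0 (b - d)) (sqr_ge0 (b + d))
    (sqr_ge0 (a - d)) (sqr_ge0 (a + d)) (sqr_ge0 (b - c)) (sqr_ge0 (b + c)); nra. Qed.

Lemma Im_mulJ_le z w : `|complex.Im (z * w^*)| <= nsq z + nsq w.
Proof. by case: z w => [a b] [c d]; rewrite /nsq /= ler_norml; apply/andP; split;
  move: (sqr_ge0 (a - c)) (sqr_ge0 (a + c)) (sqr_ge0 (b - d)) (sqr_ge0 (b + d))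
    (sqr_ge0 (a - d)) (sqr_ge0 (a + d)) (sqr_ge0 (b - c)) (sqr_ge0 (b + c)); nra. Qed.
End NormSquare.

Section L2.
Variables (R : realType) (T : choiceType) (D : pred T).
Implicit Types (f g : T -> R[i]) (A : {fset T}).

(** The functions live on all of [T] and vanish off [D]. With [D] the reduced paths, a coordinate
    such as [f (e :: es)] then makes sense for every list and is 0 when the list is not reduced. *)
Definition l2_pred : pred (T -> R[i]) := fun f =>
  `[< (forall i, ~~ D i -> f i = 0) /\
      exists c : R, forall A, psum (fun i => nsq (f i)) A <= c >].

Lemma l2_pred_closed : submod_closed l2_pred.
Proof.
split.
  apply/asboolP; split=> //; exists 0 => A.
  by rewrite /psum big1 // => i _; rewrite nsq0.
move=> k f g /asboolP[f0 [c hc]] /asboolP[g0 [d hd]]; apply/asboolP; split.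
  move=> i Di; have -> : (k *: f + g) i = k * f i + g i by [].
  by rewrite f0 // g0 // mulr0 addr0.
exists (2 * (nsq k * c) + 2 * d) => A.
apply: (@le_trans _ _ (2 * (nsq k * psum (fun i => nsq (f i)) A) +
   2 * psum (fun i => nsq (g i)) A)).
  rewrite /psum !mulr_sumr -big_split /=; apply: ler_sum => i _.
  by rewrite -nsqM; exact: nsqD_le.
apply: lerD; rewrite ler_pM2l ?ltr0n //.
by apply: ler_wpM2l; [exact: nsq_ge0|exact: hc].
Qed.

HB.instance Definition _ := GRing.isSubmodClosed.Build R[i] (T -> R[i]) l2_pred
  (GRing.submod_closed_semi l2_pred_closed).

Record l2 := L2 { l2_fun :> T -> R[i]; _ : l2_fun \in l2_pred }.
HB.instance Definition _ := [isSub for l2_fun].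
HB.instance Definition _ := [Choice of l2 by <:].
HB.instance Definition _ := [SubChoice_isSubLmodule of l2 by <:].

Section Dot.

Lemma l2_out (f : l2) i : ~~ D i -> f i = 0.
Proof. by case: f => f /= /asboolP[+ _]; exact. Qed.

Lemma l2_bounded (f : l2) : exists c : R, forall A, psum (fun i => nsq (f i)) A <= c.
Proof. by case: f => f /= /asboolP[]. Qed.

Lemma l2E k (f g : l2) i : (k *: f + g : l2) i = k * f i + g i.
Proof. by []. Qed.

Lemma l2P (f g : l2) : (forall i, f i = g i) -> f = g.
Proof. by move=> fg; apply/val_inj/funext. Qed.

Lemma usummable_nsq (f : l2) : usummable (fun i => nsq (f i)).
Proof.
have [c hc] := l2_bounded f.
by apply: usummable_bounded hc => i; exact: nsq_ge0.
Qed.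

Let bounded2 (f g : l2) : exists c, forall A, psum (fun i => nsq (f i) + nsq (g i)) A <= c.
Proof.
have [c hc] := l2_bounded f; have [d hd] := l2_bounded g.
by exists (c + d) => A; rewrite /psum big_split; apply: lerD; [exact: hc|exact: hd].
Qed.

Lemma usummable_Re (f g : l2) : usummable (fun i => complex.Re (f i * (g i)^*)).
Proof.
have [c hc] := bounded2 f g.
by apply: usummable_dominated hc => i; exact: Re_mulJ_le.
Qed.

Lemma usummable_Im (f g : l2) : usummable (fun i => complex.Im (f i * (g i)^*)).
Proof.
have [c hc] := bounded2 f g.
by apply: usummable_dominated hc => i; exact: Im_mulJ_le.
Qed.

(** Real and imaginary parts are summed separately because [usum] is real-valued. *)
Definition l2_dot (f g : l2) : R[i] :=
  usum (fun i => complex.Re (f i * (g i)^*)) +i* usum (fun i => complex.Im (f i * (g i)^*)).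

Lemma l2_dotDl k (f g h : l2) : l2_dot (k *: f + g) h = k * l2_dot f h + l2_dot g h.
Proof.
have sR := usummable_Re; have sI := usummable_Im.
have -> : l2_dot (k *: f + g) h =
  usum (fun i => complex.Re k * complex.Re (f i * (h i)^*) +
     (- complex.Im k * complex.Im (f i * (h i)^*) + complex.Re (g i * (h i)^*))) +i*
  usum (fun i => complex.Re k * complex.Im (f i * (h i)^*) +
     (complex.Im k * complex.Re (f i * (h i)^*) + complex.Im (g i * (h i)^*))).
  by congr (_ +i* _); congr usum; apply/funext => i; rewrite l2E;
    case: k (f i) (g i) (h i) => [a b] [c d] [a' b'] [c' d'] /=; ring.
rewrite !usumD //; try exact: usummableD.
by rewrite /l2_dot; case: k => a b /=; congr (_ +i* _); ring.
Qed.

Lemma l2_dotC (f g : l2) : l2_dot f g = (l2_dot g f)^*.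
Proof.
rewrite /l2_dot /=; congr (_ +i* _).
  by congr usum; apply/funext => i; case: (f i) (g i) => [a b] [c d] /=; ring.
(* Negation is put in the shape [k * h + g] of [usumD], with a zero family in the role of [g]. *)
transitivity (usum (fun i => - 1 * complex.Im (g i * (f i)^*) + complex.Re ((0 : l2) i * (f i)^*))).
  by congr usum; apply/funext => i; case: (f i) (g i) => [a b] [c d] /=; ring.
rewrite usumD; [|exact: usummable_Im|exact: usummable_Re].
rewrite mulN1r (@usum_finite _ _ (fun i => complex.Re ((0 : l2) i * _)) fset0).
  by rewrite /psum big_seq_fset0 addr0.
by move=> i _; rewrite (_ : (0 : l2) i = 0) // mul0r.
Qed.

Lemma l2_dotE (f : l2) : l2_dot f f = (usum (fun i => nsq (f i)))%:C.
Proof.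
rewrite /l2_dot; congr (_ +i* _).
  by congr usum; apply/funext => i; rewrite /nsq; case: (f i) => a b /=; ring.
rewrite (@usum_finite _ _ _ fset0) ?/psum ?big_seq_fset0 // => i _.
by case: (f i) => a b /=; ring.
Qed.

Lemma psum_nsq_le (f : l2) A : psum (fun i => nsq (f i)) A <= usum (fun i => nsq (f i)).
Proof.
by have [c hc] := l2_bounded f; apply: psum_le_usum hc => i; exact: nsq_ge0.
Qed.

Lemma l2_dot_gt0 (f : l2) : f != 0 -> 0 < l2_dot f f.
Proof.
move=> f0; rewrite l2_dotE ltcR.
have [i fi] : exists i, f i != 0.
  apply: contrapT => H; case/eqP: f0; apply: l2P => i.
  by apply/eqP; apply/negPn/negP => fi; apply: H; exists i.
apply: lt_le_trans (psum_nsq_le f [fset i]%fset).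
by rewrite /psum big_seq_fset1 lt_def nsq_eq0 fi nsq_ge0.
Qed.

Let dot_zmodl (g : l2) : zmod_morphism (l2_dot^~ g).
Proof.
by move=> a b /=; rewrite addrC -scaleN1r l2_dotDl mulN1r addrC.
Qed.

Let dot_scalel (g : l2) : scalable_for *%R (l2_dot^~ g).
Proof.
move=> k a /=; rewrite -[k *: a]addr0 l2_dotDl -[X in _ + l2_dot X _](subrr a).
by rewrite dot_zmodl subrr addr0.
Qed.

Let dot_zmodr (f : l2) : zmod_morphism (l2_dot f).
Proof.
by move=> a b /=; rewrite l2_dotC dot_zmodl rmorphB /= (l2_dotC f a) (l2_dotC f b).
Qed.

Let dot_scaler (f : l2) : scalable_for (Num.conj \; *%R) (l2_dot f).
Proof.
by move=> k a /=; rewrite l2_dotC dot_scalel rmorphM /= [in RHS]l2_dotC.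
Qed.

Let dot_herm (f g : l2) : l2_dot f g = (-1) ^+ false * Num.conj (l2_dot g f).
Proof. by rewrite expr0 mul1r; exact: l2_dotC. Qed.

HB.instance Definition _ := isBilinear.Build R[i] l2 l2 R[i] *%R (Num.conj \; *%R)
  l2_dot dot_zmodl dot_zmodr dot_scalel dot_scaler.
HB.instance Definition _ := isHermitianSesquilinear.Build R[i] l2 false Num.conj
  l2_dot dot_herm.
HB.instance Definition _ := isDotProduct.Build R[i] l2 l2_dot l2_dot_gt0.

Definition l2_form : {dot l2 for Num.conj} := l2_dot.
End Dot.
End L2.

Section FormNorm.
Variables (C : numClosedFieldType) (U : lmodType C) (form : {dot U for Num.conj}).

Definition form_norm u := sqrtC (form u u).

Lemma form_norm_ge0 u : 0 <= form_norm u.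
Proof. by rewrite sqrtC_ge0. Qed.

Lemma form_norm_sqr u : form_norm u ^+ 2 = form u u.
Proof. exact: sqrtCK. Qed.

Lemma form_norm_eq0 u : form_norm u = 0 -> u = 0.
Proof. by move/eqP; rewrite sqrtC_eq0 dnorm_eq0 => /eqP. Qed.

Lemma form_normZ k u : form_norm (k *: u) = `|k| * form_norm u.
Proof.
rewrite /form_norm dnormZ sqrtCM ?nnegrE ?exprn_ge0 ?dnorm_ge0 //.
by rewrite sqrCK.
Qed.

Lemma form_norm_CS u v : `|form u v| <= form_norm u * form_norm v.
Proof.
rewrite -(@ler_pXn2r _ 2) ?nnegrE ?mulr_ge0 ?form_norm_ge0 //.
by rewrite exprMn !form_norm_sqr; exact: Cauchy_Schwarz.
Qed.

Lemma form_normD u v : form_norm (u + v) <= form_norm u + form_norm v.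
Proof.
rewrite -(@ler_pXn2r _ 2) ?nnegrE ?addr_ge0 ?form_norm_ge0 //.
rewrite form_norm_sqr dnormD sqrrD !form_norm_sqr addrAC lerD2r lerD2l.
have -> : form u v + (form u v)^*%R = 'Re (form u v) *+ 2.
  by rewrite ReE -mulr_natr divfK ?pnatr_eq0.
rewrite lerMn2r /=; apply: le_trans (form_norm_CS u v).
exact: leif_Re_Creal.
Qed.
End FormNorm.

Lemma cvg_sum_seq (R : realType) (X : Type) (F : set_system X) (FF : Filter F)
    (I : Type) (r : seq I) (f : I -> X -> R) (l : I -> R) :
  (forall i, f i x @[x --> F] --> l i) ->
  \sum_(i <- r) f i x @[x --> F] --> \sum_(i <- r) l i.
Proof.
move=> fl; elim: r => [|i r IH].
  by under eq_fun do rewrite big_nil; rewrite big_nil; exact: cvg_cst.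
by under eq_fun do rewrite big_cons; rewrite big_cons; exact: cvgD (fl i) IH.
Qed.

Section L2Hilbert.
Variables (R : realType) (T : choiceType) (D : pred T).
Local Notation H := (l2 R D).
Local Notation C := R[i].

Definition l2_norm (u : H) : C := form_norm (l2_form R D) u.

Lemma l2_normMn u n : l2_norm (u *+ n) = l2_norm u *+ n.
Proof. by rewrite -scaler_nat /l2_norm form_normZ normr_nat mulr_natl. Qed.

Lemma l2_normN u : l2_norm (- u) = l2_norm u.
Proof. by rewrite -scaleN1r /l2_norm form_normZ normrN1 mul1r. Qed.

HB.instance Definition _ := Num.Zmodule_isNormed.Build C H
  (@form_normD _ _ (l2_form R D)) (@form_norm_eq0 _ _ (l2_form R D)) l2_normMn l2_normN.

Definition l2_dist (u v : H) : C := `|v - u|.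

Lemma l2_distxx u : l2_dist u u = 0.
Proof. by rewrite /l2_dist subrr normr0. Qed.

Lemma l2_dist_eq0 u v : l2_dist u v = 0 -> u = v.
Proof. by move/normr0_eq0/eqP; rewrite subr_eq0 => /eqP. Qed.

Lemma l2_distC u v : l2_dist u v = l2_dist v u.
Proof. exact: distrC. Qed.

Lemma l2_dist_triangle v u w : l2_dist u w <= l2_dist u v + l2_dist v w.
Proof.
by rewrite /l2_dist -(subrKA v w (- u)) addrC; apply: ler_normD.
Qed.

HB.instance Definition _ := isMetric.Build C H
  l2_distxx l2_dist_eq0 l2_distC l2_dist_triangle.
HB.instance Definition _ := isPointed.Build H 0.
HB.instance Definition _ := NormedZmoduleMetric.Build C H (fun u v => erefl).
HB.instance Definition _ := PseudoMetricNormedZmod_Lmodule_isNormedModule.Build C H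
  (form_normZ (l2_form R D)).

Lemma l2_norm_sqr (u : H) : `|u| ^+ 2 = l2_dot u u.
Proof. exact: form_norm_sqr. Qed.

Lemma psum_le_l2_norm (u : H) A : (psum (fun i => nsq (u i)) A)%:C <= `|u| ^+ 2.
Proof. by rewrite l2_norm_sqr l2_dotE lecR psum_nsq_le. Qed.

Lemma l2_norm_le (u : H) (c : R) : 0 <= c ->
  (forall A, psum (fun i => nsq (u i)) A <= c ^+ 2) -> `|u| <= c%:C.
Proof.
move=> c0 hc; rewrite -(@ler_pXn2r _ 2) ?nnegrE ?normr_ge0 ?ler0c //.
rewrite l2_norm_sqr l2_dotE -rmorphXn lecR; apply: usum_le => //.
exact: usummable_nsq.
Qed.

Lemma l2_coord_le (u : H) i : `|u i| <= `|u|.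
Proof.
rewrite -(@ler_pXn2r _ 2) ?nnegrE ?normr_ge0 //.
by have := psum_le_l2_norm u [fset i]%fset; rewrite /psum big_seq_fset1 nsqE.
Qed.

(** [p] stands for the real or the imaginary part. The composite with a coordinate is 1-Lipschitz,
    so it sends a Cauchy filter to a Cauchy filter of [R]. *)
Let coord_cvg (F : set_system H) (FF : ProperFilter F) i (p : C -> R) :
  (forall a b, p (a - b) = p a - p b) -> (forall a, `|p a|%:C <= `|a|) ->
  cauchy F -> cvg (p ((u : H) i) @[u --> F]).
Proof.
move=> pB ple /(@cauchyP C) Fc; apply/cauchy_cvgP/(@cauchyP R) => e e0.
have [u Fu] := Fc e%:C ltac:(by rewrite ltcR).
exists (p (u i)).
apply: (@filterS H F _ (ball u e%:C) [set w : H | ball (p (u i)) e (p (w i))]) => // v.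
rewrite -!ball_normE /= => uv.
rewrite -ltcR -pB.
exact: le_lt_trans (ple _) (le_lt_trans (l2_coord_le (u - v) i) uv).
Qed.

(** The limit [g] is taken coordinatewise. A bound on finite partial sums survives this limit
    uniformly in the finite set; this shows that [f - g], hence [g], is in l2, and that the
    convergence holds in norm. *)
Lemma l2_complete (F : set_system H) : ProperFilter F -> cauchy F -> cvg F.
Proof.
move=> FF Fc.
have cRe i : cvg (complex.Re ((u : H) i) @[u --> F]).
  apply: coord_cvg => // [[a b] [c d] //|a]; exact: normc_ge_Re.
have cIm i : cvg (complex.Im ((u : H) i) @[u --> F]).
  apply: coord_cvg => // [[a b] [c d] //|a];
  have := normc_ge_Re (a * 'i); rewrite ReiNIm normrN normrM.
  by rewrite (_ : `|'i| = 1) ?mulr1 // normc_def /= expr0n expr1n add0r sqrtr1.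
pose g i := lim (complex.Re ((u : H) i) @[u --> F]) +i* lim (complex.Im ((u : H) i) @[u --> F]).
have close (e : R) (f : H) : 0 < e -> F (ball f e%:C) ->
    forall A, psum (fun i => nsq (f i - g i)) A <= e ^+ 2.
  move=> e0 Ff A.
  have cvgS : psum (fun i => nsq (f i - (u : H) i)) A @[u --> F] -->
      psum (fun i => nsq (f i - g i)) A.
    rewrite /psum; apply: cvg_sum_seq => i.
    have E (a b : C) : nsq (a - b) =
        (complex.Re a - complex.Re b) * (complex.Re a - complex.Re b) +
        (complex.Im a - complex.Im b) * (complex.Im a - complex.Im b).
      by case: a b => [a a'] [b b'].
    under eq_fun do rewrite E; rewrite E.
    have cR : complex.Re (f i) - complex.Re ((u : H) i) @[u --> F] -->
        complex.Re (f i) - complex.Re (g i) by apply: cvgB (cvg_cst _) (cRe i).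
    have cI : complex.Im (f i) - complex.Im ((u : H) i) @[u --> F] -->
        complex.Im (f i) - complex.Im (g i) by apply: cvgB (cvg_cst _) (cIm i).
    exact: (cvgD (cvgM cR cR) (cvgM cI cI)).
  have -> : psum (fun i => nsq (f i - g i)) A =
    lim (psum (fun i => nsq (f i - (u : H) i)) A @[u --> F]).
    by apply/esym; exact: cvg_lim cvgS.
  apply: limr_le; first by apply/cvg_ex; eexists; exact: cvgS.
  apply: filterS Ff => u; rewrite -ball_normE /= => fu.
  rewrite -lecR; apply: le_trans (psum_le_l2_norm (f - u) A) _.
  by rewrite rmorphXn lerXn2r ?nnegrE ?normr_ge0 ?ler0c ?(ltW e0) ?(ltW fu).
have gP : g \in l2_pred D.
  have /(@cauchyP C) Fe := Fc.
  have [f Ff] := Fe 1%:C ltac:(by rewrite ltcR ltr01).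
  have fg : (fun i => f i - g i) \in l2_pred D.
    apply/asboolP; split; last by exists (1 ^+ 2); exact: close.
    move=> i Di; rewrite l2_out // sub0r /g.
    have -> : (fun u : H => complex.Re (u i)) = cst 0.
      by apply/funext => u; rewrite l2_out.
    have -> : (fun u : H => complex.Im (u i)) = cst 0.
      by apply/funext => u; rewrite l2_out.
    by rewrite !lim_cst // oppr0.
  have -> : g = val f - (fun i => f i - g i).
    apply/funext => i; transitivity (f i - (f i - g i)) => //.
    by rewrite subKr.
  by apply: rpredB => //; exact: valP.
apply/cvg_ex; exists (L2 gP); apply/fcvgrPdist_lt => e e0.
(* Radii of balls are elements of [R[i]]; a positive one is real, hence comes from some [r : R]. *)
have : e \is Num.real by rewrite ger0_real // ltW.
case/complex_realP => r er; move: e0; rewrite {}er ltcR => r0.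
have r20 : 0 < r / 2 by rewrite divr_gt0.
move: (Fc) => /(@cauchyP C) Fe.
have [f Ff] := Fe (r / 2)%:C ltac:(by rewrite ltcR).
have gf : `|f - L2 gP| <= (r / 2)%:C by apply: l2_norm_le (ltW r20) _; exact: close.
rewrite near_simpl; apply: filterS Ff => u; rewrite -ball_normE /= => fu.
rewrite [r]splitr rmorphD /= -(subrKA f).
by apply: le_lt_trans (ler_normD _ _) _; rewrite ler_ltD // distrC.
Qed.

HB.instance Definition _ := Uniform_isComplete.Build H l2_complete.
HB.instance Definition _ := CompleteNormedModule_isHilbert.Build R H
  (dotp := l2_form R D) l2_norm_sqr.
End L2Hilbert.

(** * Hilbert spaces and their bounded operators *)

Section RealNorm.
Variables (R : realType) (V : normedZmodType R[i]).
Implicit Types x y : V.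

(** The norm of [V] lies in [R[i]]; its copy in [R] admits suprema, infima and linear arithmetic. *)
Definition rnorm x : R := complex.Re `|x|.

Lemma rnormE x : (rnorm x)%:C = `|x|.
Proof. exact: RRe_real (ger0_real (normr_ge0 x)). Qed.

Lemma rnorm_ge0 x : 0 <= rnorm x.
Proof. by rewrite -ler0c rnormE normr_ge0. Qed.

Lemma rnormD x y : rnorm (x + y) <= rnorm x + rnorm y.
Proof. by rewrite -lecR rmorphD /= !rnormE ler_normD. Qed.

Lemma rnormN x : rnorm (- x) = rnorm x.
Proof. by rewrite /rnorm normrN. Qed.

Lemma rnorm0 : rnorm (0 : V) = 0.
Proof. by rewrite /rnorm normr0. Qed.

Lemma rnorm_eq0 x : (rnorm x == 0) = (x == 0).
Proof. by rewrite -(inj_eq (@complexI _)) rnormE normr_eq0. Qed.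

Lemma rdistC x y : rnorm (x - y) = rnorm (y - x).
Proof. by rewrite -rnormN opprB. Qed.

Lemma rdist_triangle y x z : rnorm (x - z) <= rnorm (x - y) + rnorm (y - z).
Proof. by rewrite -(subrKA y x (- z)) rnormD. Qed.

Lemma rnorm_small_eq0 x : (forall e : R, 0 < e -> rnorm x <= e) -> x = 0.
Proof.
move=> xe; apply/eqP; rewrite -rnorm_eq0 eq_le rnorm_ge0 andbT.
by apply/ler_addgt0Pl => e e0; rewrite addr0; exact: xe.
Qed.
End RealNorm.

Lemma rnormZ (R : realType) (V : normedModType R[i]) (k : R[i]) (x : V) :
  rnorm (k *: x) = rnorm k * rnorm x.
Proof. by apply: (@complexI _); rewrite rmorphM /= !rnormE normrZ. Qed.

Lemma rnorm_real (R : realType) (a : R) : rnorm a%:C = `|a|.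
Proof. by apply: (@complexI _); rewrite rnormE normc_def /= expr0n addr0 sqrtr_sqr. Qed.

Section ClosedSets.
Variables (R : realType) (V : normedModType R[i]).

Lemma closed_approx (S : set V) : closed S <->
  forall x, (forall e : R, 0 < e -> exists2 y, S y & rnorm (x - y) < e) -> S x.
Proof.
split=> [clS x xS|H x clx].
  apply: clS => B /nbhs_ballP[e /= e0 eB].
  have : e \is Num.real by rewrite ger0_real // ltW.
  case/complex_realP => r er; move: e0; rewrite er ltcR => r0.
  have [y Sy xy] := xS _ r0; exists y; split=> //; apply: eB.
  by rewrite -ball_normE /= er -rnormE ltcR.
apply: H => e e0.
have : nbhs x (ball x e%:C) by apply: nbhsx_ballx; rewrite ltcR.
move=> /clx[y [Sy]]; rewrite -ball_normE /= -rnormE ltcR => xy.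
by exists y.
Qed.

Lemma closure_approx (S : set V) x :
  (forall e : R, 0 < e -> exists2 y, S y & rnorm (x - y) < e) -> closure S x.
Proof.
move=> xS B /nbhs_ballP[e /= e0 eB].
have : e \is Num.real by rewrite ger0_real // ltW.
case/complex_realP => r er; move: e0; rewrite er ltcR => r0.
have [y Sy xy] := xS _ r0; exists y; split=> //; apply: eB.
by rewrite -ball_normE /= er -rnormE ltcR.
Qed.
End ClosedSets.

Section Hilbert.
Variables (R : realType).

Lemma dotpC (H : hilbertType R) (x y : H) : dotp x y = (dotp y x)^*.
Proof. exact: form_conj. Qed.

Lemma dotp_le (H : hilbertType R) (x y : H) : rnorm (dotp x y) <= rnorm x * rnorm y.
Proof.
rewrite -lecR rmorphM /= !rnormE -(@ler_pXn2r _ 2) ?nnegrE ?mulr_ge0 //.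
by rewrite exprMn !dotp_norm; exact: Cauchy_Schwarz.
Qed.

Lemma rnorm_sqr (H : hilbertType R) (x : H) : (rnorm x ^+ 2)%:C = dotp x x.
Proof. by rewrite rmorphXn /= rnormE dotp_norm. Qed.

Lemma rnorm_dotp (H : hilbertType R) (x : H) : rnorm (dotp x x) = rnorm x ^+ 2.
Proof. by rewrite -rnorm_sqr rnorm_real ger0_norm ?sqr_ge0. Qed.

Lemma dotpBl (H : hilbertType R) (x y z : H) : dotp (x - y) z = dotp x z - dotp y z.
Proof. exact: linearBl. Qed.
Lemma dotpDl (H : hilbertType R) (x y z : H) : dotp (x + y) z = dotp x z + dotp y z.
Proof. exact: linearDl. Qed.
Lemma dotpBr (H : hilbertType R) (x y z : H) : dotp z (x - y) = dotp z x - dotp z y.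
Proof. exact: linearBr. Qed.
Lemma dotpDr (H : hilbertType R) (x y z : H) : dotp z (x + y) = dotp z x + dotp z y.
Proof. exact: linearDr. Qed.
Lemma dotpZl (H : hilbertType R) k (x z : H) : dotp (k *: x) z = k * dotp x z.
Proof. exact: linearZl_LR. Qed.
Lemma dotpZr (H : hilbertType R) k (x z : H) : dotp z (k *: x) = k^* * dotp z x.
Proof. by rewrite dotpC dotpZl rmorphM /= -(dotpC z x). Qed.
Lemma dotp0l (H : hilbertType R) (z : H) : dotp 0 z = 0.
Proof. exact: linear0l. Qed.
Lemma dotp0r (H : hilbertType R) (z : H) : dotp z 0 = 0.
Proof. exact: linear0r. Qed.

Lemma dotp_eq0 (H : hilbertType R) (x : H) : (dotp x x == 0) = (x == 0).
Proof. exact: dnorm_eq0. Qed.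

Lemma dotp_inj (H : hilbertType R) (x y : H) :
  (forall z, dotp x z = dotp y z) -> x = y.
Proof.
by move=> xy; apply/eqP; rewrite -subr_eq0 -dotp_eq0 dotpBl xy subrr.
Qed.

(** Complex scalars make this work: the form at [k *: x + y] gives
    [k * <Tx, y> + k^* * <Ty, x> = 0], and [k = 1] together with [k = 'i] forces [<Tx, y> = 0],
    which is used for [y = T x]. *)
Lemma polarization (H : hilbertType R) (T : H -> H) (S : set H) : linear T ->
  (forall k x y, S x -> S y -> S (k *: x + y)) -> (forall x, S x -> S (T x)) ->
  (forall x, S x -> dotp (T x) x = 0) -> forall x, S x -> T x = 0.
Proof.
move=> Tl Sl ST T0 x Sx; apply/eqP; rewrite -dotp_eq0; apply/eqP.
set y := T x; have Sy : S y by exact: ST.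
have E k : k * dotp (T x) y + k^* * dotp (T y) x = 0.
  have := T0 _ (Sl k x y Sx Sy); rewrite Tl !dotpDl !dotpDr !dotpZl !dotpZr.
  by rewrite (T0 x Sx) (T0 y Sy) !mulr0 add0r addr0.
have := E 1; rewrite rmorph1 !mul1r => E1.
have := E 'i; rewrite -(addr0_eq E1) => Ei.
have : ('i - ('i)^* : R[i]) * dotp (T x) y = 0.
  by rewrite mulrBl -mulrN.
move/eqP; rewrite mulf_eq0 => /orP[|/eqP //].
by rewrite eq_complex /= opprK => /andP[_]; rewrite -[1 + 1]/2 pnatr_eq0.
Qed.

Variables (H K : hilbertType R).

(** The constant of [bounded_op] is an element of [R[i]]; since [c * |x|] dominates a norm, it
    equals its own absolute value [|c| * |x|]. *)
Lemma bounded_op_real (T : H -> K) : bounded_op T ->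
  exists2 c : R, 0 <= c & forall x, rnorm (T x) <= c * rnorm x.
Proof.
move=> [_ [c hc]]; exists (rnorm c); first exact: rnorm_ge0.
move=> x; rewrite -lecR rmorphM /= !rnormE -[X in _ <= _ * X]normr_id -normrM.
by rewrite ger0_norm ?hc // (le_trans _ (hc x)).
Qed.

Lemma closed_preimage (T : H -> K) (S : set K) : bounded_op T -> closed S ->
  closed (T @^-1` S).
Proof.
move=> Tb /closed_approx Scl; have [c c0 hc] := bounded_op_real Tb.
apply/closed_approx => x xT; apply: Scl => e e0.
have c1 : 0 < c + 1 by rewrite ltr_wpDl.
have [y Ty xy] := xT _ (divr_gt0 e0 c1); exists (T y) => //.
rewrite -(zmod_morphism_linear Tb.1 x y).
apply: le_lt_trans (hc _) _; apply: (@le_lt_trans _ _ ((c + 1) * rnorm (x - y))).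
  by rewrite ler_wpM2r ?rnorm_ge0 // lerDl.
by rewrite mulrC -ltr_pdivlMr.
Qed.
End Hilbert.

(** * The C*-algebra of bounded operators on a Hilbert space *)

Module BoundedOperators.
Section Pred.
Variables (R : realType) (H : hilbertType R).
Local Notation C := R[i].
Implicit Types f g : H -> H.

Definition op_bound f (c : R) := 0 <= c /\ forall x, rnorm (f x) <= c * rnorm x.

Definition op_adjoint f g := forall x y, dotp (f x) y = dotp x (g y).

Lemma op_adjoint_sym f g : op_adjoint f g -> op_adjoint g f.
Proof. by move=> fg x y; rewrite dotpC -fg dotpC conjcK. Qed.

Lemma op_adjoint_linear f g : op_adjoint f g -> linear g.
Proof.
move=> fg k x y; apply: dotp_inj => z; rewrite dotpDl dotpZl.
by rewrite !(op_adjoint_sym fg) dotpDl dotpZl.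
Qed.

(** Cauchy-Schwarz in [|g x|^2 = <f (g x), x>], after which one factor [|g x|] cancels. *)
Lemma op_adjoint_bound f g c : op_adjoint f g -> op_bound f c -> op_bound g c.
Proof.
move=> fg [c0 fc]; split=> // x.
have [->|gx0] := eqVneq (rnorm (g x)) 0; first by rewrite mulr_ge0 ?rnorm_ge0.
have gx : 0 < rnorm (g x) by rewrite lt_def gx0 rnorm_ge0.
rewrite -(ler_pM2l gx).
have : rnorm (dotp (g x) (g x)) <= c * rnorm (g x) * rnorm x.
  rewrite -fg; apply: le_trans (dotp_le _ _) _.
  by rewrite ler_wpM2r ?rnorm_ge0.
by rewrite rnorm_dotp expr2 -mulrA mulrCA.
Qed.

(** The existence of an adjoint is part of the predicate. It passes to sums, products and norm
    limits, and for the model operators it is checked on a basis. *)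
Definition bop_pred : pred (H -> H) := fun f =>
  `[< [/\ linear f, exists c, op_bound f c & exists g, op_adjoint f g] >].

Lemma bop_pred_closed : submod_closed bop_pred.
Proof.
split.
  apply/asboolP; split.
  - by move=> k x y; rewrite scaler0 addr0.
  - by exists 0; split=> // x; rewrite rnorm0 mul0r.
  - by exists (fun=> 0) => x y; rewrite dotp0l dotp0r.
move=> k f g /asboolP[fl [c [c0 fc]] [f' ff']] /asboolP[gl [d [d0 gd]] [g' gg']].
apply/asboolP; split.
- move=> l x y; rewrite !fctE fl gl !scalerDr !scalerA [l * k]mulrC.
  by rewrite !addrA; congr (_ + _); rewrite addrAC.
- exists (rnorm k * c + d); split.
    by rewrite addr_ge0 ?mulr_ge0 ?rnorm_ge0.
  move=> x; apply: le_trans (rnormD _ _) _.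
  by rewrite mulrDl lerD // rnormZ -mulrA ler_wpM2l ?rnorm_ge0.
- exists (fun x => k^* *: f' x + g' x) => x y.
  rewrite dotpDl dotpDr dotpZl dotpZr ff' gg'; congr (_ * _ + _).
  exact: esym (conjcK k).
Qed.

HB.instance Definition _ := GRing.isSubmodClosed.Build C (H -> H) bop_pred
  (GRing.submod_closed_semi bop_pred_closed).
End Pred.

(* [nz] makes the identity operator nonzero, as [algType] requires. *)
Record bop (R : realType) (H : hilbertType R) (nz : exists x : H, x != 0) :=
  Bop { bop_fun :> H -> H; _ : bop_fun \in @bop_pred R H }.

Section Bop.
Variables (R : realType) (H : hilbertType R) (nz : exists x : H, x != 0).
Local Notation C := R[i].
Local Notation B := (bop nz).

HB.instance Definition _ := [isSub for @bop_fun R H nz].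
HB.instance Definition _ := [Choice of B by <:].
HB.instance Definition _ := [SubChoice_isSubLmodule of B by <:].

Implicit Types S T : B.

Lemma bopP S T : (forall x, S x = T x) -> S = T.
Proof. by move=> ST; apply/val_inj/funext. Qed.

Lemma bop_linear T : linear T.
Proof. by case: T => T /= /asboolP[]. Qed.

Lemma bopTZ T k x : T (k *: x) = k *: T x.
Proof. exact: scalable_linear (bop_linear T) k x. Qed.

Lemma bopTD T x y : T (x + y) = T x + T y.
Proof. by rewrite -[x]scale1r bop_linear !scale1r. Qed.

Lemma bop_bounded T : exists c, op_bound T c.
Proof. by case: T => T /= /asboolP[]. Qed.

Lemma bop_adjoint T : exists g, op_adjoint T g.
Proof. by case: T => T /= /asboolP[]. Qed.

Lemma bopD S T x : (S + T) x = S x + T x. Proof. by []. Qed.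
Lemma bopZ k T x : (k *: T) x = k *: T x. Proof. by []. Qed.
Let id_subproof : id \in @bop_pred R H.
Proof.
apply/asboolP; split=> //; last by exists id.
by exists 1; split=> // x; rewrite mul1r.
Qed.

Definition bop_one : B := Bop nz id_subproof.

Let comp_subproof S T : S \o T \in @bop_pred R H.
Proof.
have [c [c0 Sc]] := bop_bounded S; have [d [d0 Td]] := bop_bounded T.
have [S' SS'] := bop_adjoint S; have [T' TT'] := bop_adjoint T.
apply/asboolP; split.
- by move=> k x y /=; rewrite !bop_linear.
- exists (c * d); split=> [|x]; first by rewrite mulr_ge0.
  by apply: le_trans (Sc _) _; rewrite -mulrA ler_wpM2l.
- by exists (T' \o S') => x y /=; rewrite SS' TT'.
Qed.

Definition bop_comp S T : B := Bop nz (comp_subproof S T).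

Let compA : associative bop_comp. Proof. by move=> *; apply: bopP. Qed.
Let comp1l : left_id bop_one bop_comp. Proof. by move=> *; apply: bopP. Qed.
Let comp1r : right_id bop_one bop_comp. Proof. by move=> *; apply: bopP. Qed.
Let compDl : left_distributive bop_comp +%R. Proof. by move=> *; apply: bopP. Qed.
Let compDr : right_distributive bop_comp +%R.
Proof.
by move=> S T U; apply: bopP => x; exact: bopTD.
Qed.
Let one_neq0 : bop_one != 0.
Proof.
have [x x0] := nz; apply: contra_neq x0 => E.
by have := congr1 (fun T : B => T x) E.
Qed.

HB.instance Definition _ := GRing.Zmodule_isNzRing.Build B
  compA comp1l comp1r compDl compDr one_neq0.

Lemma bopM S T x : (S * T) x = S (T x). Proof. by []. Qed.
Lemma bop1 x : (1 : B) x = x. Proof. by []. Qed.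

Let scalAl k S T : k *: (S * T) = (k *: S) * T. Proof. exact: bopP. Qed.
Let scalAr k S T : k *: (S * T) = S * (k *: T).
Proof.
by apply: bopP => x; rewrite bopM !bopZ bopM bopTZ.
Qed.

HB.instance Definition _ := GRing.Lmodule_isLalgebra.Build C B scalAl.
HB.instance Definition _ := GRing.Lalgebra_isAlgebra.Build C B scalAr.

Definition star_op T : H -> H := projT1 (cid (bop_adjoint T)).

Lemma star_opP T : op_adjoint T (star_op T).
Proof. by rewrite /star_op; case: cid. Qed.

Let star_subproof T : star_op T \in @bop_pred R H.
Proof.
have TS := star_opP T; apply/asboolP; split.
- exact: op_adjoint_linear TS.
- have [c Tc] := bop_bounded T; exists c; exact: op_adjoint_bound TS Tc.
- by exists T; exact: op_adjoint_sym.
Qed.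

Definition bop_star T : B := Bop nz (star_subproof T).

Lemma bop_starE T x y : dotp (T x) y = dotp x (bop_star T y).
Proof. exact: star_opP. Qed.

Lemma bop_star_apply T (g : H -> H) : op_adjoint T g -> forall x, bop_star T x = g x.
Proof. by move=> Tg x; apply: dotp_inj => y; rewrite dotpC -bop_starE Tg -dotpC. Qed.

Lemma bop_star_uniq T S : op_adjoint T S -> bop_star T = S.
Proof. by move=> TS; apply: bopP => x; exact: bop_star_apply. Qed.

Definition bop_norm T : R := inf [set c | op_bound T c].

Lemma bop_normP T : op_bound T (bop_norm T).
Proof.
have hi : has_inf [set c | op_bound T c].
  by split; [exact: bop_bounded|exists 0 => c []].
split; first by apply: lb_le_inf => [|c []//]; exact: hi.1.
move=> x; have [x0|x0] := eqVneq (rnorm x) 0; last first.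
  have xgt0 : 0 < rnorm x by rewrite lt_def x0 rnorm_ge0.
  rewrite -ler_pdivrMr //; apply: lb_le_inf => [|c [_ Tc]]; first exact: hi.1.
  by rewrite ler_pdivrMr.
by have [c [_ Tc]] := bop_bounded T; have := Tc x; rewrite x0 !mulr0.
Qed.

Lemma bop_norm_le T c : op_bound T c -> bop_norm T <= c.
Proof. by move=> Tc; apply: ge_inf => //; exists 0 => d []. Qed.

Lemma bop_norm_ge0 T : 0 <= bop_norm T.
Proof. by case: (bop_normP T). Qed.

Lemma bop_norm_apply T x : rnorm (T x) <= bop_norm T * rnorm x.
Proof. by case: (bop_normP T). Qed.

Let starK : involutive bop_star.
Proof. by move=> T; apply: bop_star_uniq => x y; rewrite dotpC -bop_starE -dotpC. Qed.
Let starD : {morph bop_star : S T / S + T}.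
Proof.
by move=> S T; apply: bop_star_uniq => x y; rewrite !bopD dotpDl dotpDr !bop_starE.
Qed.
Let starZ k T : bop_star (k *: T) = Num.conj k *: bop_star T.
Proof.
apply: bop_star_uniq => x y; rewrite !bopZ dotpZl dotpZr bop_starE; congr (_ * _).
exact: esym (conjcK k).
Qed.
Let starM S T : bop_star (S * T) = bop_star T * bop_star S.
Proof. by apply: bop_star_uniq => x y; rewrite !bopM !bop_starE. Qed.
Let norm0_eq0 T : bop_norm T = 0 -> T = 0.
Proof.
move=> T0; apply: bopP => x; apply/eqP; rewrite -rnorm_eq0 eq_le rnorm_ge0 andbT.
by have := bop_norm_apply T x; rewrite T0 mul0r.
Qed.
Let normD S T : bop_norm (S + T) <= bop_norm S + bop_norm T.
Proof.
apply: bop_norm_le; split=> [|x]; first by rewrite addr_ge0 ?bop_norm_ge0.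
by rewrite mulrDl; apply: le_trans (rnormD _ _) (lerD _ _); exact: bop_norm_apply.
Qed.
Let normM S T : bop_norm (S * T) <= bop_norm S * bop_norm T.
Proof.
apply: bop_norm_le; split=> [|x]; first by rewrite mulr_ge0 ?bop_norm_ge0.
apply: le_trans (bop_norm_apply S (T x)) _.
by rewrite -mulrA ler_wpM2l ?bop_norm_ge0 ?bop_norm_apply.
Qed.
Let normZ_le k T : bop_norm (k *: T) <= rnorm k * bop_norm T.
Proof.
apply: bop_norm_le; split=> [|x]; first by rewrite mulr_ge0 ?bop_norm_ge0 ?rnorm_ge0.
by rewrite bopZ rnormZ -mulrA ler_wpM2l ?rnorm_ge0 ?bop_norm_apply.
Qed.
Let normZ k T : (bop_norm (k *: T))%:C = `|k| * (bop_norm T)%:C.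
Proof.
rewrite -rnormE -rmorphM /=; congr _%:C; apply/eqP; rewrite eq_le normZ_le /=.
have [->|k0] := eqVneq k 0; first by rewrite rnorm0 mul0r bop_norm_ge0.
have kgt0 : 0 < rnorm k by rewrite lt_def rnorm_eq0 k0 rnorm_ge0.
rewrite mulrC -ler_pdivlMr // mulrC.
have := normZ_le k^-1 (k *: T); rewrite scalerA mulVf // scale1r.
by rewrite /rnorm normfV -/(rnorm k) -rnormE -fmorphV.
Qed.
Let norm_star T : bop_norm (bop_star T) <= bop_norm T.
Proof.
by apply: bop_norm_le; apply: op_adjoint_bound (star_opP T) (bop_normP T).
Qed.
Let norm_starM T : bop_norm (bop_star T * T) = bop_norm T ^+ 2.
Proof.
apply/eqP; rewrite eq_le; apply/andP; split.
  apply: le_trans (normM _ _) _.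
  by rewrite expr2 ler_wpM2r ?bop_norm_ge0 ?norm_star.
have n0 := bop_norm_ge0 (bop_star T * T).
rewrite -[leRHS]sqr_sqrtr // ler_pXn2r ?nnegrE ?bop_norm_ge0 ?sqrtr_ge0 //.
apply: bop_norm_le; split=> [|x]; first exact: sqrtr_ge0.
rewrite -(@ler_pXn2r _ 2) ?nnegrE ?mulr_ge0 ?sqrtr_ge0 ?rnorm_ge0 //.
rewrite exprMn sqr_sqrtr // -rnorm_dotp bop_starE.
have := dotp_le x ((bop_star T * T) x); rewrite bopM => /le_trans; apply.
rewrite expr2 mulrA mulrC ler_wpM2r ?rnorm_ge0 //.
exact: bop_norm_apply (bop_star T * T) x.
Qed.

(** Completeness of the operator norm applies this twice, to a Cauchy sequence of operators and to
    the sequence of adjoints; the second limit is then the adjoint of the first. *)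
Lemma uniform_limit (u : nat -> H -> H) :
  (forall n, linear (u n)) ->
  (forall e : R, 0 < e -> exists N, forall m n, (N <= m)%N -> (N <= n)%N ->
     forall x, rnorm (u m x - u n x) <= e * rnorm x) ->
  exists2 L : H -> H, linear L & forall e : R, 0 < e -> exists N, forall n,
    (N <= n)%N -> forall x, rnorm (u n x - L x) <= e * rnorm x.
Proof.
move=> ul uc.
have uc' (x : H) (e : R) : 0 < e -> exists N, forall m n,
    (N <= m)%N -> (N <= n)%N -> rnorm (u m x - u n x) < e.
  move=> e0; have x1 : 0 < rnorm x + 1 by rewrite ltr_wpDl ?rnorm_ge0.
  have [N hN] := uc _ (divr_gt0 e0 x1); exists N => m n Nm Nn.
  apply: le_lt_trans (hN _ _ Nm Nn x) _.
  by rewrite mulrAC ltr_pdivrMr // ltr_pM2l // ltrDl.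
have lim_ex x : exists l : H, forall e : R, 0 < e -> exists N, forall n,
    (N <= n)%N -> rnorm (u n x - l) < e.
  have : cvg (u n x @[n --> \oo]).
    apply/cauchy_cvgP/(@cauchyP R[i]) => e e0.
    have : e \is Num.real by rewrite ger0_real // ltW.
    case/complex_realP => r er; move: e0; rewrite {}er ltcR => r0.
    have [N hN] := uc' x _ r0; exists (u N x); exists N => // n /= Nn.
    by rewrite -ball_normE /= -rnormE ltcR; exact: hN.
  case/cvg_ex => l /cvgrPdist_lt ul'; exists l => e e0.
  have [N _ hN] := ul' e%:C ltac:(by rewrite ltcR).
  by exists N => n Nn; rewrite rdistC -ltcR rnormE; exact: hN.
have [L hL] := choice lim_ex; exists L.
  move=> k x y; apply/eqP; rewrite -subr_eq0; apply/eqP.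
  apply: rnorm_small_eq0 => e e0.
  (* The defect of linearity is at most [rnorm k * d + d + d], one term for each of [x], [y] and
     [k *: x + y]. *)
  have k1 : 0 < rnorm k + 2 by rewrite ltr_wpDl ?rnorm_ge0.
  have d0 := divr_gt0 e0 k1; set d := e / _ in d0.
  have [Nx hx] := hL x _ d0; have [Ny hy] := hL y _ d0.
  have [Nz hz] := hL (k *: x + y) _ d0.
  pose n := maxn Nx (maxn Ny Nz).
  have {}hx := hx n ltac:(by rewrite leq_maxl).
  have {}hy := hy n ltac:(by rewrite /n maxnCA leq_maxl).
  have {}hz := hz n ltac:(by rewrite /n maxnA leq_maxr).
  have -> : L (k *: x + y) - (k *: L x + L y) =
      k *: (u n x - L x) + (u n y - L y) - (u n (k *: x + y) - L (k *: x + y)).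
    by rewrite scalerBr ul addrACA -opprD opprB [RHS]addrC addrA subrK.
  apply: le_trans (rnormD _ _) _; rewrite rnormN.
  apply: (@le_trans _ _ (rnorm k * d + d + d)); last first.
    by rewrite -addrA -mulr2n -mulr_natl -mulrDl /d mulrC divfK ?gt_eqF.
  apply: lerD (ltW hz); apply: le_trans (rnormD _ _) (lerD _ (ltW hy)).
  by rewrite rnormZ ler_wpM2l ?rnorm_ge0 ?ltW.
move=> e e0; have [N hN] := uc _ e0; exists N => n Nn x.
apply/ler_addgt0Pl => d d0; have [M hM] := hL x _ d0.
pose m := maxn N M.
apply: le_trans (rdist_triangle (u m x) _ _) _; rewrite addrC; apply: lerD.
  by apply/ltW/hM; rewrite leq_maxr.
by apply: hN => //; rewrite leq_maxl.
Qed.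

Lemma bop_normB_le S T e : bop_norm (S - T) <= e ->
  forall x, rnorm (S x - T x) <= e * rnorm x.
Proof.
move=> STe x; apply: le_trans (bop_norm_apply (S - T) x) _.
by rewrite ler_wpM2r ?rnorm_ge0.
Qed.

Let norm_starB S T : bop_norm (bop_star S - bop_star T) <= bop_norm (S - T).
Proof.
apply: le_trans (norm_star (S - T)); rewrite starD.
have -> : bop_star (- T) = - bop_star T.
  by rewrite -scaleN1r starZ rmorphN rmorph1 scaleN1r.
by [].
Qed.

Let norm_complete (u : nat -> B) :
  (forall e : R, 0 < e -> exists N : nat, forall m k : nat,
     (N <= m)%N -> (N <= k)%N -> bop_norm (u m - u k) < e) ->
  exists l : B, forall e : R, 0 < e -> exists N : nat, forall k : nat,
     (N <= k)%N -> bop_norm (u k - l) < e.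
Proof.
move=> uc.
have [|e e0|L Ll uL] := @uniform_limit u; first by move=> n; exact: bop_linear.
  have [N hN] := uc e e0; exists N => m n Nm Nn; apply: bop_normB_le.
  by apply/ltW/hN.
have [|e e0|L' Ll' uL'] := @uniform_limit (fun n => bop_star (u n)).
    by move=> n; exact: bop_linear.
  have [N hN] := uc e e0; exists N => m n Nm Nn; apply: bop_normB_le.
  by apply: le_trans (norm_starB _ _) _; apply/ltW/hN.
have LP : L \in @bop_pred R H.
  apply/asboolP; split=> //.
    have [N hN] := uL 1 ltr01; exists (bop_norm (u N) + 1).
    split; first by rewrite addr_ge0 ?bop_norm_ge0.
    move=> x; rewrite -[L x](subrK (u N x)) mulrDl addrC.
    apply: le_trans (rnormD _ _) (lerD (bop_norm_apply _ _) _).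
    by rewrite rdistC; exact: hN.
  exists L' => x y; apply/eqP; rewrite -subr_eq0; apply/eqP.
  apply: rnorm_small_eq0 => e e0.
  (* There are two errors of size [d * (rnorm x * rnorm y)]; the summand 1 keeps the denominator of
     [d] positive. *)
  have xy1 : 0 < 2 * (rnorm x * rnorm y) + 1.
    by rewrite ltr_wpDl // !mulr_ge0 ?rnorm_ge0.
  have d0 := divr_gt0 e0 xy1; set d := e / _ in d0.
  have [N hN] := uL _ d0; have [M hM] := uL' _ d0; pose n := maxn N M.
  have -> : dotp (L x) y - dotp x (L' y) =
      dotp x (bop_star (u n) y - L' y) - dotp (u n x - L x) y.
    by rewrite dotpBl dotpBr (bop_starE (u n)) opprB [RHS]addrC addrA subrK.
  apply: le_trans (rnormD _ _) _; rewrite rnormN.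
  apply: (@le_trans _ _ (d * (2 * (rnorm x * rnorm y)))).
    rewrite mulr_natl mulrnAr mulr2n; apply: lerD.
      apply: le_trans (dotp_le _ _) _; rewrite mulrCA.
      rewrite ler_wpM2l ?rnorm_ge0 // hM // leq_maxr.
      by [].
    apply: le_trans (dotp_le _ _) _; rewrite mulrA ler_wpM2r ?rnorm_ge0 // hN //.
    by rewrite leq_maxl.
  rewrite /d mulrAC ler_pdivrMr // ler_pM2l //.
  by rewrite lerDl.
exists (Bop nz LP) => e e0; have e20 : 0 < e / 2 by rewrite divr_gt0.
have [N hN] := uL _ e20; exists N => n Nn.
apply: (@le_lt_trans _ _ (e / 2)); last by rewrite ltr_pdivrMr // ltr_pMr // ltr1n.
by apply: bop_norm_le; split=> [|x]; [exact: ltW|exact: hN].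
Qed.

HB.instance Definition _ := isCstarAlgebra.Build R B starK starD starZ starM
  norm0_eq0 normD normZ normM norm_starM norm_complete.

Lemma star_bop_apply T (g : H -> H) : op_adjoint T g -> forall x, star T x = g x.
Proof. exact: bop_star_apply. Qed.
End Bop.
End BoundedOperators.
Export BoundedOperators.

(** * C*-algebras *)

Section CstarNorm.
Variables (R : realType) (A : cstarAlgType R).
Implicit Types a b c : A.

Lemma cnormZr k a : cnorm (k *: a) = rnorm k * cnorm a.
Proof. by apply: (@complexI _); rewrite cnormZ rmorphM /= rnormE. Qed.

Lemma cnorm0 : cnorm (0 : A) = 0.
Proof. by rewrite -(scale0r 0) cnormZr rnorm0 mul0r. Qed.

Lemma cnormN a : cnorm (- a) = cnorm a.
Proof. by rewrite -scaleN1r cnormZr rnormN (rnorm_real 1) normr1 mul1r. Qed.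

Lemma cnorm_ge0 a : 0 <= cnorm a.
Proof.
have := cnormD a (- a); rewrite subrr cnorm0 cnormN -mulr2n -mulr_natl.
by rewrite pmulr_rge0.
Qed.

Lemma cdistC a b : cnorm (a - b) = cnorm (b - a).
Proof. by rewrite -cnormN opprB. Qed.

Lemma cdist_triangle b a c : cnorm (a - c) <= cnorm (a - b) + cnorm (b - c).
Proof. by rewrite -(subrKA b a (- c)) cnormD. Qed.

Lemma cnorm_small_eq0 a : (forall e : R, 0 < e -> cnorm a <= e) -> a = 0.
Proof.
move=> ae; apply: cnorm0_eq0; apply/eqP; rewrite eq_le cnorm_ge0 andbT.
by apply/ler_addgt0Pl => e e0; rewrite addr0; exact: ae.
Qed.

(** Closedness in epsilon form, as [cnorm] comes without a topology on [A]. *)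
Definition norm_closed (D : set A) :=
  forall a, (forall e : R, 0 < e -> exists2 b, D b & cnorm (a - b) < e) -> D a.

Lemma star_linear k a b : star (k *: a + b) = Num.conj k *: star a + star b.
Proof. by rewrite starD starZ. Qed.

Lemma starN a : star (- a) = - star a.
Proof. by rewrite -scaleN1r starZ rmorphN rmorph1 scaleN1r. Qed.

Lemma starB a b : star (a - b) = star a - star b.
Proof. by rewrite starD starN. Qed.

Lemma star1 : star (1 : A) = 1.
Proof. by rewrite -[LHS]mulr1 -{2}(starK 1) -starM mulr1 starK. Qed.

Lemma star0 : star (0 : A) = 0.
Proof. by rewrite -(scale0r 0) starZ rmorph0 !scale0r. Qed.

Lemma cnorm_star a : cnorm (star a) = cnorm a.
Proof.
have le b : cnorm b <= cnorm (star b).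
  have [->|b0] := eqVneq (cnorm b) 0; first exact: cnorm_ge0.
  have bgt0 : 0 < cnorm b by rewrite lt_def b0 cnorm_ge0.
  by rewrite -(ler_pM2r bgt0) -expr2 -cnorm_starM cnormM.
apply/eqP; rewrite eq_le le andbT.
by have := le (star a); rewrite starK.
Qed.
End CstarNorm.

(* The iteration [y := (b + y ^ 2) / 2] started at 0, whose limit satisfies
   [(1 - y) ^ 2 = 1 - b]. Its value at [b = 1] in [R] bounds all norms. *)
Section SquareRoot.
Variables (R : realType) (A : cstarAlgType R) (b : A).
Hypothesis b_le1 : cnorm b <= 1.

Let half : R := 2^-1.
Let step (u : A) : A := half%:C *: (b + u * u).
Let Y n := iter n step 0.
Let y n : R := iter n (fun t => (1 + t ^+ 2) / 2) 0.

Let y_bounds n : 0 <= y n <= 1.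
Proof.
elim: n => [|n /andP[IH0 IH1]] /=; first by rewrite lexx ler01.
by apply/andP; split; rewrite /y /= -/(y n); nra.
Qed.

Let y_incr n : y n <= y n.+1.
Proof. by rewrite /y /= -/(y n); have := sqr_ge0 (1 - y n); nra. Qed.

Let cnorm_step u t : cnorm u <= t -> cnorm (step u) <= (1 + t ^+ 2) / 2.
Proof.
move=> ut; rewrite /step cnormZr rnorm_real ger0_norm ?invr_ge0 // mulrC.
rewrite ler_wpM2r ?invr_ge0 //; apply: le_trans (cnormD _ _) (lerD b_le1 _).
apply: le_trans (cnormM _ _) _; rewrite -expr2.
by rewrite lerXn2r ?nnegrE ?cnorm_ge0 // (le_trans _ ut) ?cnorm_ge0.
Qed.

Let Y_le n : cnorm (Y n) <= y n.
Proof. by elim: n => [|n IH]; [rewrite cnorm0|exact: cnorm_step]. Qed.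

Let comm_step c u : c * b = b * c -> c * u = u * c -> c * step u = step u * c.
Proof.
by move=> cb cu; rewrite /step -scalerAr -scalerAl mulrDr mulrDl cb !mulrA cu -!mulrA cu.
Qed.

Let comm_Y c n : c * b = b * c -> c * Y n = Y n * c.
Proof. by move=> cb; elim: n => [|n IH]; [rewrite mulr0 mul0r|exact: comm_step]. Qed.

Let Y_comm m n : Y m * Y n = Y n * Y m.
Proof. by apply: comm_Y; rewrite -comm_Y. Qed.

(** The iterates commute, so the difference of their squares factors. The scalar iteration factors
    in the same way, and its factors dominate. *)
Let Y_diff n : cnorm (Y n.+1 - Y n) <= y n.+1 - y n.
Proof.
elim: n => [|n IH].
  by rewrite /Y /y /= subr0 subr0; apply: le_trans (cnorm_step (t := 0) _) _; rewrite ?cnorm0.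
have -> : Y n.+2 - Y n.+1 = half%:C *: ((Y n.+1 - Y n) * (Y n.+1 + Y n)).
  rewrite [Y n.+2]/(step (Y n.+1)) [X in _ - X]/(step (Y n)) /step -scalerBr; congr (_ *: _).
  by rewrite opprD addrACA subrr add0r mulrDr !mulrBl (Y_comm n.+1 n) addrA subrK.
rewrite cnormZr rnorm_real ger0_norm ?invr_ge0 //.
have -> : y n.+2 - y n.+1 = half * ((y n.+1 - y n) * (y n.+1 + y n)).
  transitivity ((1 + y n.+1 ^+ 2) / 2 - (1 + y n ^+ 2) / 2) => //.
  by rewrite /half; move: (y n.+1) (y n) => s t; field.
rewrite ler_wpM2l ?invr_ge0 //; apply: le_trans (cnormM _ _) _.
apply: ler_pM; rewrite ?cnorm_ge0 //.
by apply: le_trans (cnormD _ _) (lerD _ _).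
Qed.

Let Y_dist m n : (n <= m)%N -> cnorm (Y m - Y n) <= y m - y n.
Proof.
elim: m => [|m IH]; first by rewrite leqn0 => /eqP ->; rewrite !subrr cnorm0.
rewrite leq_eqVlt => /orP[/eqP ->|/IH {}IH]; first by rewrite !subrr cnorm0.
apply: le_trans (cdist_triangle (Y m) _ _) _.
by rewrite -(subrKA (y m) (y m.+1) (- y n)) lerD ?Y_diff.
Qed.

Let Y_cauchy (e : R) : 0 < e -> exists N : nat, forall m k : nat,
  (N <= m)%N -> (N <= k)%N -> cnorm (Y m - Y k) < e.
Proof.
move=> e0.
have ynd : nondecreasing_seq y by apply/nondecreasing_seqP.
have yub : has_ubound (range y).
  by exists 1 => _ [n _ <-]; case/andP: (y_bounds n).
have /cvgrPdist_lt /(_ _ (divr_gt0 e0 (@ltr0Sn R 1))) := nondecreasing_cvgn ynd yub.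
case=> N _ hN; exists N => m k Nm Nk.
wlog mk : m k Nm Nk / (k <= m)%N => [H|].
  by case: (leqP k m) => [/H|/ltnW /H]; [|rewrite cdistC]; apply.
apply: le_lt_trans (Y_dist mk) _.
have := hN m Nm; have := hN k Nk; set l := sup _.
by rewrite /= !ltr_norml => /andP[a1 a2] /andP[a3 a4]; lra.
Qed.

(** The last clause is how [u] inherits from [b] what the iteration preserves: self-adjointness, or
    commutation with an operator. The bound [cnorm u <= 1] is what makes [1 - u] a root with
    nonnegative quadratic form. *)
Lemma sqrt_iteration : exists u : A,
  [/\ (1 - u) * (1 - u) = 1 - b, cnorm u <= 1 &
      forall D : set A, D 0 ->
        (forall v, D v -> D ((2^-1 : R)%:C *: (b + v * v))) -> norm_closed D -> D u].
Proof.
have [u uY] := cnorm_complete Y Y_cauchy.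
have uD (D : set A) : D 0 -> (forall v, D v -> D (step v)) -> norm_closed D -> D u.
  move=> D0 Ds Dc; apply: Dc => e e0; have [N hN] := uY _ e0.
  exists (Y N); last by rewrite cdistC hN.
  by elim: N {hN} => [|n IH]; [exact: D0|exact: Ds].
have u1 : cnorm u <= 1.
  apply: (uD [set v | cnorm v <= 1]) => [|v|v vD] /=; first by rewrite cnorm0 ler01.
    by move/cnorm_step => /le_trans; apply; rewrite expr1n; lra.
  apply/ler_addgt0Pl => e e0; have [w w1 vw] := vD _ e0.
  rewrite -[v](subrK w); apply: le_trans (cnormD _ _) (lerD (ltW vw) w1).
exists u; split=> //.
(* A fixed point satisfies [2 u = b + u ^ 2], which rearranges to [(1 - u) ^ 2 = 1 - b]. *)
have E : u = step u.
  apply/eqP; rewrite -subr_eq0; apply/eqP/cnorm_small_eq0 => e e0.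
  have e20 : 0 < e / 2 by rewrite divr_gt0.
  have [N hN] := uY _ e20; have hN1 := hN N.+1 (leqnSn N).
  apply: le_trans (cdist_triangle (Y N.+1) _ _) _.
  rewrite cdistC [e]splitr; apply: lerD; first exact: ltW.
  rewrite [Y N.+1]/(step (Y N)) /step -scalerBr.
  have -> : b + Y N * Y N - (b + u * u) = Y N * (Y N - u) + (Y N - u) * u.
    by rewrite opprD addrACA subrr add0r mulrBr mulrBl addrA subrK.
  rewrite cnormZr rnorm_real ger0_norm ?invr_ge0 //.
  have hle : cnorm (Y N * (Y N - u) + (Y N - u) * u) <= e / 2 + e / 2.
    have d := ltW (hN N (leqnn N)); have dg := cnorm_ge0 (Y N - u).
    have YN1 : cnorm (Y N) <= 1 by apply: le_trans (Y_le N) _; case/andP: (y_bounds N).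
    apply: le_trans (cnormD _ _) (lerD _ _); apply: le_trans (cnormM _ _) _.
      by apply: le_trans d; rewrite ler_piMl.
    by apply: le_trans d; rewrite ler_piMr.
  by rewrite /half; move: hle; lra.
have E2 : u + u = b + u * u.
  rewrite {1 2}E /step -scalerDl -rmorphD /=.
  have -> : half + half = 1 by rewrite /half; lra.
  by rewrite scale1r.
rewrite mulrBl mul1r mulrBr mulr1 opprB addrA addrAC -[1 - u - u]addrA -opprD E2.
by rewrite opprD addrA subrK.
Qed.
End SquareRoot.

(** * Representations are contractive *)

Section Representations.
Variables (R : realType) (A : cstarAlgType R) (rho : rep A).
Local Notation H := (rep_space rho).
Implicit Types (a b : A) (x y : H).

Lemma repD a b x : rho (a + b) x = rho a x + rho b x.
Proof. by have := @rep_linear _ _ rho 1 a b x; rewrite !scale1r. Qed.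

Lemma rep0 x : rho 0 x = 0.
Proof. by apply: (addrI (rho 0 x)); rewrite -repD !addr0. Qed.

Lemma repZ k a x : rho (k *: a) x = k *: rho a x.
Proof. by have := @rep_linear _ _ rho k a 0 x; rewrite addr0 rep0 addr0. Qed.

Lemma repN a x : rho (- a) x = - rho a x.
Proof. by rewrite -scaleN1r repZ scaleN1r. Qed.

Lemma repB a b x : rho (a - b) x = rho a x - rho b x.
Proof. by rewrite repD repN. Qed.

Lemma rep_sum (I : Type) (r : seq I) (P : pred I) (F : I -> A) x :
  rho (\sum_(i <- r | P i) F i) x = \sum_(i <- r | P i) rho (F i) x.
Proof.
by elim/big_rec2: _ => [|i y b _ <-]; [exact: rep0|exact: repD].
Qed.

Lemma rep_opD a x y : rho a (x + y) = rho a x + rho a y.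
Proof. by rewrite -[x]scale1r (rep_bounded rho a).1 !scale1r. Qed.

Lemma rep_opB a x y : rho a (x - y) = rho a x - rho a y.
Proof. exact: zmod_morphism_linear (rep_bounded rho a).1 x y. Qed.

Lemma rep_opZ a k x : rho a (k *: x) = k *: rho a x.
Proof. exact: scalable_linear (rep_bounded rho a).1 k x. Qed.

Lemma rep_op0 a : rho a 0 = 0.
Proof. by rewrite -(scale0r 0) rep_opZ !scale0r. Qed.

Lemma rep_starV a x y : dotp (rho (star a) x) y = dotp x (rho a y).
Proof. by rewrite rep_star starK. Qed.

(* If [cnorm a <= 1], then [1 - star a * a] is the square of a self-adjoint [c],
   whence [|rho a x|^2 = |x|^2 - |rho c x|^2]. *)
Lemma rep_contractive a x : rnorm (rho a x) <= cnorm a * rnorm x.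
Proof.
have le1 b : cnorm b <= 1 -> rnorm (rho b x) <= rnorm x.
  move=> b1; have bb1 : cnorm (star b * b) <= 1.
    by rewrite cnorm_starM exprn_ile1 ?cnorm_ge0.
  have [u [u2 _ uD]] := sqrt_iteration bb1.
  have u_sa : star u = u.
    apply: (uD [set v | star v = v]) => /= [|v vs|v vD]; first exact: star0.
      by rewrite starZ starD !starM starK vs conj_Creal // complex_real eqxx.
    apply/eqP; rewrite -subr_eq0; apply/eqP/cnorm_small_eq0 => e e0.
    have [w ws vw] := vD _ (divr_gt0 e0 (@ltr0Sn R 1)).
    apply: le_trans (cdist_triangle w _ _) _; rewrite [e]splitr.
    by apply: lerD; rewrite 1?[cnorm (w - v)]cdistC ?(ltW vw) // -{1}ws -starB cnorm_star ltW.
  have c_sa : star (1 - u) = 1 - u by rewrite starB star1 u_sa.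
  rewrite -(@ler_pXn2r _ 2) ?nnegrE ?rnorm_ge0 // -lecR !rnorm_sqr rep_star -rep_mul.
  have -> : star b * b = 1 - (1 - u) * (1 - u) by rewrite u2 subKr.
  rewrite repB dotpBr rep_one lerBlDr lerDl rep_mul -rep_starV c_sa.
  by rewrite -rnorm_sqr ler0c sqr_ge0.
have [a0|a0] := eqVneq (cnorm a) 0.
  by rewrite a0 mul0r (cnorm0_eq0 _ a0) rep0 rnorm0.
have agt0 : 0 < cnorm a by rewrite lt_def a0 cnorm_ge0.
have ia0 : 0 <= (cnorm a)^-1 by rewrite invr_ge0 ltW.
have := le1 (((cnorm a)^-1)%:C *: a).
rewrite cnormZr rnorm_real ger0_norm // mulVf // lexx => /(_ erefl).
by rewrite repZ rnormZ rnorm_real ger0_norm // ler_pdivrMl.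
Qed.

Lemma rep_norm_closed (S : set H) : closed S ->
  norm_closed [set a | forall x, S x -> S (rho a x)].
Proof.
move=> /closed_approx Scl a aS x Sx; apply: Scl => e e0.
have x1 : 0 < rnorm x + 1 by rewrite ltr_wpDl ?rnorm_ge0.
have [b bS ab] := aS _ (divr_gt0 e0 x1); exists (rho b x); first exact: bS.
rewrite -repB; apply: le_lt_trans (rep_contractive _ _) _.
apply: (@le_lt_trans _ _ (cnorm (a - b) * (rnorm x + 1))).
  by rewrite ler_wpM2l ?cnorm_ge0 // lerDl.
by rewrite -ltr_pdivlMr.
Qed.
End Representations.

(** * C*-subalgebras and induction on generators *)

Record cstar_subset (R : realType) (A : cstarAlgType R) := CstarSubset {
  subset_mem :> A -> Prop;
  subset1 : subset_mem 1;
  subset_lin : forall k a b, subset_mem a -> subset_mem b -> subset_mem (k *: a + b);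
  subsetM : forall a b, subset_mem a -> subset_mem b -> subset_mem (a * b);
  subset_star : forall a, subset_mem a -> subset_mem (star a);
  subset_closed : norm_closed subset_mem
}.

Module CstarSubalgebra.
Section Sub.
Variables (R : realType) (A : cstarAlgType R) (D : cstar_subset A).
Local Notation C := R[i].

Definition subset_pred : pred A := fun a => `[< D a >].

Lemma subset_pred_closed : subalg_closed subset_pred.
Proof.
split; first by apply/asboolP; exact: subset1.
- by move=> k a b /asboolP Da /asboolP Db; apply/asboolP; exact: subset_lin.
- by move=> a b /asboolP Da /asboolP Db; apply/asboolP; exact: subsetM.
Qed.

HB.instance Definition _ := GRing.isSubalgClosed.Build C A subset_pred
  (GRing.subalg_closed_semi subset_pred_closed).

Record cstar_sub := CstarSub { cstar_val :> A; _ : cstar_val \in subset_pred }.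
HB.instance Definition _ := [isSub for cstar_val].
HB.instance Definition _ := [Choice of cstar_sub by <:].
HB.instance Definition _ := [SubChoice_isSubAlgebra of cstar_sub by <:].

Lemma cstar_valP (a : cstar_sub) : D a.
Proof. by case: a => a /= /asboolP. Qed.

Lemma cstar_sub_mem a : D a -> a \in subset_pred.
Proof. by move=> Da; apply/asboolP. Qed.

Lemma cstar_val_inj (a b : cstar_sub) : a = b :> A -> a = b.
Proof. exact: val_inj. Qed.

Lemma cstar_val_sum (I : Type) (r : seq I) (P : pred I) (F : I -> cstar_sub) :
  \sum_(i <- r | P i) F i = \sum_(i <- r | P i) (F i : A) :> A.
Proof. exact: (big_morph cstar_val (fun _ _ => erefl) erefl). Qed.

Definition cstar_sub_star (a : cstar_sub) : cstar_sub :=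
  CstarSub (cstar_sub_mem (subset_star (cstar_valP a))).
Definition cstar_sub_norm (a : cstar_sub) : R := cnorm (a : A).

Let starK : involutive cstar_sub_star.
Proof. by move=> a; apply: cstar_val_inj; exact: starK. Qed.
Let starD : {morph cstar_sub_star : a b / a + b}.
Proof. by move=> a b; apply: cstar_val_inj; exact: starD. Qed.
Let starZ k a : cstar_sub_star (k *: a) = Num.conj k *: cstar_sub_star a.
Proof. by apply: cstar_val_inj; exact: starZ. Qed.
Let starM a b : cstar_sub_star (a * b) = cstar_sub_star b * cstar_sub_star a.
Proof. by apply: cstar_val_inj; exact: starM. Qed.
Let norm0 a : cstar_sub_norm a = 0 -> a = 0.
Proof. by move=> /cnorm0_eq0 a0; apply: cstar_val_inj; exact: a0. Qed.
Let normD a b : cstar_sub_norm (a + b) <= cstar_sub_norm a + cstar_sub_norm b.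
Proof. exact: cnormD. Qed.
Let normZ k a : (cstar_sub_norm (k *: a))%:C = `|k| * (cstar_sub_norm a)%:C.
Proof. exact: cnormZ. Qed.
Let normM a b : cstar_sub_norm (a * b) <= cstar_sub_norm a * cstar_sub_norm b.
Proof. exact: cnormM. Qed.
Let norm_starM a : cstar_sub_norm (cstar_sub_star a * a) = cstar_sub_norm a ^+ 2.
Proof. exact: cnorm_starM. Qed.
Let complete (u : nat -> cstar_sub) :
  (forall e : R, 0 < e -> exists N : nat, forall m k : nat,
     (N <= m)%N -> (N <= k)%N -> cstar_sub_norm (u m - u k) < e) ->
  exists l : cstar_sub, forall e : R, 0 < e -> exists N : nat, forall k : nat,
     (N <= k)%N -> cstar_sub_norm (u k - l) < e.
Proof.
move=> /(@cnorm_complete R A (fun n => u n : A))[l ul].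
have Dl : D l.
  apply: subset_closed => e /ul[N hN]; exists (u N); first exact: cstar_valP.
  by rewrite cdistC hN.
by exists (CstarSub (cstar_sub_mem Dl)).
Qed.

HB.instance Definition _ := isCstarAlgebra.Build R cstar_sub starK starD starZ starM
  norm0 normD normZ normM norm_starM complete.

Definition cstar_incl : starHom cstar_sub A.
Proof. by apply: (@StarHom _ _ _ (fun a : cstar_sub => a : A)). Defined.
End Sub.
End CstarSubalgebra.
Export CstarSubalgebra.

Section Composition.
Variables (R : realType) (A B C : cstarAlgType R) (g : starHom B C) (f : starHom A B).

Definition starHom_comp : starHom A C.
Proof.
apply: (@StarHom _ _ _ (g \o f)) => [k a b||a] /=.
- by rewrite !star_fun_linear.
- by split=> [|a b] /=; rewrite ?(star_fun_monoid f).1 ?(star_fun_monoid f).2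
    ?(star_fun_monoid g).1 ?(star_fun_monoid g).2.
- by rewrite !star_fun_star.
Defined.
End Composition.

Section Identity.
Variables (R : realType) (A : cstarAlgType R).

Definition starHom_id : starHom A A.
Proof. by apply: (@StarHom _ _ _ id). Defined.
End Identity.

(** The universal property yields a morphism into the subalgebra [D]. Followed by the inclusion it
    agrees with the identity on the generators, so by uniqueness it is the identity and every
    element lies in [D]. *)
Lemma universal_generated (R : realType) (G : Type)
    (rel : forall B : cstarAlgType R, (G -> B) -> Prop) (A : cstarAlgType R)
    (g : G -> A) (D : cstar_subset A) :
  universal rel g -> (forall h : G -> cstar_sub D, (forall i, h i = g i :> A) -> rel _ h) ->
  (forall i, D (g i)) -> forall a, D a.
Proof.
move=> [rg ug] rD Dg a.
pose h i : cstar_sub D := CstarSub (cstar_sub_mem (Dg i)).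
have [[f fh] _] := ug _ _ (rD h (fun=> erefl)).
have [_ uniq] := ug _ _ rg.
have /(_ a) /= <- : starHom_comp (cstar_incl D) f =1 starHom_id A.
  by apply: uniq => i //=; rewrite fh.
exact: cstar_valP.
Qed.

Section CuntzKriegerGenerated.
Variables (L : digraph) (R : realType) (O : cstarAlgType R) (x : vert L + edge L -> O).
Hypothesis xU : is_cuntz_krieger x.

(** The relations are equations, and the inclusion of the subalgebra is injective, so they descend
    to it. *)
Lemma cuntz_krieger_ind (D : cstar_subset O) : (forall i, D (x i)) -> forall a, D a.
Proof.
apply: universal_generated xU _ => h hx.
have [[X1 X2 X3] [X4 X5 X6]] := xU.1.
have vD : forall a b : cstar_sub D, a = b :> O -> a = b by exact: cstar_val_inj.
split; split.
- by move=> v; have [a b] := X1 v; split; apply: vD; rewrite /= hx.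
- by move=> v w vw; apply: vD; rewrite /= !hx X2.
- by apply: vD; rewrite cstar_val_sum -[RHS]X3; apply: eq_bigr => v _; rewrite hx.
- move=> w we; apply: vD; rewrite cstar_val_sum hx -(X4 w we).
  by apply: eq_bigr => e _; rewrite /= hx.
- by move=> e; apply: vD; rewrite /= !hx -X5.
- by move=> e; apply: vD; rewrite /= !hx -X6.
Qed.
End CuntzKriegerGenerated.

(** * The model representations *)

Section L2Basis.
Variables (R : realType) (T : choiceType) (D : pred T).
Local Notation H := (l2 R D).
Local Notation C := R[i].
Implicit Types (f : H) (A : {fset T}).

(** The estimate behind all model operators: each of them moves coordinates along a map [tau],
    injective where the result is nonzero, up to factors of modulus at most 1. *)
Lemma l2_dominated f (g : T -> C) (tau : T -> T) :
  (forall i, ~~ D i -> g i = 0) -> (forall i, nsq (g i) <= nsq (f (tau i))) ->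
  (forall i j, g i != 0 -> g j != 0 -> tau i = tau j -> i = j) ->
  forall A, psum (fun i => nsq (g i)) A <= usum (fun i => nsq (f i)).
Proof.
move=> gD gf tau_inj A; apply: le_trans (psum_nsq_le f (tau @` [fset i in A | g i != 0])%fset).
rewrite /psum (big_fsetID _ (fun i => g i != 0)) /= [X in _ + X]big1_fset; last first.
  by move=> i; rewrite !inE => /andP[_ /negPn/eqP ->] _; rewrite nsq0.
rewrite addr0 [leRHS]big_imfset /=; last first.
  by move=> i j; rewrite !inE => /andP[_ gi] /andP[_ gj]; exact: tau_inj.
by apply: ler_sum => i _; exact: gf.
Qed.

Lemma l2_dominatedP f (g : T -> C) (tau : T -> T) :
  (forall i, ~~ D i -> g i = 0) -> (forall i, nsq (g i) <= nsq (f (tau i))) ->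
  (forall i j, g i != 0 -> g j != 0 -> tau i = tau j -> i = j) ->
  g \in l2_pred D.
Proof.
move=> gD gf tau_inj; apply/asboolP; split=> //.
by exists (usum (fun i => nsq (f i))); exact: l2_dominated gD gf tau_inj.
Qed.

Lemma rnorm_l2_sqr f : rnorm f ^+ 2 = usum (fun i => nsq (f i)).
Proof. by apply: (@complexI _); rewrite rmorphXn /= rnormE l2_norm_sqr l2_dotE. Qed.

Lemma rnorm_l2_le f (c : R) : 0 <= c ->
  (forall A, psum (fun i => nsq (f i)) A <= c ^+ 2) -> rnorm f <= c.
Proof. by move=> c0 fc; rewrite -lecR rnormE; exact: l2_norm_le. Qed.

(** Equal to 0 when [j] lies outside [D], so that every index has a vector. *)
Definition delta_fun (j : T) : T -> C := fun i => (D i && (i == j))%:R.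

Lemma delta_subproof j : delta_fun j \in l2_pred D.
Proof.
apply/asboolP; split; first by move=> i; rewrite /delta_fun => /negPf ->.
exists 1 => A; rewrite /psum (big_fsetID _ (fun i => i == j)) /= [X in _ + X]big1_fset ?addr0.
  apply: (@le_trans _ _ (\sum_(i <- [fset x in A | x == j]%fset) 1)).
    apply: ler_sum => i _; rewrite /nsq /delta_fun.
    by case: (_ && _); rewrite /= ?expr0n ?expr1n ?addr0.
  apply: (@le_trans _ _ (\sum_(i <- [fset j]%fset) 1)).
    apply: (@le_psum _ _ (fun=> 1)) => //.
    by apply/fsubsetP => i; rewrite !inE => /andP[].
  by rewrite big_seq_fset1.
move=> i; rewrite !inE => /andP[_ /negPf ij] _.
by rewrite /delta_fun ij andbF nsq0.
Qed.

Definition delta j : H := L2 (delta_subproof j).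

Lemma deltaE j i : delta j i = (D i && (i == j))%:R.
Proof. by []. Qed.

Lemma dotp_delta f j : dotp f (delta j) = f j.
Proof.
have [Dj|nDj] := boolP (D j); last first.
  rewrite (l2_out f nDj) (_ : delta j = 0) ?dotp0r //.
  by apply: l2P => i; rewrite deltaE; case: eqP => [->|]; rewrite ?(negPf nDj) ?andbF.
rewrite [LHS]/(l2_dot f (delta j)) /l2_dot.
have E i : i \notin [fset j]%fset -> f i * (delta j i)^* = 0.
  by rewrite inE deltaE => /negPf ->; rewrite andbF rmorph0 mulr0.
rewrite !(@usum_finite _ _ _ [fset j]%fset) /psum ?big_seq_fset1.
- rewrite deltaE Dj eqxx; case: (f j) => a b /=.
  by rewrite oppr0 !mulr0 !mulr1 subr0 add0r.
- by move=> i /E ->.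
- by move=> i /E ->.
Qed.

Lemma sum_delta f A i : (\sum_(j <- A) f j *: delta j) i = (i \in A)%:R * f i.
Proof.
have [Di|nDi] := boolP (D i); last by rewrite !(l2_out _ nDi) mulr0.
have -> : (\sum_(j <- A) f j *: delta j) i = \sum_(j <- A) f j * (i == j)%:R.
  rewrite (big_morph (fun u : H => u i) (id1 := 0) (op1 := +%R)) //.
  by apply: eq_bigr => j _; transitivity (f j * (D i && (i == j))%:R) => //; rewrite Di.
have [iA|iA] := boolP (i \in A).
  rewrite mul1r (big_fsetD1 i) //= eqxx mulr1 big1_fset ?addr0 // => j.
  by rewrite !inE eq_sym => /andP[/negPf -> _]; rewrite mulr0.
rewrite mul0r big1_fset // => j jA _; case: eqP => [ij|]; last by rewrite mulr0.
by rewrite ij jA in iA.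
Qed.

Lemma l2_approx f (e : R) : 0 < e ->
  exists A, rnorm (f - \sum_(j <- A) f j *: delta j) < e.
Proof.
move=> e0.
(* A tail of squares below [e ^ 2 / 4] bounds the norm by [e / 2], which is strictly less than
   [e]. *)
have := cvg_usum (@usummable_nsq _ _ _ f) => /cvgrPdist_lt /(_ (e ^+ 2 / 4)).
have e2 : 0 < e ^+ 2 / 4 by rewrite divr_gt0 // exprn_gt0.
move=> /(_ (@filter_filter _ _ (@summability.totally_filter T)) e2).
move=> [A _ /(_ A (fsubset_refl A))] /= hA; exists A.
apply: (@le_lt_trans _ _ (e / 2)); last by rewrite ltr_pdivrMr // ltr_pMr // ltr1n.
apply: rnorm_l2_le => [|B]; first by rewrite divr_ge0 ?ltW.
have AB := psum_nsq_le f (A `|` B)%fset.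
have split_sum : psum (fun i => nsq (f i)) (A `|` B)%fset =
    psum (fun i => nsq (f i)) A + psum (fun i => nsq (f i)) (B `\` A)%fset.
  rewrite {1}/psum (big_fsetID _ (mem A)) /=.
  have -> : [fset x in A `|` B | x \in A]%fset = A.
    by apply/fsetP => i; rewrite !inE; case: (i \in A); rewrite ?andbF.
  have -> // : [fset x in A `|` B | x \notin A]%fset = (B `\` A)%fset.
  by apply/fsetP => i; rewrite !inE; case: (i \in A); rewrite ?andbF ?andbT.
have : psum (fun i => nsq ((f - \sum_(j <- A) f j *: delta j) i)) B <=
   psum (fun i => nsq (f i)) (B `\` A)%fset.
  have E i : (f - \sum_(j <- A) f j *: delta j) i = (i \notin A)%:R * f i.
    transitivity (f i - (\sum_(j <- A) f j *: delta j) i) => //.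
    rewrite sum_delta; case: (i \in A); rewrite ?mul1r ?mul0r ?subrr ?subr0 //.
  rewrite /psum (big_fsetID _ (mem A)) /= [X in X + _]big1_fset ?add0r => [|i].
    rewrite le_eqVlt; apply/orP; left; apply/eqP.
    have -> : [fset x in B | x \notin A]%fset = (B `\` A)%fset.
      by apply/fsetP => i; rewrite !inE andbC.
    apply: eq_big_seq => i; rewrite inE => /andP[iA _].
    by rewrite -[LHS]/(nsq ((f - \sum_(j <- A) f j *: delta j) i)) E iA mul1r.
  rewrite !inE => /andP[_ iA] _; rewrite -[LHS]/(nsq ((f - \sum_(j <- A) f j *: delta j) i)).
  by rewrite E iA mul0r nsq0.
move=> /le_trans; apply; rewrite expr_div_n -natrX.
move: hA AB; rewrite split_sum ger0_norm ?subr_ge0 ?psum_nsq_le //.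
lra.
Qed.

Lemma delta_dense (S : set H) : Defs.subspace S -> closed S ->
  (forall j, D j -> S (delta j)) -> forall f, S f.
Proof.
move=> [S0 Sl] /closed_approx Scl Sd f; apply: Scl => e e0.
have [A fA] := l2_approx f e0; exists (\sum_(j <- A) f j *: delta j) => //.
apply: (@big_ind _ (fun u => S u) _ _ S0) => [u w Su Sw|j _].
  by rewrite -[u]scale1r; exact: Sl.
rewrite -[_ *: _]addr0; apply: Sl => //.
have [Dj|nDj] := boolP (D j); first exact: Sd.
rewrite (_ : delta j = 0) //; apply: l2P => i.
by rewrite deltaE; case: eqP => [->|]; rewrite ?(negPf nDj) ?andbF.
Qed.
End L2Basis.

(* Cycles are loops, and a vertex receives exactly one loop as soon as it
   receives an edge; [h] witnesses the absence of other cycles. *)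
Definition only_loops (L : digraph) (h : vert L -> nat) : Prop :=
  [/\ forall e : edge L, src e = rng e \/ (h (src e) < h (rng e))%N,
      forall w : vert L, (exists e, rng e = w) -> exists l : edge L, src l = w /\ rng l = w
    & forall e e' : edge L, src e = rng e -> src e' = rng e' -> rng e = rng e' -> e = e'].

Section Model.
Variables (L : digraph) (R : realType) (v : vert L) (z : R[i]).
Hypothesis z1 : `|z| = 1.
Implicit Types (e : edge L) (es : seq (edge L)) (w : vert L).

(** The range of the path [es] out of [v]; lists have the last edge of the path in front. *)
Definition top es : vert L := if es is e :: _ then rng e else v.

Definition at_loop e := (src e == v) && (rng e == v).

(* The paths with source [v] that do not start with the loop at [v]; their
   classes form an orthonormal basis of Pi(M_{v,z}). *)
Fixpoint reduced es : bool :=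
  if es is e :: es' then
    [&& src e == top es', reduced es' & ~~ (nilp es' && (rng e == v))]
  else true.

Local Notation H := (l2 R reduced).
Implicit Type f : H.

Lemma z_mulJ : z^* * z = 1.
Proof. by rewrite mulrC -sqr_normc z1 expr1n. Qed.

Let nsqz : nsq z = 1.
Proof. by apply: (@complexI _); rewrite nsqE z1 expr1n. Qed.

Let nsqzJ : nsq z^* = 1.
Proof. by apply: (@complexI _); rewrite nsqE normcJ z1 expr1n. Qed.

Definition vfun w f : seq (edge L) -> R[i] := fun es => if top es == w then f es else 0.

(** Prepends [e] to the basis paths. Prepending the loop at [v] to the empty path leaves the reduced
    paths; there it acts by [z^*], because the defining relation of Pi(M_{v,z}) reads [[v, xi] =
    [loop, z *: xi]]. *)
Definition efun e f : seq (edge L) -> R[i] := fun es =>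
  if es is e' :: es' then if (e' == e) && reduced es then f es' else 0
  else if at_loop e then z^* * f [::] else 0.

(** The adjoint of [efun e], which removes a leading [e]. Where [e :: es] is not reduced, the
    coordinate [f (e :: es)] is already 0. *)
Definition esfun e f : seq (edge L) -> R[i] := fun es =>
  if nilp es && at_loop e then z * f [::] else f (e :: es).

Lemma loop_not_reduced e es : at_loop e -> nilp es -> reduced (e :: es) = false.
Proof. by case: es => //= /andP[-> ->] _; rewrite !andbF. Qed.

Let nsq_if (b : bool) (c : R[i]) : nsq (if b then c else 0) <= nsq c.
Proof. by case: b => //; rewrite nsq0 nsq_ge0. Qed.

Lemma reduced_behead e es : reduced (e :: es) -> reduced es.
Proof. by case/and3P. Qed.

Let dominated (g : seq (edge L) -> R[i]) f := exists tau : seq (edge L) -> seq (edge L),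
  [/\ forall es, ~~ reduced es -> g es = 0,
      forall es, nsq (g es) <= nsq (f (tau es))
    & forall es es', g es != 0 -> g es' != 0 -> tau es = tau es' -> es = es'].

Let dominated_in g f : dominated g f -> g \in l2_pred reduced.
Proof. by case=> tau [g0 gf tau_inj]; exact: l2_dominatedP g0 gf tau_inj. Qed.

Let vdom w f : dominated (vfun w f) f.
Proof.
exists id; split=> // es; last exact: nsq_if.
by move=> nes; rewrite /vfun l2_out ?if_same.
Qed.

(** [behead] confuses [[::]] with [[:: e]]. Both coordinates of [efun e f] cannot be nonzero: the
    first requires [e] to be the loop at [v], and then [[:: e]] is not reduced. *)
Let edom e f : dominated (efun e f) f.
Proof.
exists behead; split.
- by move=> [|e' es] //= /negPf nr; rewrite nr andbF.
- move=> [|e' es] /=; last exact: nsq_if.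
  by apply: le_trans (nsq_if _ _) _; rewrite nsqM nsqzJ mul1r.
- have nz0 (b : bool) (c : R[i]) : (if b then c else 0) != 0 -> b.
    by case: b; rewrite ?eqxx.
  have no e' : at_loop e -> (e' == e) && reduced [:: e'] -> False.
    by move=> le /andP[/eqP ->]; rewrite loop_not_reduced.
  move=> [|e1 es1] [|e2 es2] // /nz0 h1 /nz0 h2 /= E.
  + by case: (no e2 h1); rewrite E.
  + by case: (no e1 h2); rewrite -E.
  + by move: h1 h2 => /andP[/eqP -> _] /andP[/eqP -> _]; rewrite E.
Qed.

Let esdom e f : dominated (esfun e f) f.
Proof.
exists (fun es => if nilp es && at_loop e then [::] else e :: es); split.
- move=> [|e' es] // nr; rewrite /esfun /= l2_out //.
  by apply: contra nr; exact: reduced_behead.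
- by move=> es; rewrite /esfun; case: ifP => // _; rewrite nsqM nsqz mul1r.
- by move=> es1 es2 _ _; case: ifP => [/andP[/nilP -> _]|_];
    case: ifP => [/andP[/nilP -> _]|_] // [].
Qed.

Definition vmap w f : H := L2 (dominated_in (vdom w f)).
Definition emap e f : H := L2 (dominated_in (edom e f)).
Definition esmap e f : H := L2 (dominated_in (esdom e f)).

Let l2Z k f es : (k *: f : H) es = k * f es.
Proof. by []. Qed.

Lemma vmapE w f es : vmap w f es = if top es == w then f es else 0.
Proof. by []. Qed.

Lemma emap_nil e f : emap e f [::] = if at_loop e then z^* * f [::] else 0.
Proof. by []. Qed.

Lemma emap_cons e f e' es :
  emap e f (e' :: es) = if (e' == e) && reduced (e' :: es) then f es else 0.
Proof. by []. Qed.

Lemma esmapE e f es : esmap e f es = if nilp es && at_loop e then z * f [::] else f (e :: es).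
Proof. by []. Qed.

Let dominated_bound (T : H -> H) : (forall f, dominated (T f) f) -> exists c : R, op_bound T c.
Proof.
move=> Tdom; exists 1; split=> // f; rewrite mul1r.
apply: rnorm_l2_le => [|A]; first exact: rnorm_ge0.
by rewrite rnorm_l2_sqr; case: (Tdom f) => tau [g0 gf tau_inj]; exact: l2_dominated g0 gf tau_inj _.
Qed.

Let linearP (T : H -> H) :
  (forall k f g es, T (k *: f + g) es = k * T f es + T g es) -> linear T.
Proof. by move=> Tl k f g; apply: l2P => es; exact: Tl. Qed.

Let vmap_linear w : linear (vmap w).
Proof.
apply: linearP => k f g es; rewrite !vmapE l2E.
by case: ifP => // _; rewrite mulr0 addr0.
Qed.

Let emap_linear e : linear (emap e).
Proof.
apply: linearP => k f g [|e' es]; rewrite ?emap_nil ?emap_cons l2E; case: ifP => _;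
  rewrite ?mulr0 ?addr0 //.
by rewrite mulrDr mulrCA.
Qed.

Let esmap_linear e : linear (esmap e).
Proof.
apply: linearP => k f g es; rewrite !esmapE !l2E; case: ifP => _ //.
by rewrite mulrDr mulrCA.
Qed.

(* By density, it suffices to check adjointness on the basis. *)
Let adjointP (T S : H -> H) : linear T -> (forall f, dominated (T f) f) ->
  linear S -> (forall f, dominated (S f) f) ->
  (forall f es, reduced es -> T f es = dotp f (S (delta R reduced es))) -> op_adjoint T S.
Proof.
move=> Tl Td Sl Sd TS f g.
pose K : set H := [set g | dotp (T f) g = dotp f (S g)].
apply: (@delta_dense _ _ _ K _ _ _ g) => [||es res]; last first.
- by rewrite /K /= dotp_delta TS.
- apply/closed_approx => x xK; apply/eqP; rewrite -subr_eq0; apply/eqP.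
  apply: rnorm_small_eq0 => e e0.
  have [c [c0 Sc]] := dominated_bound Sd; have [d [d0 Td']] := dominated_bound Td.
  have f1 : 0 < (d + c) * rnorm f + 1 by rewrite ltr_wpDl ?mulr_ge0 ?addr_ge0 ?rnorm_ge0.
  have [y yK xy] := xK _ (divr_gt0 e0 f1).
  have -> : dotp (T f) x - dotp f (S x) = dotp (T f) (x - y) - dotp f (S (x - y)).
    by rewrite (zmod_morphism_linear Sl) !dotpBr yK opprB addrA subrK.
  apply: le_trans (rnormD _ _) _; rewrite rnormN.
  have h1 := dotp_le (T f) (x - y); have h2 := dotp_le f (S (x - y)).
  apply: (@le_trans _ _ (((d + c) * rnorm f + 1) * rnorm (x - y))); last first.
    by rewrite mulrC -ler_pdivlMr // ltW.
  have h3 := ler_wpM2r (rnorm_ge0 (x - y)) (Td' f).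
  have h4 := ler_wpM2l (rnorm_ge0 f) (Sc (x - y)).
  have h5 := rnorm_ge0 (x - y).
  by move: h1 h2 h3 h4 h5; nra.
- have S0 : S 0 = 0 by rewrite -{1}(subrr 0) (zmod_morphism_linear Sl) subrr.
  split; first by rewrite /K /= S0 !dotp0r.
  by move=> k x y xK yK; rewrite /K /= Sl !dotpDr !dotpZr xK yK.
Qed.

Let vadj w : op_adjoint (vmap w) (vmap w).
Proof.
apply: (adjointP (vmap_linear w) (vdom w) (vmap_linear w) (vdom w)) => f es res.
rewrite vmapE.
have -> : vmap w (delta R reduced es) = if top es == w then delta R reduced es else 0.
  apply: l2P => es'; rewrite vmapE; case: (eqVneq es es') => [->|es_es'].
    by case: ifP => // _; rewrite (_ : (0 : H) _ = 0).
  have d0 : delta R reduced es es' = 0.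
    by rewrite deltaE eq_sym (negPf es_es') andbF.
  by rewrite d0 if_same; case: ifP => _; rewrite ?d0.
by case: ifP; rewrite ?dotp_delta ?dotp0r.
Qed.

Lemma esmap_delta_nil e : esmap e (delta R reduced [::]) =
  if at_loop e then z *: delta R reduced [::] else 0.
Proof.
apply: l2P => es; rewrite esmapE deltaE; case: ifP => [/andP[/nilP -> ->] //|].
rewrite (_ : delta R reduced [::] (e :: es) = 0); last by rewrite deltaE andbF.
case: es => [|e' es] /= le; last by case: ifP => // _; rewrite l2Z deltaE andbF mulr0.
by rewrite le.
Qed.

Lemma esmap_delta_cons e e' es : reduced (e' :: es) ->
  esmap e (delta R reduced (e' :: es)) = if e == e' then delta R reduced es else 0.
Proof.
move=> red; apply: l2P => es'; rewrite esmapE.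
have [/andP[/nilP -> le]|nle] := boolP (nilp es' && at_loop e).
  rewrite deltaE /= mulr0; case: eqP => // ee'; rewrite deltaE /=.
  by case: es red => // red; rewrite -ee' loop_not_reduced in red.
rewrite deltaE eqseq_cons; have [ee'|] := eqVneq e e'; last by rewrite andbF.
rewrite deltaE; case: (eqVneq es' es) => [->|]; last by rewrite !andbF.
by rewrite ee' red (reduced_behead red).
Qed.

Let eadj e : op_adjoint (emap e) (esmap e).
Proof.
apply: (adjointP (emap_linear e) (edom e) (esmap_linear e) (esdom e)) => f [|e' es] res.
  rewrite emap_nil esmap_delta_nil; case: ifP => _; last by rewrite dotp0r.
  by rewrite dotpZr dotp_delta.
rewrite emap_cons esmap_delta_cons // res andbT eq_sym.
by case: ifP => _; rewrite ?dotp_delta ?dotp0r.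
Qed.

Lemma model_nz : exists x : H, x != 0.
Proof.
exists (delta R reduced [::]); apply/eqP => /(congr1 (fun u : H => u [::])).
by rewrite deltaE /=; apply/eqP; exact: oner_neq0.
Qed.

Local Notation B := (bop model_nz).

Let bopP' (T S : H -> H) : linear T -> (forall f, dominated (T f) f) -> op_adjoint T S ->
  T \in @bop_pred R H.
Proof.
by move=> Tl Td TS; apply/asboolP; split=> //; [exact: dominated_bound|exists S].
Qed.

Definition vbop w : B :=
  Bop model_nz (bopP' (vmap_linear w) (vdom w) (vadj w)).
Definition ebop e : B :=
  Bop model_nz (bopP' (emap_linear e) (edom e) (eadj e)).

Definition model_gen (g : vert L + edge L) : B :=
  match g with inl w => vbop w | inr e => ebop e end.

Lemma star_vbop w : star (vbop w) = vbop w.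
Proof. by apply: bopP => f; exact: (@star_bop_apply _ _ _ (vbop w) _ (vadj w) f). Qed.

Lemma star_ebop e f : star (ebop e) f = esmap e f.
Proof. exact: (@star_bop_apply _ _ _ (ebop e) _ (eadj e) f). Qed.

Lemma bop_sum (I : Type) (r : seq I) (P : pred I) (F : I -> B) f :
  (\sum_(i <- r | P i) F i) f = \sum_(i <- r | P i) F i f.
Proof. exact: (big_morph (fun S : B => S f) (fun _ _ => erefl) erefl). Qed.

Lemma l2_sum (I : Type) (r : seq I) (P : pred I) (F : I -> H) es :
  (\sum_(i <- r | P i) F i) es = \sum_(i <- r | P i) F i es.
Proof. exact: (big_morph (fun u : H => u es) (fun _ _ => erefl) erefl). Qed.

Lemma vbopE w f es : vbop w f es = if top es == w then f es else 0.
Proof. by []. Qed.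

Lemma ebop_nil e f : ebop e f [::] = if at_loop e then z^* * f [::] else 0.
Proof. by []. Qed.

Lemma ebop_cons e f e' es :
  ebop e f (e' :: es) = if (e' == e) && reduced (e' :: es) then f es else 0.
Proof. by []. Qed.

Lemma star_ebopE e f es :
  star (ebop e) f es = if nilp es && at_loop e then z * f [::] else f (e :: es).
Proof. by rewrite star_ebop. Qed.

Lemma ebop_bop_star e f es : (ebop e * star (ebop e)) f es =
  if es is e' :: es' then if e' == e then f es else 0
  else if at_loop e then f [::] else 0.
Proof.
rewrite bopM; case: es => [|e' es].
  rewrite ebop_nil star_ebopE (_ : nilp [::] = true) //=.
  by case: (at_loop e); rewrite // mulrA z_mulJ mul1r.
rewrite ebop_cons star_ebopE; have [->|//] := eqVneq e' e; rewrite andTb.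
have [red|nred] := boolP (reduced (e :: es)); last by rewrite (l2_out f nred).
case: ifP => // /andP[nil le].
by rewrite loop_not_reduced in red.
Qed.

Variable h : vert L -> nat.
Hypothesis Lh : only_loops h.

Lemma model_ck : ck_relations model_gen.
Proof.
have [_ loop_ex loop_uniq] := Lh; rewrite /ck_relations /model_gen.
split; split.
- move=> w; split; first exact: star_vbop.
  by apply: bopP => f; apply: l2P => es; rewrite bopM !vbopE; case: (top es == w).
- move=> w w' /eqP ww'; apply: bopP => f; apply: l2P => es; rewrite bopM !vbopE.
  by case: (eqVneq (top es) w) => [->|] //; case: eqP.
- apply: bopP => f; apply: l2P => es; rewrite bop_sum l2_sum bop1.
  rewrite (bigD1 (top es)) //= -[RHS]addr0; congr (_ + _).
    by rewrite -[LHS]/(vbop (top es) f es) vbopE eqxx.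
  rewrite big1 // => w /negPf tw.
  by rewrite -[LHS]/(vbop w f es) vbopE eq_sym tw.
(* In the coordinate [es], when its range is [w], exactly one summand survives: that of the edge in
   front of [es], or that of the loop at [v] if [es] is empty. The loop exists because [v = w]
   receives [e0]. *)
- move=> w [e0 e0w]; apply: bopP => f; apply: l2P => es; rewrite bop_sum l2_sum.
  rewrite vbopE (eq_bigr (fun e => if es is e' :: es' then if e' == e then f es else 0
    else if at_loop e then f [::] else 0)) => [|e _]; last exact: ebop_bop_star.
  case: es => [|e' es] /=.
    case: eqP => [vw|vw]; last first.
      rewrite big1 // => e /eqP ew; case: ifP => // /andP[_ /eqP rv].
      by case: vw; rewrite -rv.
    have [l [sl rl]] : exists l : edge L, src l = w /\ rng l = w.
      by apply: loop_ex; exists e0.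
    rewrite (bigD1 l) ?rl //= /at_loop sl rl vw eqxx /= big1 ?addr0 // => e.
    move=> /andP[/eqP re el]; case: ifP => // /andP[/eqP se _]; case/eqP: el.
    by apply: loop_uniq; rewrite ?se ?re ?sl ?rl.
  case: eqP => [rw|rw].
    rewrite (bigD1 e') ?rw //= eqxx big1 ?addr0 // => e /andP[_].
    by rewrite eq_sym => /negPf ->.
  by rewrite big1 // => e /eqP ew; case: eqP => // E; case: rw; rewrite E.
- move=> e; change (ebop e = vbop (rng e) * ebop e).
  apply: bopP => f; apply: l2P => -[|e' es]; rewrite bopM vbopE.
    by rewrite ebop_nil /=; case: ifP => [/andP[_ /eqP ->]|]; rewrite ?eqxx ?if_same.
  by rewrite ebop_cons /=; case: eqP => [->|]; rewrite ?eqxx ?if_same.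
- move=> e; change (star (ebop e) * ebop e = vbop (src e)).
  apply: bopP => f; apply: l2P => es; rewrite bopM star_ebopE vbopE.
  have [/andP[/nilP -> le]|nle] := boolP (nilp es && at_loop e).
    by rewrite ebop_nil le mulrA [z * _]mulrC z_mulJ mul1r /= eq_sym; case/andP: le => ->.
  (* If [es] is reduced and ends at [src e] while [e :: es] is not reduced, then [es] is empty and
     [e] is the loop at [v], the case just treated. *)
  rewrite ebop_cons eqxx /=; case: (eqVneq (top es) (src e)) => [ts|ts].
    case: (boolP (reduced es)) => [red|nred]; last by rewrite (l2_out f nred).
    case: ifP => //= /negbT; rewrite negbK => /andP[nil /eqP rv].
    case/negP: nle; rewrite nil /at_loop rv eqxx andbT -ts.
    by move/nilP: nil => -> /=.
  by [].
Qed.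
End Model.

Section RepOfHom.
Variables (R : realType) (A : cstarAlgType R) (H : hilbertType R).
Variables (nz : exists x : H, x != 0) (f : starHom A (bop nz)).

Lemma bop_bounded_op (T : bop nz) : bounded_op T.
Proof.
split; first exact: bop_linear.
by exists (bop_norm T)%:C => x; rewrite -!rnormE -rmorphM lecR bop_norm_apply.
Qed.

Definition rep_of_hom : rep A.
Proof.
apply: (@Rep _ _ H (fun a => f a)) => [a|k a b x|x|a b x|a x y].
- exact: bop_bounded_op.
- by rewrite star_fun_linear.
- by rewrite (star_fun_monoid f).1.
- by rewrite (star_fun_monoid f).2.
- by rewrite bop_starE star_fun_star.
Defined.
End RepOfHom.

Section GeneratedRep.
Variables (L : digraph) (R : realType) (O : cstarAlgType R) (x : vert L + edge L -> O).
Hypothesis xU : is_cuntz_krieger x.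

Lemma ck_star_vert w : star (x (inl w)) = x (inl w).
Proof. by have [[+ _ _] _] := xU.1 => /(_ w)[]. Qed.
Lemma ck_vertK w : x (inl w) * x (inl w) = x (inl w).
Proof. by have [[+ _ _] _] := xU.1 => /(_ w)[]. Qed.
Lemma ck_vert_orth w w' : w != w' -> x (inl w) * x (inl w') = 0.
Proof. by have [[_ + _] _] := xU.1; apply. Qed.
Lemma ck_vert_sum : \sum_w x (inl w) = 1.
Proof. by have [[_ _ +] _] := xU.1. Qed.
Lemma ck_edge_sum w : (exists e : edge L, rng e = w) ->
  \sum_(e | rng e == w) x (inr e) * star (x (inr e)) = x (inl w).
Proof. by have [_ [+ _ _]] := xU.1; apply. Qed.
Lemma ck_rng e : x (inl (rng e)) * x (inr e) = x (inr e).
Proof. by have [_ [_ <- _]] := xU.1. Qed.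
Lemma ck_star_edge e : star (x (inr e)) * x (inr e) = x (inl (src e)).
Proof. by have [_ [_ _ ->]] := xU.1. Qed.

Lemma ck_star_rng e : star (x (inr e)) * x (inl (rng e)) = star (x (inr e)).
Proof. by rewrite -{1}ck_star_vert -starM ck_rng. Qed.

Variable sigma : rep O.
Local Notation K := (rep_space sigma).

(** The elements that preserve [S] together with their adjoints form a C*-subalgebra; it is
    norm-closed because [sigma] is contractive. *)
Lemma rep_invariant (S : set K) : Defs.subspace S -> closed S ->
  (forall g xi, S xi -> S (sigma (x g) xi)) ->
  (forall g xi, S xi -> S (sigma (star (x g)) xi)) ->
  forall a xi, S xi -> S (sigma a xi).
Proof.
move=> [S0 Sl] Scl Sx Ssx.
pose D a := (forall xi, S xi -> S (sigma a xi)) /\ (forall xi, S xi -> S (sigma (star a) xi)).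
have D1 : D 1 by split=> xi; rewrite ?star1 rep_one.
have Dl k a b : D a -> D b -> D (k *: a + b).
  move=> [a1 a2] [b1 b2]; split=> xi Sxi; rewrite ?star_linear rep_linear.
    by apply: Sl; [exact: a1|exact: b1].
  by apply: Sl; [exact: a2|exact: b2].
have DM a b : D a -> D b -> D (a * b).
  by move=> [a1 a2] [b1 b2]; split=> xi Sxi; rewrite ?starM rep_mul; auto.
have Ds a : D a -> D (star a) by move=> [a1 a2]; split=> // xi; rewrite starK; exact: a1.
have Dc : norm_closed D.
  move=> a aD; split; apply: (rep_norm_closed Scl) => e e0; have [b [b1 b2] ab] := aD _ e0.
    by exists b.
  by exists (star b) => //; rewrite -starB cnorm_star.
pose DD := CstarSubset D1 Dl DM Ds Dc.
move=> a.
have /(_ _ a)[] // : (forall i, DD (x i)) -> forall a, DD a := cuntz_krieger_ind xU (D := DD).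
by move=> g; split=> xi; [exact: Sx|exact: Ssx].
Qed.

(** As for invariance: the intertwining elements, paired with their adjoints, form a C*-subalgebra.
    Contractivity of [U] and of both representations gives closedness. *)
Lemma rep_intertwine (rho : rep O) (U : K -> rep_space rho) : linear U ->
  (forall xi, rnorm (U xi) <= rnorm xi) ->
  (forall g xi, U (sigma (x g) xi) = rho (x g) (U xi)) ->
  (forall g xi, U (sigma (star (x g)) xi) = rho (star (x g)) (U xi)) ->
  forall a xi, U (sigma a xi) = rho a (U xi).
Proof.
move=> Ul Uc Ux Usx.
pose D a := (forall xi, U (sigma a xi) = rho a (U xi)) /\
  (forall xi, U (sigma (star a) xi) = rho (star a) (U xi)).
have D1 : D 1 by split=> xi; rewrite ?star1 !rep_one.
have Dl k a b : D a -> D b -> D (k *: a + b).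
  by move=> [a1 a2] [b1 b2]; split=> xi; rewrite ?star_linear !rep_linear Ul ?a1 ?b1 ?a2 ?b2.
have DM a b : D a -> D b -> D (a * b).
  by move=> [a1 a2] [b1 b2]; split=> xi; rewrite ?starM !rep_mul ?a1 ?b1 ?b2 ?a2.
have Ds a : D a -> D (star a) by move=> [a1 a2]; split=> // xi; rewrite starK; exact: a1.
have close a xi : (forall e : R, 0 < e -> exists2 b, (forall xi, U (sigma b xi) = rho b (U xi)) &
    cnorm (a - b) < e) -> U (sigma a xi) = rho a (U xi).
  move=> ab; apply/eqP; rewrite -subr_eq0; apply/eqP/rnorm_small_eq0 => e e0.
  have m0 : 0 < 2 * rnorm xi + 1 by rewrite ltr_wpDl ?mulr_ge0 ?rnorm_ge0.
  have [b Ub d] := ab _ (divr_gt0 e0 m0).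
  have -> : U (sigma a xi) - rho a (U xi) = U (sigma (a - b) xi) - rho (a - b) (U xi).
    by rewrite !repB (zmod_morphism_linear Ul) Ub opprB addrA subrK.
  apply: le_trans (rnormD _ _) _; rewrite rnormN.
  have h1 := le_trans (Uc (sigma (a - b) xi)) (@rep_contractive _ _ sigma (a - b) xi).
  have h2 := le_trans (@rep_contractive _ _ rho (a - b) (U xi))
    (ler_wpM2l (cnorm_ge0 (a - b)) (Uc xi)).
  apply: le_trans (lerD h1 h2) _.
  apply: (@le_trans _ _ (cnorm (a - b) * (2 * rnorm xi + 1))).
    by move: (cnorm_ge0 (a - b)) (rnorm_ge0 xi); nra.
  by rewrite -ler_pdivlMr // ltW.
have Dc : norm_closed D.
  move=> a aD; split=> xi; apply: close => e e0; have [b [b1 b2] ab] := aD _ e0.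
    by exists b.
  by exists (star b) => //; rewrite -starB cnorm_star.
pose DD := CstarSubset D1 Dl DM Ds Dc.
move=> a.
have /(_ _ a)[] // : (forall i, DD (x i)) -> forall a, DD a := cuntz_krieger_ind xU (D := DD).
Qed.

End GeneratedRep.

(** The first edge out of [v] is not the loop at [v], so it raises [h]; later edges may be loops
    elsewhere, but never lower it. *)
Lemma only_loops_path (L : digraph) (h : vert L -> nat) (v : vert L) es :
  only_loops h -> reduced v es -> es = [::] \/ (h v < h (top v es))%N.
Proof.
move=> [hL _ _]; elim: es => [|e es IH] /=; first by left.
move=> /and3P[/eqP se /IH {}IH ne]; right.
case: IH => [E|IH].
  move: ne se; rewrite E /= => re se.
  by case: (hL e) => [E'|]; [rewrite -E' se eqxx in re|rewrite se].
by rewrite -se in IH; case: (hL e) => [<- //|/(ltn_trans IH)].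
Qed.

Lemma only_loops_top (L : digraph) (h : vert L -> nat) (v : vert L) es :
  only_loops h -> reduced v es -> top v es = v -> es = [::].
Proof. by move=> hL red tv; case: (only_loops_path hL red) => //; rewrite tv ltnn. Qed.

Section ModelRep.
Variables (L : digraph) (h : vert L -> nat) (Lh : only_loops h).
Variables (R : realType) (O : cstarAlgType R) (x : vert L + edge L -> O).
Hypothesis xU : is_cuntz_krieger x.
Variables (v : vert L) (z : R[i]) (z1 : `|z| = 1).
Local Notation H := (l2 R (reduced v)).
Local Notation d es := (delta R (reduced v) es).

Let hom_ex : exists f : starHom O (bop (model_nz R v)), forall i, f (x i) = model_gen v z1 i.
Proof. by have [_ /(_ _ _ (model_ck v z1 Lh))[]] := xU. Qed.

Definition model_rep : rep O := rep_of_hom (projT1 (cid hom_ex)).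

Lemma model_repE i f : model_rep (x i) f = model_gen v z1 i f.
Proof. by rewrite /model_rep; case: cid => g /= ->. Qed.

Lemma model_rep_vert w f es :
  (model_rep (x (inl w)) f : H) es = if top v es == w then (f : H) es else 0.
Proof. by rewrite model_repE. Qed.

Lemma model_rep_nil e f :
  (model_rep (x (inr e)) f : H) [::] = if at_loop v e then z^* * (f : H) [::] else 0.
Proof. by rewrite model_repE. Qed.

Lemma model_rep_cons e f e' es : (model_rep (x (inr e)) f : H) (e' :: es) =
  if (e' == e) && reduced v (e' :: es) then (f : H) es else 0.
Proof. by rewrite model_repE. Qed.

Lemma model_rep_star e f es : (model_rep (star (x (inr e))) f : H) es =
  if nilp es && at_loop v e then z * (f : H) [::] else (f : H) (e :: es).
Proof.
have -> : model_rep (star (x (inr e))) f = star (ebop v z1 e) f.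
  by rewrite /model_rep; case: cid => g gx /=; rewrite star_fun_star gx.
exact: star_ebopE.
Qed.
(** No nonempty reduced path returns to [v], so [x_v] acts as the rank one projection onto the
    vacuum [d [::]]. *)
Lemma model_rep_source (f : H) : model_rep (x (inl v)) f = f [::] *: d [::].
Proof.
apply: l2P => es; rewrite model_rep_vert.
transitivity (f [::] * d [::] es) => //; rewrite deltaE.
have [->|es0] := eqVneq es [::]; first by rewrite eqxx mulr1.
rewrite andbF mulr0; case: eqP => // tv; rewrite l2_out //.
by apply: contra_neqN es0 => red; exact: only_loops_top Lh red tv.
Qed.

Lemma model_rep_delta e es : reduced v (e :: es) ->
  model_rep (x (inr e)) (d es) = d (e :: es).
Proof.
move=> red; apply: l2P => -[|e' es'].
  rewrite model_rep_nil !deltaE andbF; case: ifP => // le.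
  case: es red => [|e1 es] red; first by rewrite loop_not_reduced in red.
  by rewrite /= mulr0.
rewrite model_rep_cons !deltaE eqseq_cons.
have [->|_] := eqVneq e' e; last by rewrite andbF.
rewrite !andTb; have [->|] := eqVneq es' es; last by rewrite !andbF if_same.
by rewrite red (reduced_behead red).
Qed.

Lemma model_rep_loop e : at_loop v e -> model_rep (x (inr e)) (d [::]) = z^* *: d [::].
Proof.
move=> le; apply: l2P => -[|e' es].
  by rewrite model_rep_nil le.
rewrite model_rep_cons; transitivity (z^* * d [::] (e' :: es)) => //.
rewrite !deltaE andbF mulr0; case: ifP => // /andP[/eqP -> red].
case: es red => [|e1 es] red; last by rewrite andbF.
by rewrite loop_not_reduced in red.
Qed.

(** A nonzero coordinate of [f] is indexed by a reduced path from [v] to [w]. This is what tells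
    apart models with different base vertices. *)
Lemma model_rep_fixed w (f : H) : model_rep (x (inl w)) f = f -> f != 0 ->
  w = v \/ (h v < h w)%N.
Proof.
move=> fw f0.
have [es fes] : exists es, f es != 0.
  apply: contrapT => H0; case/eqP: f0; apply: l2P => i.
  by apply/eqP; apply/negPn/negP => fi; apply: H0; exists i.
have red : reduced v es by apply: contraNT fes => /(l2_out f) ->.
have tw : top v es = w.
  apply/eqP; move: fes; rewrite -fw model_rep_vert.
  by case: (top v es == w); rewrite ?eqxx.
by rewrite -tw; case: (only_loops_path Lh red) => [->|]; [left|right].
Qed.

(** From a nonzero coordinate [es] of a vector of [S], the adjoints of the edges strip [es] down to
    the empty path, where [x_v] isolates the vacuum. The edges then produce every basis vector from
    it. *)
Lemma model_rep_irreducible : irreducible model_rep.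
Proof.
split; first exact: model_nz.
move=> S Ssub Scl Sinv; have [S0 Sl] := Ssub.
have [[f [Sf f0]]|no] := pselect (exists f, S f /\ f != 0); last first.
  left; apply/seteqP; split=> f /= => [Sf|->//].
  by apply/eqP/negPn/negP => f0; apply: no; exists f.
right; apply/seteqP; split=> // g _.
have SZ k (u : H) : S u -> S (k *: u).
  by move=> Su; rewrite -[k *: u]addr0; exact: Sl.
have dnil : S (d [::]).
  have [es fes] : exists es, (f : H) es != 0.
    apply: contrapT => H0; case/eqP: f0; apply: (@l2P _ _ _ f) => i.
    by apply/eqP; apply/negPn/negP => fi; apply: H0; exists i.
  have red : reduced v es by apply: contraNT fes => /(l2_out f) ->.
  elim: es f Sf f0 red fes => [|e es IH] f Sf f0 red fes.
    have := Sinv (x (inl v)) f Sf; rewrite model_rep_source => /(SZ ((f : H) [::])^-1).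
    by rewrite scalerA mulVf // scale1r.
  have E : (model_rep (star (x (inr e))) f : H) es = (f : H) (e :: es).
    rewrite model_rep_star; case: ifP => // /andP[nil le].
    by rewrite loop_not_reduced in red.
  apply: (IH (model_rep (star (x (inr e))) f)) => //; last by rewrite E.
  - exact: Sinv.
  - by apply: contraNneq fes => f'0; rewrite -E f'0.
  - exact: reduced_behead red.
apply: delta_dense => // es; elim: es => [//|e es IH] red.
by rewrite -model_rep_delta //; apply: Sinv; exact: IH (reduced_behead red).
Qed.
End ModelRep.

Lemma unitarily_equivalent_sym (R : realType) (A : cstarAlgType R) (rho sigma : rep A) :
  unitarily_equivalent rho sigma -> unitarily_equivalent sigma rho.
Proof.
move=> [U [Ul Uiso Uonto Urho]].
have [V UV] := choice Uonto.
have Uinj a b : U a = U b -> a = b.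
  move=> Uab; apply/eqP; rewrite -subr_eq0 -dotp_eq0 -Uiso.
  by rewrite (zmod_morphism_linear Ul) Uab subrr dotp0l.
exists V; split.
- by move=> k a b; apply: Uinj; rewrite Ul !UV.
- by move=> a b; rewrite -Uiso !UV.
- by move=> a; exists (U a); apply: Uinj; rewrite UV.
- by move=> a b; apply: Uinj; rewrite Urho !UV.
Qed.

(** A unitary equivalence sends [d], which [p] fixes, into the range of [p] in [sigma], hence to a
    nonzero multiple of [d']; the eigenvalues of [a] must then agree. *)
Lemma equiv_eigenvalue (R : realType) (A : cstarAlgType R) (rho sigma : rep A) (p a : A)
    (d : rep_space rho) (d' : rep_space sigma) (k l : R[i]) :
  d != 0 -> rho p d = d -> (forall f, exists c : R[i], sigma p f = c *: d') ->
  rho a d = k *: d -> sigma a d' = l *: d' -> unitarily_equivalent rho sigma -> k = l.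
Proof.
move=> d0 pd pd' ad ad' [U [Ul Uiso _ Urho]].
have [c Ud] := pd' (U d); move: Ud; rewrite -Urho pd => Ud.
have Ud0 : U d != 0 by rewrite -dotp_eq0 Uiso dotp_eq0.
have := Urho a d; rewrite ad (scalable_linear Ul) /= Ud rep_opZ ad' !scalerA [k * c]mulrC => /eqP.
rewrite -subr_eq0 -scalerBl -mulrBr scaler_eq0 mulf_eq0 subr_eq0.
move=> /orP[/orP[/eqP c0|/eqP //]|/eqP d'0].
  by rewrite Ud c0 scale0r eqxx in Ud0.
by rewrite Ud d'0 scaler0 eqxx in Ud0.
Qed.

Section ModelRepEquiv.
Variables (L : digraph) (h : vert L -> nat) (Lh : only_loops h).
Variables (R : realType) (O : cstarAlgType R) (x : vert L + edge L -> O).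
Hypothesis xU : is_cuntz_krieger x.
Local Notation mrep v z1 := (model_rep Lh xU v z1).

Let equiv_src v z (z1 : `|z| = 1 :> R[i]) v' z' (z1' : `|z'| = 1 :> R[i]) :
  unitarily_equivalent (mrep v z1) (mrep v' z1') -> v = v' \/ (h v' < h v)%N.
Proof.
move=> [U [Ul Uiso _ Urho]].
set d : l2 R (reduced v) := delta R (reduced v) [::].
have Ud : mrep v' z1' (x (inl v)) (U d) = U d.
  rewrite -Urho model_rep_source; congr U.
  by apply: l2P => es; rewrite deltaE /= scale1r.
apply: (@model_rep_fixed _ _ Lh _ _ _ xU v' z' z1' v (U d) Ud).
rewrite -dotp_eq0 Uiso dotp_delta deltaE /=; exact: oner_neq0.
Qed.

Lemma model_rep_equiv_vert v z (z1 : `|z| = 1 :> R[i]) v' z' (z1' : `|z'| = 1 :> R[i]) :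
  unitarily_equivalent (mrep v z1) (mrep v' z1') -> v = v'.
Proof.
move=> E; have E' := unitarily_equivalent_sym E.
case: (equiv_src E) => // lt1; case: (equiv_src E') => // lt2.
by have := ltn_trans lt1 lt2; rewrite ltnn.
Qed.

Lemma model_rep_equiv_loop v z (z1 : `|z| = 1 :> R[i]) z' (z1' : `|z'| = 1 :> R[i]) e :
  at_loop v e -> unitarily_equivalent (mrep v z1) (mrep v z1') -> z = z'.
Proof.
move=> le; pose d : l2 R (reduced v) := delta R (reduced v) [::].
have d0 : d != 0 by rewrite -dotp_eq0 dotp_delta deltaE /=; exact: oner_neq0.
have pd : mrep v z1 (x (inl v)) d = d.
  by rewrite -[RHS]scale1r; apply: etrans (model_rep_source Lh xU z1 d) _; rewrite deltaE.
have pd' (f : rep_space (mrep v z1')) : exists c : R[i], mrep v z1' (x (inl v)) f = c *: d.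
  by exists ((f : l2 R (reduced v)) [::]); exact: model_rep_source.
move=> /(@equiv_eigenvalue R O (mrep v z1) (mrep v z1') (x (inl v)) (x (inr e)) d d z^* z'^*
  d0 pd pd' (model_rep_loop Lh xU z1 le) (model_rep_loop Lh xU z1' le)).
exact: (can_inj (@conjcK R)).
Qed.
End ModelRepEquiv.

(** * The functor Pi on one-dimensional modules *)

Section LineModule.
Variables (L : digraph) (h : vert L -> nat) (Lh : only_loops h).
Variables (R : realType) (v : vert L) (z : R[i]) (z1 : `|z| = 1).

(** The one-dimensional Hilbert space, as l2 over a point. *)
Definition line := l2 R (xpredT : pred unit).
Definition line_vec : line := delta R xpredT tt.

Lemma lineP (a : line) : a = a tt *: line_vec.
Proof.
apply: l2P => -[]; transitivity (a tt * line_vec tt) => //.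
by rewrite deltaE mulr1.
Qed.

Lemma line_dotp (a b : line) : dotp a b = a tt * (b tt)^*.
Proof.
rewrite {1}(lineP a) {1}(lineP b) dotpZl dotpZr dotp_delta deltaE mulr1 //.
Qed.

Definition line_v (w : vert L) (a : line) : line := if w == v then a else 0.
Definition line_e (e : edge L) (a : line) : line := if at_loop v e then z *: a else 0.

Let line_v_bounded w : bounded_op (line_v w).
Proof.
split; first by move=> k a b; rewrite /line_v; case: ifP => //; rewrite scaler0 addr0.
exists 1 => a; rewrite mul1r /line_v; case: ifP => // _; by rewrite normr0.
Qed.

Let line_v_idem w a : line_v w (line_v w a) = line_v w a.
Proof. by rewrite /line_v; case: (w == v). Qed.

Let line_v_selfadj w (a b : line) : dotp (line_v w a) b = dotp a (line_v w b).
Proof. by rewrite /line_v; case: ifP => //; rewrite dotp0l dotp0r. Qed.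

Let line_v_orth w w' a : w != w' -> line_v w (line_v w' a) = 0.
Proof.
move=> ww'; rewrite /line_v; case: eqP => // wv; case: eqP => // w'v.
by rewrite wv w'v eqxx in ww'.
Qed.

Let line_v_sum a : \sum_w line_v w a = a.
Proof.
rewrite (bigD1 v) //= /line_v eqxx big1 ?addr0 // => w /negPf -> //.
Qed.

Let line_e_bounded e : bounded_op (line_e e).
Proof.
split; first move=> k a b; rewrite /line_e.
  by case: ifP => _; rewrite ?scaler0 ?addr0 // scalerDr !scalerA mulrC.
exists 1 => a; rewrite mul1r /line_e; case: ifP => _; last by rewrite normr0.
by rewrite normrZ z1 mul1r.
Qed.

Let line_e_supp e a : line_e e a = line_v (src e) (line_e e (line_v (rng e) a)).
Proof.
rewrite /line_e /line_v /at_loop; case: (src e == v) => //=; case: (rng e == v) => //.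
Qed.

Let line_e_isometry w : (exists e : edge L, rng e = w) ->
  forall a, line_v w a = a -> \sum_(e | rng e == w) `|line_e e a| ^+ 2 = `|a| ^+ 2.
Proof.
have [_ loop_ex loop_uniq] := Lh.
move=> ex a; rewrite /line_v; case: eqP => [wv _|_ <-]; last first.
  rewrite big1 ?normr0 ?expr0n // => e _.
  by rewrite /line_e scaler0 if_same normr0 expr0n.
have [l [sl rl]] := loop_ex w ex.
rewrite (bigD1 l) ?rl //= /line_e /at_loop sl rl wv eqxx /= normrZ z1 mul1r.
rewrite big1 ?addr0 // => e /andP[/eqP re el]; case: ifP => [/andP[/eqP se _]|].
  by case/eqP: el; apply: loop_uniq; rewrite ?sl ?rl ?se ?re.
by rewrite normr0 expr0n.
Qed.

Definition line_module : ped_module R L :=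
  PedModule line_v_bounded line_v_idem line_v_selfadj line_v_orth line_v_sum
    line_e_bounded line_e_supp line_e_isometry.

Lemma line_module_one_dimensional : one_dimensional line_module.
Proof.
exists line_vec; last by move=> y; exists ((y : line) tt); exact: lineP.
by rewrite -dotp_eq0 dotp_delta deltaE; exact: oner_neq0.
Qed.

Lemma line_fiber w (a : line) : mod_fiber (M := line_module) w a -> w != v -> a = 0.
Proof. by rewrite /mod_fiber /= /line_v => <- /negPf ->. Qed.
End LineModule.

Section Span.
Variables (K : pzRingType) (V : lmodType K) (S : set V).

Lemma span0 : linear_span S 0.
Proof. by exists 0%N, (fun=> 0), (fun=> 0); split=> [[]//|]; rewrite big_ord0. Qed.

Lemma span_mem u : S u -> linear_span S u.
Proof.
by move=> Su; exists 1%N, (fun=> 1), (fun=> u); split=> //; rewrite big_ord1 scale1r.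
Qed.

Lemma spanD u w : linear_span S u -> linear_span S w -> linear_span S (u + w).
Proof.
move=> [k [c [a [Sa ->]]]] [l [d [b [Sb ->]]]].
exists (k + l)%N, (fun i => match fintype.split i with inl j => c j | inr j => d j end),
  (fun i => match fintype.split i with inl j => a j | inr j => b j end); split.
  by move=> i; case: (fintype.split i).
rewrite big_split_ord /=; congr (_ + _); apply: eq_bigr => i _.
  by rewrite (unsplitK (inl i)).
by rewrite (unsplitK (inr i)).
Qed.

Lemma spanZ k u : linear_span S u -> linear_span S (k *: u).
Proof.
move=> [n [c [a [Sa ->]]]]; exists n, (fun i => k * c i), a; split=> //.
by rewrite scaler_sumr; apply: eq_bigr => i _; rewrite scalerA.
Qed.

Lemma span_sum (I : Type) (r : seq I) (F : I -> V) :
  (forall i, linear_span S (F i)) -> linear_span S (\sum_(i <- r) F i).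
Proof.
move=> SF; elim: r => [|i r IH]; first by rewrite big_nil; exact: span0.
by rewrite big_cons; apply: spanD.
Qed.
End Span.

Section Paths.
Variables (L : digraph) (v : vert L).

(** Unlike [reduced], this admits paths that start with the loop at [v]: all classes in Pi are
    needed here, not only the basis. *)
Fixpoint chain (es : seq (edge L)) : bool :=
  if es is e :: es' then (src e == top v es') && chain es' else true.

Lemma chainP w es : is_path (w, es) && (path_src (w, es) == v) = (w == top v es) && chain es.
Proof.
rewrite /is_path /path_src /=.
elim: es w => [|e es IH] w /=; first by rewrite andbT.
by rewrite -andbA IH eq_sym; congr (_ && _); rewrite eq_sym.
Qed.

Lemma composable_cat (w : vert L) es es' : composable w (es ++ es') =
  composable w es && composable (last w (map (@src L) es)) es'.
Proof. by elim: es w => //= e es IH w; rewrite IH andbA. Qed.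

Lemma prefix_extends (w : vert L) es es' : is_path (w, es') -> prefix es es' ->
  path_extends (w, es') (w, es).
Proof.
move=> + /prefixP[s E]; rewrite E /is_path /= composable_cat => /andP[_ cs].
by exists (path_src (w, es), s).
Qed.
End Paths.

Lemma bessel (R : realType) (H : hilbertType R) (T : choiceType) (e : T -> H)
    (A : {fset T}) (x : H) :
  (forall i j, i \in A -> j \in A -> dotp (e i) (e j) = (i == j)%:R) ->
  psum (fun i => nsq (dotp x (e i))) A <= rnorm x ^+ 2.
Proof.
move=> on; set c := fun i => dotp x (e i).
pose y := \sum_(i <- A) c i *: e i.
have dy (w : H) : dotp y w = \sum_(i <- A) c i * dotp (e i) w.
  rewrite /y (big_morph (fun u : H => dotp u w) (id1 := 0) (op1 := +%R)).
  - by apply: eq_bigr => i _; rewrite dotpZl.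
  - by move=> a b; rewrite dotpDl.
  - by rewrite dotp0l.
have ye j : j \in A -> dotp y (e j) = c j.
  move=> jA; rewrite dy (big_fsetD1 j) //= on // eqxx mulr1 big1_fset ?addr0 // => i.
  by rewrite !inE => /andP[ij iA] _; rewrite on // (negPf ij) mulr0.
have cc i : c i * (c i)^* = (nsq (c i))%:C by rewrite nsqE sqr_normc.
have yx : dotp y x = (psum (fun i => nsq (c i)) A)%:C.
  rewrite dy rmorph_sum /=; apply: eq_bigr => i _.
  by rewrite -cc dotpC.
have yy : dotp y y = (psum (fun i => nsq (c i)) A)%:C.
  rewrite dy rmorph_sum /= !big_seq; apply: eq_bigr => i iA.
  by rewrite -cc dotpC ye.
have := dnorm_ge0 dotp (x - y).
rewrite dotpBl !dotpBr yy (dotpC x y) yx conjc_real subrr subr0.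
by rewrite -rnorm_sqr -rmorphB ler0c subr_ge0.
Qed.

Section RepOrthogonality.
Variables (L : digraph) (R : realType) (O : cstarAlgType R) (x : vert L + edge L -> O).
Hypothesis xU : is_cuntz_krieger x.
Variable sigma : rep O.

Lemma rep_vert w w' xi : sigma (x (inl w)) (sigma (x (inl w')) xi) =
  if w == w' then sigma (x (inl w')) xi else 0.
Proof.
rewrite -rep_mul; case: eqVneq => [->|ww']; first by rewrite (ck_vertK xU).
by rewrite (ck_vert_orth xU) // rep0.
Qed.

Lemma rep_vert_edge w e xi : sigma (x (inl w)) (sigma (x (inr e)) xi) =
  if w == rng e then sigma (x (inr e)) xi else 0.
Proof. by rewrite -(ck_rng xU) rep_mul rep_vert. Qed.

Lemma rep_star_vert e w xi : sigma (star (x (inr e))) (sigma (x (inl w)) xi) =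
  if rng e == w then sigma (star (x (inr e))) xi else 0.
Proof.
rewrite -{1}(ck_star_rng xU) rep_mul rep_vert; case: eqP => [<-|]; last by rewrite rep_op0.
by rewrite -rep_mul (ck_star_rng xU).
Qed.

(** This equation is not among the relations. The difference of the two sides has square norm 0 by
    [star x_e * x_e = x_(src e)]. *)
Lemma rep_edge_src e xi : sigma (x (inr e)) (sigma (x (inl (src e))) xi) = sigma (x (inr e)) xi.
Proof.
apply/eqP; rewrite -subr_eq0 -dotp_eq0 -rep_opB -rep_starV -rep_mul (ck_star_edge xU).
by rewrite rep_opB -rep_mul (ck_vertK xU) subrr dotp0l.
Qed.

(** Orthogonality of the ranges of distinct edges comes from the sum relation: for [eta] in the
    range of [x_e'] the numbers [|star x_f eta|^2] add up to [|eta|^2], and the term [f = e'] alone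
    already attains this value. *)
Lemma rep_star_edge e e' xi : sigma (star (x (inr e))) (sigma (x (inr e')) xi) =
  if e == e' then sigma (x (inl (src e))) xi else 0.
Proof.
have [->|ee'] := eqVneq e e'; first by rewrite -rep_mul (ck_star_edge xU).
have [re|re] := eqVneq (rng e) (rng e'); last first.
  have -> : sigma (x (inr e')) xi = sigma (x (inl (rng e'))) (sigma (x (inr e')) xi).
    by rewrite rep_vert_edge eqxx.
  by rewrite rep_star_vert (negPf re).
set eta := sigma (x (inr e')) xi.
have total : \sum_(f | rng f == rng e') rnorm (sigma (star (x (inr f))) eta) ^+ 2 = rnorm eta ^+ 2.
  apply: (@complexI _); rewrite rmorph_sum /= rnorm_sqr.
  have {3}<- : sigma (x (inl (rng e'))) eta = eta by rewrite rep_vert_edge eqxx.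
  rewrite -(ck_edge_sum xU); last by exists e'.
  rewrite rep_sum (big_morph (fun u => dotp eta u) (id1 := 0) (op1 := +%R)).
  - by apply: eq_bigr => f _; rewrite rnorm_sqr rep_starV rep_mul.
  - by move=> a b; rewrite dotpDr.
  - by rewrite dotp0r.
have self : rnorm (sigma (star (x (inr e'))) eta) = rnorm eta.
  apply/eqP; rewrite -(@eqrXn2 _ 2) ?rnorm_ge0 //; apply/eqP/(@complexI _).
  have E : sigma (star (x (inr e'))) eta = sigma (x (inl (src e'))) xi.
    by rewrite /eta -rep_mul (ck_star_edge xU).
  by rewrite !rnorm_sqr E rep_star (ck_star_vert xU) -rep_mul (ck_vertK xU) -E -rep_star.
move: total; rewrite (bigD1 e') //= self -[RHS]addr0 => /addrI.
rewrite (bigD1 e) /=; last by rewrite re eqxx.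
move=> /eqP; rewrite paddr_eq0 ?sqr_ge0 //; last by apply: sumr_ge0 => f _; exact: sqr_ge0.
by rewrite sqrf_eq0 rnorm_eq0 => /andP[/eqP].
Qed.
End RepOrthogonality.

(* An irreducible representation is identified with a model as soon as it has a
   unit vector [xi0] behaving as the class of the vertex [v] in Pi(M_{v,z}). *)
Section Recognition.
Variables (L : digraph) (h : vert L -> nat) (Lh : only_loops h).
Variables (R : realType) (O : cstarAlgType R) (x : vert L + edge L -> O).
Hypothesis xU : is_cuntz_krieger x.
Variables (v : vert L) (z : R[i]) (z1 : `|z| = 1).
Variables (sigma : rep O) (xi0 : rep_space sigma).
Hypothesis sigma_irr : irreducible sigma.
Hypothesis xi0_unit : dotp xi0 xi0 = 1.
Hypothesis xi0_vert : sigma (x (inl v)) xi0 = xi0.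
Hypothesis xi0_loop : forall e, at_loop v e -> sigma (x (inr e)) xi0 = z^* *: xi0.
Hypothesis xi0_other : forall e, rng e = v -> ~~ at_loop v e -> sigma (star (x (inr e))) xi0 = 0.
Local Notation K := (rep_space sigma).
Local Notation H := (l2 R (reduced v)).

Let star_nil e : sigma (star (x (inr e))) xi0 = if at_loop v e then z *: xi0 else 0.
Proof.
case: ifP => [le|nle].
  have zz : z * z^* = 1 by rewrite -sqr_normc z1 expr1n.
  rewrite -[xi0 in LHS]scale1r -zz -scalerA rep_opZ -(xi0_loop le) (rep_star_edge xU) eqxx.
  by case/andP: le => /eqP -> _; rewrite xi0_vert.
have [re|re] := eqVneq (rng e) v; first by rewrite xi0_other ?nle.
by rewrite -xi0_vert (rep_star_vert xU) (negPf re).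
Qed.

Definition path_vec (es : seq (edge L)) : K := foldr (fun e xi => sigma (x (inr e)) xi) xi0 es.

Let vec_vert w es : sigma (x (inl w)) (path_vec es) = if top v es == w then path_vec es else 0.
Proof.
case: es => [|e es] /=; last by rewrite (rep_vert_edge xU) eq_sym.
by rewrite -{1}xi0_vert (rep_vert xU) xi0_vert eq_sym; case: eqP => // ->.
Qed.

Let star_cons e e' es : reduced v (e' :: es) ->
  sigma (star (x (inr e))) (path_vec (e' :: es)) = if e == e' then path_vec es else 0.
Proof.
move=> /and3P[/eqP se _ _] /=; rewrite (rep_star_edge xU); case: eqP => // ->.
by rewrite vec_vert se eqxx.
Qed.

(** On the empty path the loop is excluded by [reduced]; a nonempty reduced path has left [v] for
    good. *)
Let loop_cons e es : reduced v (e :: es) -> at_loop v e = false.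
Proof.
move=> red; apply/negP => le; have /orP[nil|nil] := orbN (nilp es).
  by rewrite loop_not_reduced in red.
case/and3P: red => /eqP se red _; move: nil.
rewrite (only_loops_top Lh red) // -se.
by case/andP: le => /eqP.
Qed.

Let vec_on p q : reduced v p -> reduced v q -> dotp (path_vec p) (path_vec q) = (p == q)%:R.
Proof.
elim: p q => [|e p IH] q redp redq.
  case: q redq => [|e q] redq; first by rewrite xi0_unit.
  by rewrite /= -rep_starV star_nil (loop_cons redq) dotp0l.
rewrite rep_star; case: q redq => [|e' q] redq.
  by rewrite star_nil (loop_cons redp) dotp0r.
rewrite star_cons // eqseq_cons; case: eqP => _; last by rewrite dotp0r.
by rewrite IH ?(reduced_behead redp) ?(reduced_behead redq).
Qed.

(** The coefficients of [xi] along the orthonormal family [path_vec]. Bessel's inequality makes the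
    resulting map [U] a contraction before it is known to be isometric. *)
Let ufun (xi : K) : seq (edge L) -> R[i] :=
  fun es => if reduced v es then dotp xi (path_vec es) else 0.

Let ufun_le (xi : K) A : psum (fun es => nsq (ufun xi es)) A <= rnorm xi ^+ 2.
Proof.
rewrite /psum (big_fsetID _ (fun es => reduced v es)) /= [X in _ + X]big1_fset ?addr0.
  apply: (@le_trans _ _ (psum (fun es => nsq (dotp xi (path_vec es)))
    [fset es in A | reduced v es]%fset)).
    by apply: ler_sum => es _; rewrite /ufun; case: ifP => // _; rewrite nsq0 nsq_ge0.
  by apply: bessel => p q; rewrite !inE => /andP[_ redp] /andP[_ redq]; exact: vec_on.
by move=> es; rewrite !inE => /andP[_ /negPf nred] _; rewrite /ufun nred nsq0.
Qed.

Let ufun_in xi : ufun xi \in l2_pred (reduced v).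
Proof.
apply/asboolP; split; first by move=> es /negPf nred; rewrite /ufun nred.
by exists (rnorm xi ^+ 2); exact: ufun_le.
Qed.

Let U xi : H := L2 (ufun_in xi).

Let UE xi es : U xi es = if reduced v es then dotp xi (path_vec es) else 0.
Proof. by []. Qed.

Let U_linear : linear U.
Proof.
move=> k a b; apply: l2P => es; rewrite l2E !UE; case: ifP => _; last by rewrite mulr0 addr0.
by rewrite dotpDl dotpZl.
Qed.

Let U_le xi : rnorm (U xi) <= rnorm xi.
Proof. by apply: rnorm_l2_le; [exact: rnorm_ge0|exact: ufun_le]. Qed.

Let U_vec es : reduced v es -> U (path_vec es) = delta R (reduced v) es.
Proof.
move=> red; apply: l2P => es'; rewrite UE deltaE; case: ifP => // red'.
by rewrite vec_on // eq_sym.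
Qed.

Local Notation rho := (model_rep Lh xU v z1).

Let U_gen g xi : U (sigma (x g) xi) = rho (x g) (U xi).
Proof.
apply: l2P => es; rewrite UE; case: g => [w|e].
  rewrite model_rep_vert UE; case: ifP => red; last by rewrite if_same.
  rewrite -{1}(ck_star_vert xU) rep_starV vec_vert.
  by case: ifP => _; rewrite ?dotp0r.
case: es => [|e' es].
  rewrite model_rep_nil UE /= rep_star star_nil; case: ifP => _; last by rewrite dotp0r.
  by rewrite dotpZr.
rewrite model_rep_cons UE; case: ifP => [red|]; last by rewrite andbF.
rewrite rep_star star_cons // andbT eq_sym (reduced_behead red).
by case: ifP => _; rewrite ?dotp0r.
Qed.

Let U_gen_star g xi : U (sigma (star (x g)) xi) = rho (star (x g)) (U xi).
Proof.
case: g => [w|e]; first by rewrite (ck_star_vert xU) U_gen.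
apply: l2P => es; rewrite UE model_rep_star !UE rep_starV.
case: (boolP (nilp es && at_loop v e)) => [/andP[/nilP -> le]|nle].
  by rewrite /= (xi0_loop le) dotpZr; congr (_ * _); exact: conjcK.
have [red|nred] := boolP (reduced v es); last first.
  by case: ifP => // /reduced_behead red; rewrite red in nred.
have [ts|ts] := eqVneq (src e) (top v es).
  suff -> : reduced v (e :: es) by [].
  rewrite /= ts eqxx red /=; apply: contra nle => /andP[nil re].
  by rewrite nil /at_loop ts re andbT; move/nilP: nil => -> /=.
rewrite /= (negPf ts) /= -(rep_edge_src xU) vec_vert eq_sym (negPf ts).
by rewrite rep_op0 dotp0r.
Qed.

Let U_rep a xi : U (sigma a xi) = rho a (U xi).
Proof. exact: (@rep_intertwine _ _ _ _ xU sigma rho U U_linear U_le U_gen U_gen_star). Qed.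

Let U_delta es : reduced v es -> exists xi, U xi = delta R (reduced v) es.
Proof. by move=> red; exists (path_vec es); exact: U_vec. Qed.

Let UB a b : U (a - b) = U a - U b.
Proof. exact: zmod_morphism_linear U_linear a b. Qed.

(* The vectors on which [U] is isometric form a closed invariant subspace. *)
Let U_iso xi eta : dotp (U xi) (U eta) = dotp xi eta.
Proof.
pose S : set K := [set xi | forall eta, dotp (U xi) (U eta) = dotp xi eta].
have [_ irr] := sigma_irr.
have Ssub : Defs.subspace S.
  split=> [w|k a b Sa Sb w]; last by rewrite U_linear !dotpDl !dotpZl Sa Sb.
  by rewrite -(subrr 0) UB !subrr !dotp0l.
have Scl : closed S.
  apply/closed_approx => a aS w; apply/eqP; rewrite -subr_eq0; apply/eqP.
  apply: rnorm_small_eq0 => e e0.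
  have m0 : 0 < 2 * rnorm w + 1 by rewrite ltr_wpDl ?mulr_ge0 ?rnorm_ge0.
  have [b Sb ab] := aS _ (divr_gt0 e0 m0).
  have -> : dotp (U a) (U w) - dotp a w = dotp (U (a - b)) (U w) - dotp (a - b) w.
    by rewrite UB !dotpBl Sb opprB addrA subrK.
  apply: le_trans (rnormD _ _) _; rewrite rnormN.
  have h1 := dotp_le (U (a - b)) (U w); have h2 := dotp_le (a - b) w.
  have h3 : rnorm (U (a - b)) * rnorm (U w) <= rnorm (a - b) * rnorm w.
    by apply: ler_pM; rewrite ?rnorm_ge0 ?U_le.
  apply: (@le_trans _ _ ((2 * rnorm w + 1) * rnorm (a - b))); last first.
    by rewrite mulrC -ler_pdivlMr // ltW.
  by move: h1 h2 h3 (rnorm_ge0 (a - b)); lra.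
have Sinv a w : S w -> S (sigma a w).
  move=> Sw w'; rewrite U_rep (@rep_star _ _ rho) -U_rep rep_star; exact: Sw.
have [S0|ST] := irr S Ssub Scl Sinv; last by have : S xi by rewrite ST; exact.
have : S xi0.
  move=> w; rewrite -[xi0]/(path_vec [::]) U_vec // dotpC dotp_delta UE /=.
  by rewrite -dotpC.
rewrite S0 /= => xi00; have := xi0_unit.
by rewrite xi00 dotp0l => /esym/eqP; rewrite oner_eq0.
Qed.

Let U_norm xi : rnorm (U xi) = rnorm xi.
Proof.
apply/eqP; rewrite -(@eqrXn2 _ 2) ?rnorm_ge0 //; apply/eqP/(@complexI _).
by rewrite !rnorm_sqr U_iso.
Qed.

(** The range of an isometry on a complete space is closed, and this one contains the basis. *)
Let U_onto f : exists xi, U xi = f.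
Proof.
pose S : set H := [set f | exists xi, U xi = f].
apply: (@delta_dense R _ _ S) => //.
  split; first by exists 0; rewrite -(subrr 0) UB !subrr.
  by move=> k _ _ [a <-] [b <-]; exists (k *: a + b); rewrite U_linear.
apply/closed_approx => g gS.
have an_ex n : exists a, rnorm (g - U a) < n.+1%:R^-1.
  have [_ [a <-] ga] := gS n.+1%:R^-1 ltac:(by rewrite invr_gt0).
  by exists a.
have [a ga] := choice an_ex.
have small (e : R) : 0 < e -> exists N, forall n, (N <= n)%N -> rnorm (g - U (a n)) < e.
  move=> e0; have [N _ hN] := near_infty_natSinv_lt (PosNum e0).
  by exists N => n Nn; apply: lt_trans (ga n) (hN n Nn).
have acvg : cvg (a n @[n --> \oo]).
  apply/cauchy_cvgP/(@cauchyP R[i]) => e e0.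
  have : e \is Num.real by rewrite ger0_real // ltW.
  case/complex_realP => r er; move: e0; rewrite {}er ltcR => r0.
  have [N hN] := small _ (divr_gt0 r0 (@ltr0Sn R 1)).
  exists (a N); exists N => // n /= Nn.
  rewrite -ball_normE /= -rnormE ltcR -U_norm UB [r]splitr.
  apply: le_lt_trans (rdist_triangle g _ _) _; apply: ltrD; last exact: hN.
  by rewrite rdistC; exact: hN.
case/cvg_ex: acvg => l /cvgrPdist_lt al; exists l.
apply/eqP; rewrite -subr_eq0; apply/eqP/rnorm_small_eq0 => e e0.
have e20 := divr_gt0 e0 (@ltr0Sn R 1).
have [N hN] := small _ e20.
have [M _ hM] := al (e / 2)%:C ltac:(by rewrite ltcR).
pose n := maxn N M.
apply: le_trans (rdist_triangle (U (a n)) _ _) _; rewrite [e]splitr; apply: lerD.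
  by rewrite -UB U_norm -lecR rnormE ltW // hM //= leq_maxr.
by rewrite rdistC ltW // hN // leq_maxl.
Qed.

Lemma model_rep_recognition : unitarily_equivalent sigma rho.
Proof.
exists U; split; [exact: U_linear|exact: U_iso|exact: U_onto|exact: U_rep].
Qed.

Local Notation M := (line_module Lh v z1).
Local Notation walk := (walk L).

(** Paths with another source get 0, as the module has its only nonzero fibre at [v]. Initial loops
    are kept and act on [xi0] by [z^*]. *)
Definition path_class (p : walk) (a : line R) : K :=
  if is_path p && (path_src p == v) then a tt *: path_vec p.2 else 0.

Let class_linear p k (a b : line R) :
  path_class p (k *: a + b) = k *: path_class p a + path_class p b.
Proof.
rewrite /path_class; case: ifP => _; last by rewrite scaler0 addr0.
by rewrite scalerA -scalerDl l2E.
Qed.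

Let class0 p : path_class p 0 = 0.
Proof. by rewrite /path_class scale0r if_same. Qed.

Let classE es a : chain v es -> path_class (top v es, es) a = a tt *: path_vec es.
Proof. by move=> ch; rewrite /path_class chainP eqxx ch. Qed.

Let class_sum (I : Type) (r : seq I) (P : pred I) (F : I -> line R) p :
  path_class p (\sum_(i <- r | P i) F i) = \sum_(i <- r | P i) path_class p (F i).
Proof.
elim/big_rec2: _ => [|i a b _ <-]; first exact: class0.
by rewrite -[F i]scale1r class_linear !scale1r.
Qed.

Let fiberE p (a : line R) : mod_fiber (M := M) (path_src p) a -> path_src p = v \/ a = 0.
Proof.
by move=> fa; have [|sv] := eqVneq (path_src p) v; [left|right; exact: line_fiber fa sv].
Qed.

Let class_action g p (a : line R) : is_path p -> mod_fiber (M := M) (path_src p) a ->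
  sigma (x g) (path_class p a) =
    if path_src (short_path g) == path_rng p then path_class (path_cat (short_path g) p) a else 0.
Proof.
move=> pp /fiberE[sv|->]; last by rewrite !class0 rep_op0 if_same.
case: p pp sv => w es pp sv.
have /andP[/eqP wt ch] : (w == top v es) && chain v es by rewrite -chainP pp sv eqxx.
rewrite wt classE // rep_opZ /path_rng /=; case: g => [w'|e] /=.
  have -> : path_src ((w', [::]) : walk) = w' by [].
  rewrite vec_vert eq_sym; have [->|_] := eqVneq w' (top v es).
    exact: esym (classE _ ch).
  by rewrite scaler0.
have -> : path_src ((rng e, [:: e]) : walk) = src e by [].
have [se|se] := eqVneq (src e) (top v es).
  by rewrite -[X in path_class X _]/(top v (e :: es), e :: es) classE //= se eqxx.
by rewrite -(rep_edge_src xU) vec_vert eq_sym (negPf se) rep_op0 scaler0.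
Qed.

Let vec_dot0 es es' : chain v es -> chain v es' -> ~~ prefix es es' -> ~~ prefix es' es ->
  dotp (path_vec es) (path_vec es') = 0.
Proof.
elim: es es' => [|e es IH] [|e' es'] //= /andP[/eqP se ch] /andP[/eqP se' ch'].
rewrite -rep_starV (rep_star_edge xU); have [ee'|_] := eqVneq e' e; last by rewrite dotp0l.
by rewrite !andTb vec_vert ee' se eqxx => p1 p2; exact: IH.
Qed.

Let class_orth p r (a b : line R) : is_path p -> is_path r ->
  mod_fiber (M := M) (path_src p) a -> mod_fiber (M := M) (path_src r) b ->
  ~ path_extends p r -> ~ path_extends r p ->
  dotp (path_class p a) (path_class r b) = 0.
Proof.
move=> pp pr /fiberE[sp|->]; last by rewrite class0 dotp0l.
move=> /fiberE[sr|->]; last by rewrite class0 dotp0r.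
case: p r pp pr sp sr => [w es] [w' es'] pp pr sp sr nwr nrw.
have /andP[/eqP wt ch] : (w == top v es) && chain v es by rewrite -chainP pp sp eqxx.
have /andP[/eqP wt' ch'] : (w' == top v es') && chain v es' by rewrite -chainP pr sr eqxx.
rewrite /path_class pp pr sp sr eqxx /= dotpZl dotpZr.
suff -> : dotp (path_vec es) (path_vec es') = 0 by rewrite !mulr0.
have [ww'|ww'] := eqVneq w w'.
  apply: vec_dot0 => //; apply/negP => pre; [apply: nrw|apply: nwr].
    by rewrite ww' in pp pre *; exact: prefix_extends.
  by rewrite ww' in pp pre *; exact: prefix_extends.
have -> : path_vec es = sigma (x (inl w)) (path_vec es) by rewrite vec_vert wt eqxx.
rewrite -{1}(ck_star_vert xU) rep_starV vec_vert -wt' eq_sym (negPf ww').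
exact: dotp0r.
Qed.

(** The inner product formula for [p] of length 0. An edge moved to the other side acts on [xi0]
    through its adjoint, by [z] for the loop and by 0 otherwise, exactly as [line_e] does on the
    module. *)
Let nil_dot (a b : line R) es :
  dotp (a tt *: xi0) (b tt *: path_vec es) =
  dotp (foldl (fun y e => line_e v z e y) a es : line R) b.
Proof.
elim: es a => [|e es IH] a /=.
  by rewrite dotpZl dotpZr xi0_unit line_dotp mulr1.
rewrite -IH -rep_opZ -rep_starV rep_opZ star_nil /line_e; case: ifP => _.
  by rewrite scalerA mulrC.
by rewrite scaler0 scale0r.
Qed.

Let class_inner p r (a b : line R) : is_path p -> is_path r -> path_src p = path_rng r ->
  mod_fiber (M := M) (path_src p) a -> mod_fiber (M := M) (path_src r) b ->
  dotp (path_class p a) (path_class (path_cat p r) b) = dotp (mod_path (M := M) r a) b.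
Proof.
have mod0 es : foldl (fun y e => line_e v z e y) (0 : line R) es = 0.
  by elim: es => //= e es IH; rewrite /line_e scaler0 if_same.
move=> pp pr pr_src /fiberE[sp|->]; last first.
  rewrite class0 dotp0l /mod_path /= /line_v if_same.
  by rewrite [foldl _ _ _]mod0 dotp0l.
move=> /fiberE[sr|->]; last by rewrite class0 !dotp0r.
case: p r pp pr pr_src sp sr => [w es] [w' es'] pp pr pr_src sp sr.
have w'v : w' = v by rewrite -sp pr_src.
have /andP[/eqP wt ch] : (w == top v es) && chain v es by rewrite -chainP pp sp eqxx.
have pc : is_path (path_cat (w, es) (w', es')) && (path_src (path_cat (w, es) (w', es')) == v).
  rewrite /is_path /path_cat /= composable_cat /path_src /= map_cat last_cat.
  move: pp pr sp sr pr_src; rewrite /is_path /path_src /= => -> + -> sr _ /=.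
  by rewrite w'v in sr * => -> /=; rewrite sr.
rewrite {2}/path_class pc /path_class pp sp eqxx /mod_path /= /line_v w'v eqxx.
rewrite -nil_dot !dotpZl !dotpZr; congr (_ * (_ * _)).
have ch' : top v es' = v.
  have : (w' == top v es') && chain v es' by rewrite -chainP pr sr eqxx.
  by rewrite w'v => /andP[/eqP <-].
(* The edges of the common prefix act isometrically and cancel one by one, which leaves the case of
   [nil_dot]. *)
clear pc pp sp pr_src wt; elim: es ch => [//|e es IH] /= /andP[/eqP se ch].
rewrite -rep_starV (rep_star_edge xU) eqxx vec_vert se eqxx; exact: IH.
Qed.

(* The class of a path is [phase] times the class of its [reduction], which drops
   the initial loops. *)
Fixpoint reduction (es : seq (edge L)) : seq (edge L) :=
  if es is e :: es' then
    if nilp (reduction es') && at_loop v e then [::] else e :: reduction es'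
  else [::].

Fixpoint phase (es : seq (edge L)) : R[i] :=
  if es is e :: es' then
    if nilp (reduction es') && at_loop v e then z^* * phase es' else phase es'
  else 1.

Let reductionP es : chain v es ->
  [/\ reduced v (reduction es), top v (reduction es) = top v es
    & path_vec es = phase es *: path_vec (reduction es)].
Proof.
elim: es => [_|e es IH] /=; first by rewrite scale1r.
move=> /andP[/eqP se /IH[red topr E]]; case: ifP => [/andP[nil le]|nle].
  split=> //; first by case/andP: le => _ /eqP ->.
  by rewrite E rep_opZ (nilP nil) /= xi0_loop // scalerA mulrC.
split=> //; last by rewrite E rep_opZ.
rewrite /= topr se eqxx red /=; apply/negP => /andP[nil re].
by move: nle; rewrite nil /at_loop re se -topr (nilP nil) /= eqxx.
Qed.

Let reduction_rcons_loop es e : at_loop v e ->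
  reduction (rcons es e) = reduction es /\ phase (rcons es e) = z^* * phase es.
Proof.
move=> le; elim: es => [|e' es [IH1 IH2]] /=; first by rewrite le.
by rewrite IH1 IH2; split=> //; case: ifP => _ //; rewrite mulrCA.
Qed.

Let reduction_rcons es e : ~~ at_loop v e ->
  reduction (rcons es e) = rcons es e /\ phase (rcons es e) = 1.
Proof.
move=> /negPf le; elim: es => [|e' es [IH1 IH2]] /=; first by rewrite le.
by rewrite IH1 IH2; case: (es).
Qed.

Let chain_rcons_loop es e : at_loop v e ->
  top v (rcons es e) = top v es /\ chain v (rcons es e) = chain v es.
Proof.
move=> /andP[/eqP se /eqP re]; elim: es => [|e' es [IH1 IH2]] /=.
  by rewrite re se eqxx.
by rewrite IH1 IH2.
Qed.

Let path_vec_rcons es e : at_loop v e -> path_vec (rcons es e) = z^* *: path_vec es.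
Proof.
move=> le; elim: es => [|e' es IH] /=; first exact: xi0_loop.
by rewrite -/(path_vec _) IH rep_opZ.
Qed.

Let src_chain es : chain v es -> is_path ((top v es, es) : walk) /\
  path_src ((top v es, es) : walk) = v.
Proof.
move=> ch; have : (top v es == top v es) && chain v es by rewrite eqxx.
by rewrite -chainP => /andP[pp /eqP ->].
Qed.

Local Notation ds p a := (@ds_elt R L M p a).
Local Notation relators := (@pyth_relators R L M).

Let ds0 p : ds p 0 = 0.
Proof. by apply/funext => q; rewrite /ds_elt if_same. Qed.

Let fiber_v (a : line R) : mod_fiber (M := M) v a.
Proof. by rewrite /mod_fiber /= /line_v eqxx. Qed.

(** The relator of the vector [z^* *: a] on the path [es]: the sum has one nonzero term, at the
    loop, where [z] cancels [z^*]. *)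
Let loop_relator es e (a : line R) : chain v es -> at_loop v e ->
  relators (ds (top v es, es) (z^* *: a) - ds (top v (rcons es e), rcons es e) a).
Proof.
move=> ch le; have [pp sp] := src_chain ch; have [_ _ loop_uniq] := Lh.
have /andP[/eqP se /eqP re] := le.
exists (top v es, es), (z^* *: a); split=> //.
- by rewrite sp; exact: fiber_v.
- by exists e; rewrite sp.
- congr (_ - _); rewrite sp (bigD1 e) ?re //=.
  rewrite [X in _ = _ + X]big1 ?addr0 => [|e' /andP[/eqP re' ee']].
    rewrite /line_e le scalerA mulrC z_mulJ // scale1r.
    by rewrite /path_cat /= cats1 (chain_rcons_loop es le).1.
  rewrite /line_e; case: ifP => [/andP[/eqP se' _]|_]; last exact: ds0.
  by case/eqP: ee'; apply: loop_uniq; rewrite ?se ?se' ?re ?re'.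
Qed.

(** The initial edges of a path are at the end of its list, hence an induction on [rcons]; each loop
    there costs one relator. *)
Let reduction_span es (a : line R) : chain v es ->
  linear_span relators (ds (top v es, es) a -
    ds (top v (reduction es), reduction es) (phase es *: a)).
Proof.
elim/last_ind: es a => [|es e IH] a ch; first by rewrite /= scale1r subrr; exact: span0.
have [le|nle] := boolP (at_loop v e); last first.
  by have [-> ->] := reduction_rcons es nle; rewrite scale1r subrr; exact: span0.
have [E1 E2] := reduction_rcons_loop es le; have [E3 E4] := chain_rcons_loop es le.
rewrite E4 in ch; rewrite E1 E2.
have -> : (z^* * phase es) *: a = phase es *: (z^* *: a) by rewrite scalerA mulrC.
rewrite -(subrKA (ds (top v es, es) (z^* *: a))); apply: spanD; last exact: IH.
rewrite -opprB -scaleN1r; apply: spanZ; apply: span_mem; exact: loop_relator.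
Qed.

Let quot (f : walk -> line R) : K := \sum_(p \in [set p | f p != 0]) path_class p (f p).

Let quotE (r : seq walk) (f : walk -> line R) : uniq r -> (forall p, f p != 0 -> p \in r) ->
  quot f = \sum_(p <- r) path_class p (f p).
Proof.
move=> ur fr; apply: fsbig_fwiden => // p [_ /=] /negP.
by rewrite negbK => /eqP ->; rewrite class0.
Qed.

Let sum_ds (r : seq walk) p (a : line R) : uniq r -> p \in r ->
  \sum_(q <- r) path_class q (ds p a q) = path_class p a.
Proof.
move=> ur pr; rewrite (bigD1_seq p) //= {1}/ds_elt eqxx big1 ?addr0 // => q /negPf qp.
by rewrite /ds_elt qp class0.
Qed.

(** Sums over any list containing the support, rather than over the exact support, let all relators
    of a linear combination share one list. *)
Let relator_quot0 (g : walk -> line R) : relators g -> exists r : seq walk,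
  (forall p, g p != 0 -> p \in r) /\
  (forall r', uniq r' -> {subset r <= r'} -> \sum_(p <- r') path_class p (g p) = 0).
Proof.
move=> [p [a [pp fa ex ->]]].
pose ext e : walk := path_cat p (short_path (inr e)).
exists (p :: [seq ext e | e <- enum (edge L)]).
have gE q : (ds p a - \sum_(e | rng e == path_src p) ds (ext e) (line_e v z e a)) q =
    ds p a q - \sum_(e | rng e == path_src p) ds (ext e) (line_e v z e a) q.
  transitivity (ds p a q - (\sum_(e | rng e == path_src p) ds (ext e) (line_e v z e a)) q) => //.
  by rewrite fct_sumE.
split=> [q|r' ur' rr'].
  rewrite -[X in X != 0 -> _]/(_ q) [X in X != 0 -> _]gE inE; have [//|qp] := eqVneq q p.
  rewrite {1}/ds_elt (negPf qp) sub0r oppr_eq0; apply: contraNT => qr.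
  rewrite big1 // => e _; rewrite /ds_elt; case: eqP => // qe.
  by case/negP: qr; rewrite qe map_f // mem_enum.
have pr' : p \in r' by apply: rr'; rewrite inE eqxx.
have er' e : ext e \in r' by apply: rr'; rewrite inE map_f ?orbT ?mem_enum.
have -> : \sum_(q <- r') path_class q ((ds p a -
      \sum_(e | rng e == path_src p) ds (ext e) (line_e v z e a)) q) =
    path_class p a - \sum_(e | rng e == path_src p) path_class (ext e) (line_e v z e a).
  rewrite -(sum_ds a ur' pr').
  have -> : \sum_(e | rng e == path_src p) path_class (ext e) (line_e v z e a) =
      \sum_(e | rng e == path_src p) \sum_(q <- r') path_class q (ds (ext e) (line_e v z e a) q).
    by apply: eq_bigr => e _; rewrite sum_ds.
  rewrite exchange_big -sumrB /=; apply: eq_bigr => q _; rewrite gE.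
  rewrite addrC -scaleN1r class_linear scaleN1r addrC; congr (_ - _).
  exact: class_sum.
have [sp|->] := fiberE fa; last first.
  by rewrite class0 big1 ?subr0 // => e _; rewrite /line_e scaler0 if_same class0.
have [_ loop_ex loop_uniq] := Lh.
have [l [sl rl]] := loop_ex _ ex; rewrite sp in sl rl.
have le : at_loop v l by rewrite /at_loop sl rl eqxx.
have -> : \sum_(e | rng e == path_src p) path_class (ext e) (line_e v z e a) =
    path_class (ext l) (z *: a).
  rewrite (bigD1 l) ?rl ?sp //= {1}/line_e le -[RHS]addr0; congr (_ + _).
  rewrite big1 // => e /andP[/eqP re el].
  rewrite /line_e; case: ifP => [/andP[/eqP se _]|_]; last exact: class0.
  by case/eqP: el; apply: loop_uniq; rewrite ?sl ?se ?re ?rl.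
rewrite /ext; clear ext gE ex er' fa pr' rr'.
case: p pp sp => w es pp sp.
have /andP[/eqP -> ch] : (w == top v es) && chain v es by rewrite -chainP pp sp eqxx.
rewrite classE // /path_cat /= cats1 -(chain_rcons_loop es le).1 classE; last first.
  by rewrite (chain_rcons_loop es le).2.
rewrite path_vec_rcons // (_ : (z *: a : line R) tt = z * a tt) // scalerA mulrAC.
by rewrite [z * _]mulrC z_mulJ // mul1r subrr.
Qed.

Let span_quot0 (f : walk -> line R) : @direct_sum R L M f -> linear_span relators f -> quot f = 0.
Proof.
move=> [fin _] [k [c [g [gr fE]]]].
have [r rP] := choice (fun i => relator_quot0 (gr i)).
pose r' := undup (enum_fset (fset_set [set p | f p != 0]) ++ flatten [seq r i | i <- enum 'I_k]).
have ur' : uniq r' by exact: undup_uniq.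
rewrite (quotE ur') => [|p fp]; last first.
  rewrite mem_undup mem_cat in_fset_set //; apply/orP; left; exact/mem_set.
have fpE p : f p = \sum_i c i *: g i p.
  by rewrite fE fct_sumE.
under eq_bigr => p _ do rewrite fpE class_sum.
rewrite exchange_big big1 //= => i _.
under eq_bigr => p _ do rewrite -[c i *: _]addr0 class_linear class0 addr0.
rewrite -scaler_sumr (rP i).2 ?scaler0 // => p pr.
rewrite mem_undup mem_cat; apply/orP; right; apply/flattenP; exists (r i) => //.
by rewrite map_f // mem_enum.
Qed.

Let supportE (f : walk -> line R) p : @direct_sum R L M f -> f p != 0 ->
  p = (top v p.2, p.2) /\ chain v p.2.
Proof.
move=> [_ /(_ p)]; case: ifP => [pp fa fp|_ ->]; last by rewrite eqxx.
have sp : path_src p = v by case: (fiberE fa) => // f0; rewrite f0 eqxx in fp.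
case: p pp sp {fa fp} => w es pp sp /=.
by have /andP[/eqP -> ->] : (w == top v es) && chain v es by rewrite -chainP pp sp eqxx.
Qed.

(** Modulo relators, [f] may be moved to reduced paths. There the vectors [path_vec] are
    orthonormal, so pairing [quot f = 0] with them shows that all coefficients vanish. *)
Let quot0_span (f : walk -> line R) : @direct_sum R L M f -> quot f = 0 -> linear_span relators f.
Proof.
move=> fD; have [fin _] := fD.
pose r : seq walk := enum_fset (fset_set [set p | f p != 0]).
have ur : uniq r by exact: fset_uniq.
have rP p : (p \in r) = (f p != 0).
  by rewrite in_fset_set //; apply/idP/idP => [/set_mem|/mem_set].
rewrite (quotE ur) => [q0|p]; last by rewrite rP.
pose red (p : walk) : walk := (top v (reduction p.2), reduction p.2).
have -> : f = \sum_(p <- r) (ds p (f p) - ds (red p) (phase p.2 *: f p)) +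
    \sum_(p <- r) ds (red p) (phase p.2 *: f p).
  rewrite -big_split /=; apply/funext => q; rewrite fct_sumE.
  have [qr|qr] := boolP (q \in r).
    rewrite (bigD1_seq q) //= subrK {1}/ds_elt eqxx big1 ?addr0 // => p /negPf pq.
    by rewrite subrK /ds_elt eq_sym pq.
  rewrite big_seq big1 => [|p pr]; first by move: qr; rewrite rP negbK => /eqP.
  by rewrite subrK /ds_elt; case: eqP => // qp; rewrite qp pr in qr.
rewrite [X in _ + X](_ : _ = 0) ?addr0.
  apply: span_sum => p; have [->|fp] := eqVneq (f p) 0.
    by rewrite scaler0 !ds0 subrr; exact: span0.
  have [E ch] := supportE fD fp; rewrite {1}E; exact: reduction_span.
apply/funext => q; rewrite fct_sumE.
have redP p : p \in r -> [/\ reduced v (reduction p.2), chain v p.2 & p = (top v p.2, p.2)].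
  by rewrite rP => fp; have [E ch] := supportE fD fp; have [] := reductionP ch.
have [qred|qred] := boolP ((q.1 == top v q.2) && reduced v q.2); last first.
  rewrite big_seq big1 // => p /redP[redp _ _]; rewrite /ds_elt; case: eqP => // qp.
  by rewrite qp /= eqxx redp in qred.
have /andP[/eqP q1 q2] := qred.
apply: l2P => -[]; rewrite (big_morph (fun a : line R => a tt) (id1 := 0) (op1 := +%R)) //.
transitivity (dotp (\sum_(p <- r) path_class p (f p)) (path_vec q.2)); last first.
  by rewrite q0 dotp0l.
rewrite (big_morph (fun a => dotp a (path_vec q.2)) (id1 := 0) (op1 := +%R)); last exact: dotp0l.
  rewrite !big_seq; apply: eq_bigr => p /redP[redp ch E].
  have [_ _ Ev] := reductionP ch.
  rewrite [in RHS]E classE // dotpZl Ev dotpZl vec_on // -E /ds_elt.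
  have -> : (q == red p) = (reduction p.2 == q.2).
    by apply/eqP/eqP => [->//|E2]; rewrite /red E2 -q1; exact: surjective_pairing.
  case: ifP => _; last by rewrite !mulr0.
  by rewrite mulr1 mulrC.
by move=> a b; exact: dotpDl.
Qed.

(** Since [U] is isometric, the approximation takes place in l2, where truncations of [U xi] to
    finite sets of paths are images of elements of the direct sum. *)
Let quot_dense : dense (quot @` @direct_sum R L M).
Proof.
move=> S [xi Sxi] Sop.
have : closure (quot @` @direct_sum R L M) xi.
  apply: closure_approx => e e0.
  have [A hA] := l2_approx (U xi) e0.
  pose f : walk -> line R := fun p =>
    if [&& p.2 \in A, reduced v p.2 & p.1 == top v p.2] then U xi p.2 *: line_vec R else 0.
  pose r : seq walk := [seq (top v es, es) | es <- enum_fset A].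
  have ur : uniq r by rewrite map_inj_uniq ?fset_uniq // => a b [].
  have fr p : f p != 0 -> p \in r.
    rewrite /f; case: ifP => [/and3P[pA _ /eqP p1] _|_]; last by rewrite eqxx.
    by rewrite [p]surjective_pairing p1; apply/mapP; exists p.2.
  have red_chain es : reduced v es -> chain v es.
    by elim: es => //= e' es IH /and3P[-> /IH -> _].
  exists (quot f).
    exists f => //; split.
      apply: (@sub_finite_set _ _ [set` r]); last exact: finite_seq.
      by move=> p /= /fr.
    move=> [w es].
    have [/and3P[_ red /eqP /= wt]|nf] := boolP [&& es \in A, reduced v es & w == top v es].
      have [pp sp] := src_chain (red_chain _ red); rewrite wt pp sp; exact: fiber_v.
    have -> : f (w, es) = 0 by rewrite /f /= (negPf nf).
    case: ifP => // _; rewrite /mod_fiber /= /line_v; by rewrite if_same.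
  rewrite (quotE ur) // /r big_map -U_norm UB.
  suff -> : U (\sum_(es <- A) path_class (top v es, es) (f (top v es, es))) =
    \sum_(j <- A) U xi j *: delta R (reduced v) j by [].
  have US (T : Type) (s : seq T) (F : T -> K) : U (\sum_(i <- s) F i) = \sum_(i <- s) U (F i).
    elim: s => [|i s IH]; first by rewrite !big_nil -(subrr 0) UB subrr.
    by rewrite !big_cons -IH -[F i]scale1r U_linear !scale1r.
  have UZ k a : U (k *: a) = k *: U a by exact: scalable_linear U_linear k a.
  rewrite US; apply: eq_big_seq => es esA; rewrite /f /= esA eqxx andbT /=.
  have [red|nred] := boolP (reduced v es); last first.
    have U0 : U 0 = 0 by rewrite -[in LHS](subrr (0 : K)) UB subrr.
    rewrite class0 U0 -[LHS](scale0r (delta R (reduced v) es)); congr (_ *: _).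
    exact: esym (l2_out (U xi) nred).
  rewrite classE ?red_chain // UZ U_vec //.
  rewrite (_ : (U xi es *: line_vec R) tt = U xi es * line_vec R tt) //.
  by rewrite /line_vec deltaE mulr1.
move=> /(_ S (open_nbhs_nbhs (conj Sop Sxi)))[y [qy Sy]].
by exists y.
Qed.

Lemma line_module_is_Pi : is_Pi M x sigma.
Proof.
exists path_class; split; split.
- by move=> p k a b _ _ _; exact: class_linear.
- by move=> f fD; split; [exact: quot0_span|exact: span_quot0].
- exact: quot_dense.
- exact: class_orth.
- exact: class_inner.
- exact: class_action.
Qed.
End Recognition.

(** * Exhaustion of the spectrum *)

Section Corner.
Variables (L : digraph) (R : realType) (O : cstarAlgType R) (x : vert L + edge L -> O).
Hypothesis xU : is_cuntz_krieger x.
Variables (sigma : rep O) (v : vert L).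
Hypothesis sigma_irr : irreducible sigma.
Hypothesis other0 : forall e, rng e = v -> ~~ at_loop v e -> forall xi, sigma (x (inr e)) xi = 0.
Local Notation K := (rep_space sigma).

Definition corner : set K := [set xi | sigma (x (inl v)) xi = xi].

Lemma corner_subspace : Defs.subspace corner.
Proof.
split=> [|k a b Ka Kb]; first exact: rep_op0.
by rewrite /corner /= rep_opD rep_opZ Ka Kb.
Qed.

Lemma corner_vert xi : corner (sigma (x (inl v)) xi).
Proof. by rewrite /corner /= -rep_mul (ck_vertK xU). Qed.

Lemma corner_loop e xi : at_loop v e -> corner (sigma (x (inr e)) xi).
Proof. by move=> /andP[_ /eqP re]; rewrite /corner /= (rep_vert_edge xU) re eqxx. Qed.

Lemma rep_vert_star w e xi : sigma (x (inl w)) (sigma (star (x (inr e))) xi) =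
  if w == src e then sigma (star (x (inr e))) xi else 0.
Proof.
apply: dotp_inj => eta; rewrite -{1}(ck_star_vert xU) rep_starV.
have [->|we] := eqVneq w (src e); first by rewrite !rep_starV (rep_edge_src xU).
by rewrite rep_starV -(rep_edge_src xU) (rep_vert xU) eq_sym (negPf we) rep_op0 !(dotp0l, dotp0r).
Qed.

Lemma corner_star e xi : at_loop v e -> corner (sigma (star (x (inr e))) xi).
Proof. by move=> /andP[/eqP se _]; rewrite /corner /= rep_vert_star se eqxx. Qed.

Let other_star0 e xi : rng e = v -> ~~ at_loop v e -> sigma (star (x (inr e))) xi = 0.
Proof.
by move=> re nle; apply: dotp_inj => eta; rewrite rep_starV other0 // dotp0r dotp0l.
Qed.

(** The adjoint of the path operator of [es], followed by [x_v]: the component of a vector along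
    [es], brought back to the corner. *)
Let pull es : O := foldr (fun e a => a * star (x (inr e))) (x (inl v)) es.

Let pull_cons e es xi :
  sigma (pull (e :: es)) xi = sigma (pull es) (sigma (star (x (inr e))) xi).
Proof. exact: rep_mul. Qed.

(* [N] generates the invariant subspace of the vectors all of whose components
   [pull es xi] lie in [N]. *)
Lemma corner_irreducible (N : set K) : Defs.subspace N -> closed N -> N `<=` corner ->
  (forall e, at_loop v e -> forall xi, N xi -> N (sigma (x (inr e)) xi)) ->
  (forall e, at_loop v e -> forall xi, N xi -> N (sigma (star (x (inr e))) xi)) ->
  (forall xi, N xi -> xi = 0) \/ (forall xi, corner xi -> N xi).
Proof.
move=> [N0 Nl] Ncl Ncorner Nx Nsx.
pose S : set K := [set xi | forall es, N (sigma (pull es) xi)].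
have Ssub : Defs.subspace S.
  split=> [es|k a b Sa Sb es]; first by rewrite rep_op0.
  by rewrite rep_opD rep_opZ; apply: Nl.
have Scl : closed S.
  apply/closed_approx => a aS es.
  have Pcl := closed_preimage (rep_bounded sigma (pull es)) Ncl.
  move/closed_approx: Pcl; apply => e e0; have [b Sb ab] := aS _ e0.
  by exists b => //; exact: Sb.
have Svert w xi : S xi -> S (sigma (x (inl w)) xi).
  move=> Sxi [|e es].
    rewrite /= (rep_vert xU); case: eqP => // <-; exact: (Sxi [::]).
  rewrite pull_cons (rep_star_vert xU); case: eqP => _; last by rewrite rep_op0.
  by rewrite -pull_cons; exact: Sxi.
have Sinv : forall a xi, S xi -> S (sigma a xi).
  apply: (rep_invariant xU Ssub Scl) => -[w|e] xi Sxi.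
  - exact: Svert.
  (* For the empty list only an edge into [v] counts, and by [other0] only the loop, which preserves
     [N]. Otherwise the adjoint of [e'] cancels the edge and leaves a vertex projection. *)
  - move=> [|e' es].
      rewrite /= (rep_vert_edge xU); case: eqP => // ve.
      have [le|nle] := boolP (at_loop v e); last by rewrite other0.
      rewrite -(rep_edge_src xU); case/andP: (le) => /eqP -> _.
      apply: Nx => //; exact: (Sxi [::]).
    rewrite pull_cons (rep_star_edge xU); case: eqP => _; last by rewrite rep_op0.
    exact: Svert.
  - by rewrite (ck_star_vert xU); exact: Svert.
  - by move=> es; rewrite -pull_cons; exact: Sxi.
have NS : N `<=` S.
  move=> xi Nxi es; elim: es xi Nxi => [|e es IH] xi Nxi.
    by rewrite /= (Ncorner _ Nxi).
  (* On a vector of [N], the adjoint of the loop stays in [N] and the adjoint of any other edge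
     gives 0. *)
  rewrite pull_cons; have [le|nle] := boolP (at_loop v e); first exact/IH/Nsx.
  rewrite -(Ncorner _ Nxi) (rep_star_vert xU); case: eqP => [re|]; last by rewrite rep_op0.
  by rewrite other_star0 // rep_op0.
have [S0|ST] := sigma_irr.2 S Ssub Scl Sinv.
  by left=> xi /NS; rewrite S0.
right=> xi Kxi; rewrite -Kxi.
have : S xi by rewrite ST.
by move=> /(_ [::]).
Qed.

Lemma rep_ker_closed (a : O) : closed [set xi | sigma a xi = 0].
Proof.
apply: (closed_preimage (S := [set 0]) (rep_bounded sigma a)).
apply/closed_approx => xi xi0 /=; apply: rnorm_small_eq0 => e e0.
by have [_ -> d] := xi0 _ e0; rewrite subr0 in d; exact: ltW.
Qed.

Lemma corner_closed : closed corner.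
Proof.
have -> : corner = [set xi | sigma (x (inl v) - 1) xi = 0].
  apply/seteqP; split=> xi; rewrite /corner /= repB rep_one.
    by move=> ->; rewrite subrr.
  by move/eqP; rewrite subr_eq0 => /eqP.
exact: rep_ker_closed.
Qed.

Section LoopUnitary.
Variable l : edge L.
Hypothesis hl : at_loop v l.
Hypothesis loop_uniq : forall e, at_loop v e -> e = l.
Local Notation u := (x (inr l)).

Let uniV xi : corner xi -> sigma (star u) (sigma u xi) = xi.
Proof. by move=> Kxi; rewrite (rep_star_edge xU) eqxx; case/andP: hl => /eqP ->. Qed.

Let Vuni xi : corner xi -> sigma u (sigma (star u) xi) = xi.
Proof.
move=> Kxi; have [_ /eqP rl] := andP hl.
rewrite -[RHS]Kxi -(ck_edge_sum xU); last by exists l.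
rewrite rep_sum (bigD1 l) ?rl //= rep_mul big1 ?addr0 // => e /andP[/eqP re el].
rewrite rep_mul other0 //; apply: contra el => le; apply/eqP; exact: loop_uniq.
Qed.

(** The elements that preserve the corner and commute there with the loop and its adjoint. They form
    a norm-closed algebra, so the square root iteration stays inside. *)
Definition corner_good (a : O) := forall xi, corner xi -> [/\ corner (sigma a xi),
  sigma a (sigma u xi) = sigma u (sigma a xi) &
  sigma a (sigma (star u) xi) = sigma (star u) (sigma a xi)].

Let good_lin k a b : corner_good a -> corner_good b -> corner_good (k *: a + b).
Proof.
move=> ga gb xi Kxi; have [a1 a2 a3] := ga xi Kxi; have [b1 b2 b3] := gb xi Kxi.
rewrite !rep_linear; split; first exact: corner_subspace.2.
  by rewrite a2 b2 rep_opD rep_opZ.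
by rewrite a3 b3 rep_opD rep_opZ.
Qed.

Let good_mul a b : corner_good a -> corner_good b -> corner_good (a * b).
Proof.
move=> ga gb xi Kxi; have [b1 b2 b3] := gb xi Kxi; have [a1 a2 a3] := ga _ b1.
by rewrite !rep_mul; split; rewrite ?b2 ?b3.
Qed.

Let good1 : corner_good 1.
Proof. by move=> xi Kxi; rewrite !rep_one. Qed.

Let good0 : corner_good 0.
Proof. by rewrite -(addNr 1) -scaleN1r; exact: good_lin. Qed.

Let good_u : corner_good u.
Proof. by move=> xi Kxi; split; rewrite ?uniV ?Vuni //; exact: corner_loop. Qed.

Let good_su : corner_good (star u).
Proof. by move=> xi Kxi; split; rewrite ?uniV ?Vuni //; exact: corner_star. Qed.

Let good_closed : norm_closed corner_good.
Proof.
move=> a aG xi Kxi.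
have lim0 (eta : K) (c : R) : 0 <= c -> (forall e : R, 0 < e -> exists2 b, corner_good b &
    cnorm (a - b) < e) -> (forall b, corner_good b -> rnorm eta <= cnorm (a - b) * c) -> eta = 0.
  move=> c0 ab etab; apply: rnorm_small_eq0 => e e0.
  have c1 : 0 < c + 1 by rewrite ltr_wpDl.
  have [b gb d] := ab _ (divr_gt0 e0 c1); apply: le_trans (etab b gb) _.
  apply: (@le_trans _ _ (cnorm (a - b) * (c + 1))); last by rewrite -ler_pdivlMr // ltW.
  by rewrite ler_wpM2l ?cnorm_ge0 // lerDl.
have commutes c : (forall b, corner_good b -> sigma b (sigma c xi) = sigma c (sigma b xi)) ->
    sigma a (sigma c xi) = sigma c (sigma a xi).
  move=> bc; apply/eqP; rewrite -subr_eq0; apply/eqP.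
  apply: (lim0 _ (rnorm (sigma c xi) + cnorm c * rnorm xi)) => //.
    by rewrite addr_ge0 ?mulr_ge0 ?rnorm_ge0 ?cnorm_ge0.
  move=> b /bc bcb.
  have -> : sigma a (sigma c xi) - sigma c (sigma a xi) =
      sigma (a - b) (sigma c xi) - sigma c (sigma (a - b) xi).
    by rewrite !repB rep_opB bcb opprB addrA subrK.
  apply: le_trans (rnormD _ _) _; rewrite rnormN mulrDr; apply: lerD.
    exact: rep_contractive.
  apply: le_trans (@rep_contractive _ _ sigma c _) _.
  by rewrite mulrCA ler_wpM2l ?cnorm_ge0 //; exact: rep_contractive.
split.
- have : norm_closed [set a | forall xi, corner xi -> corner (sigma a xi)].
    exact: rep_norm_closed corner_closed.
  move=> /(_ a); apply => // e e0; have [b gb d] := aG _ e0; exists b => // eta Keta.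
  by case: (gb eta Keta).
- by apply: commutes => b /(_ xi Kxi)[].
- by apply: commutes => b /(_ xi Kxi)[].
Qed.

(** [star u * u] is a projection, so its norm [N] satisfies [N = N ^ 2], while [N] is the square of
    [cnorm u]. *)
Let cnorm_u : cnorm u <= 1.
Proof.
have E : cnorm u ^+ 2 = cnorm (x (inl (src l))) by rewrite -cnorm_starM (ck_star_edge xU).
have F : cnorm (x (inl (src l))) = cnorm (x (inl (src l))) ^+ 2.
  by rewrite -cnorm_starM (ck_star_vert xU) (ck_vertK xU).
move: F; rewrite -E => F; have u0 := cnorm_ge0 u.
rewrite leNgt; apply/negP => u1.
have u2 : 1 < cnorm u ^+ 2 by rewrite exprn_egt1.
have : cnorm u ^+ 2 < (cnorm u ^+ 2) ^+ 2 by rewrite ltr_eXnr.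
by rewrite -F ltxx.
Qed.

Definition herm_part (c : R[i]) : O := c *: u + c^* *: star u.

Let star_herm c : star (herm_part c) = herm_part c.
Proof.
rewrite /herm_part star_linear starZ starK addrC; congr (_ *: _ + _).
exact: conjcK.
Qed.

Let good_herm c : corner_good (herm_part c).
Proof. by apply: good_lin => //; rewrite -[_ *: _]addr0; apply: good_lin. Qed.

Let cnorm_herm c : cnorm (herm_part c) <= rnorm c + rnorm c.
Proof.
apply: le_trans (cnormD _ _) _; rewrite !cnormZr cnorm_star.
have -> : rnorm c^* = rnorm c by rewrite /rnorm normcJ.
by apply: lerD; rewrite ler_piMr ?rnorm_ge0.
Qed.

Let herm_sqr1 c xi : corner xi -> sigma (herm_part c) (sigma (herm_part c) xi) =
  (c * c) *: sigma u (sigma u xi) + (2 * (c * c^*)) *: xi +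
  (c^* * c^*) *: sigma (star u) (sigma (star u) xi).
Proof.
move=> Kxi; rewrite /herm_part !rep_linear !repZ !rep_opD !rep_opZ uniV // Vuni //.
rewrite !scalerDr !scalerA addrA -[_ + _ *: xi + _ *: xi]addrA -scalerDl.
by congr (_ + _ *: _ + _); ring.
Qed.

(** The identity of the type [cos ^ 2 + sin ^ 2 = 1] for the real and imaginary parts of a unitary:
    replacing [c] by ['i * c] flips the sign of the terms in [u ^ 2] and [star u ^ 2], and the
    constant terms add up. *)
Let herm_sqr c xi : corner xi -> sigma (herm_part c) (sigma (herm_part c) xi) +
  sigma (herm_part ('i * c)) (sigma (herm_part ('i * c)) xi) = (4 * (c * c^*)) *: xi.
Proof.
move=> Kxi; rewrite !herm_sqr1 // addrACA [X in X + _]addrACA -!scalerDl.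
have ii : 'i * 'i = - 1 :> R[i] by rewrite -expr2 sqr_i.
have -> : c * c + 'i * c * ('i * c) = 0.
  by rewrite mulrACA ii mulN1r subrr.
have -> : c^* * c^* + ('i * c)^* * ('i * c)^* = 0.
  by rewrite -!rmorphM -rmorphD /= mulrACA ii mulN1r subrr rmorph0.
rewrite !scale0r add0r addr0; congr (_ *: _).
rewrite rmorphM /= mulrACA.
have -> : 'i * ('i)^* = 1 :> R[i].
  by apply/eqP; rewrite eq_complex /=; apply/andP; split; apply/eqP; ring.
by rewrite mul1r -mulrDl; congr (_ * _); ring.
Qed.

Let dotp_herm c xi : dotp (sigma (herm_part c) xi) xi =
  (2 * complex.Re (c * dotp (sigma u xi) xi))%:C.
Proof.
rewrite /herm_part rep_linear repZ dotpDl !dotpZl rep_starV (dotpC xi).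
by rewrite -rmorphM addcJ rmorphM /= rmorph_nat.
Qed.

(* On the corner, the real part [t] and the imaginary part [s] of [w u] satisfy
   [t ^ 2 = 1 - s ^ 2].  The square root [a >= 0] of [1 - s ^ 2] commutes with [u],
   so [ker (a - t)] reduces [u], and [t] is [a] or [- a]. *)
Lemma numerical_sign (w : R[i]) : `|w| = 1 ->
  (forall xi, corner xi -> 0 <= complex.Re (w * dotp (sigma u xi) xi)) \/
  (forall xi, corner xi -> complex.Re (w * dotp (sigma u xi) xi) <= 0).
Proof.
(* The half makes [t] below the real part of [w u], and [s] its imaginary part up to sign; it also
   turns the scalar of [herm_sqr] into 1. *)
move=> w1; pose c := w / 2.
have c1 : rnorm c = 2^-1.
  by apply: (@complexI _); rewrite rnormE normrM w1 mul1r normfV normr_nat fmorphV rmorph_nat.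
pose t := herm_part c; pose s := herm_part ('i * c).
have s1 : cnorm s <= 1.
  apply: le_trans (cnorm_herm _) _.
  have -> : rnorm ('i * c) = rnorm c.
    rewrite /rnorm normrM (_ : `|'i| = 1) ?mul1r // normc_def /=.
    by rewrite expr0n expr1n add0r sqrtr1.
  by rewrite c1; lra.
have b1 : cnorm (s * s) <= 1.
  by apply: le_trans (cnormM _ _) _; rewrite mulr_ile1 ?cnorm_ge0.
have [y [y2 y1 yD]] := sqrt_iteration b1.
(* The iteration starts at 0 and uses only [s * s], both of which commute with the loop on the
   corner. *)
have ty : corner_good y.
  apply: yD good_closed => // q gq; rewrite -[_ *: _]addr0; apply: good_lin => //.
  by rewrite -[s * s]scale1r; apply: good_lin;
    [exact: good_mul (good_herm _) (good_herm _)|exact: good_mul].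
have ga : corner_good (1 - y) by rewrite addrC -scaleN1r; exact: good_lin.
set a := 1 - y in y2 ga.
have a2 xi : corner xi -> sigma a (sigma a xi) = sigma t (sigma t xi).
  move=> Kxi; rewrite -rep_mul y2 repB rep_one rep_mul.
  have := herm_sqr c Kxi; rewrite -/t -/s.
  have -> : 4 * (c * c^*) = 1.
    rewrite -sqr_normc -rnormE c1 -rmorphXn -(rmorph_nat (real_complex R)) -rmorphM /=.
    by rewrite (_ : 4 * 2^-1 ^+ 2 = 1 :> R) //; lra.
  by rewrite scale1r => E; rewrite -{1}E addrK.
have at_comm xi : corner xi -> sigma a (sigma t xi) = sigma t (sigma a xi).
  move=> Kxi; have [_ au asu] := ga xi Kxi.
  by rewrite /t /herm_part !rep_linear !repZ rep_opD !rep_opZ au asu.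
(* Here [cnorm y <= 1] enters: [<y xi, xi>] has real part at most [|xi|^2]. *)
have a_ge0 xi : 0 <= complex.Re (dotp (sigma a xi) xi).
  have h1 := dotp_le (sigma y xi) xi.
  have h2 : rnorm (sigma y xi) <= rnorm xi.
    apply: le_trans (@rep_contractive _ _ sigma y xi) _.
    by rewrite ler_piMl ?rnorm_ge0.
  have h3 : complex.Re (dotp (sigma y xi) xi) <= rnorm (dotp (sigma y xi) xi).
    have := normc_ge_Re (dotp (sigma y xi) xi); rewrite -rnormE lecR.
    by apply: le_trans; exact: ler_norm.
  rewrite repB rep_one dotpBl -rnorm_sqr raddfB /= subr_ge0.
  apply: le_trans h3 (le_trans h1 _); rewrite expr2.
  by rewrite ler_wpM2r ?rnorm_ge0.
have tw xi : dotp (sigma t xi) xi = (complex.Re (w * dotp (sigma u xi) xi))%:C.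
  rewrite dotp_herm; congr (_%:C); rewrite /c.
  have -> : w / 2 * dotp (sigma u xi) xi = (2^-1)%:C * (w * dotp (sigma u xi) xi).
    by rewrite fmorphV rmorph_nat mulrAC mulrC.
  by case: (w * _) => p q /=; rewrite mul0r subr0 mulrA divff ?mul1r.
pose N : set K := corner `&` [set xi | sigma (a - t) xi = 0].
have NE xi : N xi <-> corner xi /\ sigma a xi = sigma t xi.
  split=> -[Kxi E]; split=> //; last by rewrite /= repB E subrr.
  by apply/eqP; rewrite -subr_eq0 -repB; apply/eqP.
have Nsub : Defs.subspace N.
  split; first by split; [exact: corner_subspace.1|exact: rep_op0].
  move=> k p q [Kp Np] [Kq Nq]; split; first exact: corner_subspace.2.
  by move: Np Nq; rewrite /= rep_opD rep_opZ => -> ->; rewrite scaler0 addr0.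
have Ncl : closed N by apply: closedI; [exact: corner_closed|exact: rep_ker_closed].
have gt := good_herm c.
have Nu e : at_loop v e -> forall xi, N xi -> N (sigma (x (inr e)) xi).
  move=> le xi /NE[Kxi E]; apply/NE; split; first exact: corner_loop.
  rewrite (loop_uniq le); have [_ -> _] := ga xi Kxi; have [_ -> _] := gt xi Kxi.
  by rewrite E.
have Nsu e : at_loop v e -> forall xi, N xi -> N (sigma (star (x (inr e))) xi).
  move=> le xi /NE[Kxi E]; apply/NE; split; first exact: corner_star.
  rewrite (loop_uniq le); have [_ _ ->] := ga xi Kxi; have [_ _ ->] := gt xi Kxi.
  by rewrite E.
have [N0|NT] := corner_irreducible Nsub Ncl (@subIsetl _ _ _) Nu Nsu; last first.
  left=> xi Kxi; have /NE[_ E] := NT xi Kxi.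
  by have := a_ge0 xi; rewrite E tw.
right=> xi Kxi.
(* As [a] and [t] commute with equal squares, [a - t] annihilates the image of [a + t]. So [N = 0]
   gives [t = - a] on the corner. *)
have : N (sigma a xi + sigma t xi).
  apply/NE; have [Ka _ _] := ga xi Kxi; have [Kt _ _] := gt xi Kxi; split.
    by rewrite -[sigma a xi]scale1r; exact: corner_subspace.2.
  by rewrite !rep_opD a2 // at_comm // addrC.
move=> /N0 /eqP; rewrite addr_eq0 => /eqP E.
by have := a_ge0 xi; rewrite E -scaleN1r dotpZl tw mulN1r raddfN /= oppr_ge0.
Qed.

(* Otherwise some [w] would give [w <u xi0, xi0>] and [w <u eta, eta>] real parts
   of opposite signs. *)
Let numerical_range_ray xi0 : corner xi0 -> dotp (sigma u xi0) xi0 != 0 ->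
  forall eta, corner eta ->
    complex.Im ((dotp (sigma u xi0) xi0)^* * dotp (sigma u eta) eta) = 0.
Proof.
move=> K0 al0 eta Keta; set al := dotp (sigma u xi0) xi0 in al0 *.
set be := dotp (sigma u eta) eta; set g := al^* * be.
apply/eqP/negPn/negP => g0.
(* The choice makes the real part of [w0 * be] equal to [Re g - kappa * Im g = - 1], whereas that of
   [w0 * al] is [|al|^2]. *)
pose kappa := (complex.Re g + 1) / complex.Im g.
pose w0 : R[i] := al^* * (1 +i* kappa).
have w00 : w0 != 0.
  rewrite mulf_neq0 ?conjc_eq0 // eq_complex /= negb_and; apply/orP; left; exact: oner_neq0.
have r0 : 0 < rnorm w0 by rewrite lt_def rnorm_eq0 w00 rnorm_ge0.
pose w := ((rnorm w0)^-1)%:C * w0.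
have w1 : `|w| = 1.
  rewrite -rnormE; congr (_%:C); apply: (@complexI _); rewrite rnormE normrM -!rnormE rnorm_real.
  by rewrite ger0_norm ?invr_ge0 ?rnorm_ge0 // -rmorphM mulVf ?gt_eqF.
have ReZ (r : R) (a : R[i]) : complex.Re (r%:C * a) = r * complex.Re a.
  by case: a => p q /=; rewrite mul0r subr0.
have wal : 0 < complex.Re (w * al).
  rewrite -mulrA ReZ pmulr_rgt0 ?invr_gt0 //.
  have -> : w0 * al = (nsq al)%:C * (1 +i* kappa).
    by rewrite nsqE sqr_normc /w0; ring.
  by rewrite ReZ mulr1 lt_def nsq_eq0 al0 nsq_ge0.
have wbe : complex.Re (w * be) < 0.
  rewrite -mulrA ReZ pmulr_rlt0 ?invr_gt0 //.
  have -> : w0 * be = (1 +i* kappa) * g by rewrite /w0 /g; ring.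
  have -> : complex.Re ((1 +i* kappa) * g) = complex.Re g - kappa * complex.Im g.
    by case: (g) => p q /=; rewrite mul1r.
  by rewrite /kappa divfK // opprD addrA subrr add0r oppr_lt0.
have [H|H] := numerical_sign w1.
  by have := H _ Keta; rewrite leNgt wbe.
by have := H _ K0; rewrite leNgt wal.
Qed.

(* As the numerical range of [u] lies on a line through 0, [u] is a multiple of its
   adjoint, and [u ^ 2] is a scalar [d ^ 2]; then [ker (u - d)] reduces [u]. *)
Lemma loop_scalar : (exists2 xi, corner xi & xi != 0) ->
  exists2 m : R[i], `|m| = 1 & forall xi, corner xi -> sigma u xi = m *: xi.
Proof.
move=> [xi1 K1 xi10].
have Kl k a b : corner a -> corner b -> corner (k *: a + b) by exact: corner_subspace.2.
(* If every [<u xi, xi>] vanished on the corner, [polarization] would give [u = 0] there, although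
   [star u * u] is the identity on it. *)
have [xi0 [K0 al0]] : exists xi0, corner xi0 /\ dotp (sigma u xi0) xi0 != 0.
  apply: contrapT => no; have u0 : sigma u xi1 = 0.
    apply: (polarization (S := corner)) K1 => //; first exact: (rep_bounded sigma u).1.
      by move=> xi Kxi; exact: corner_loop.
    by move=> xi Kxi; apply/eqP/negPn/negP => H; apply: no; exists xi.
  by have := uniV K1; rewrite u0 rep_op0 => /esym/eqP; rewrite (negPf xi10).
have real := numerical_range_ray K0 al0; set al := dotp (sigma u xi0) xi0 in al0 real.
have aJ0 : al^* != 0 by rewrite conjc_eq0.
(* The quadratic form of the difference of the two sides is [g - g^*], where [g = al^* * <u a, a>]
   is real. *)
have skew xi : corner xi -> al^* *: sigma u xi = al *: sigma (star u) xi.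
  move=> Kxi; apply/eqP; rewrite -subr_eq0; apply/eqP.
  apply: (polarization (T := fun xi => al^* *: sigma u xi - al *: sigma (star u) xi)
    (S := corner)) Kxi => //.
  - move=> k a b; rewrite !rep_opD !rep_opZ !scalerDr !scalerN !scalerA.
    by rewrite ![_ * k]mulrC opprD addrACA.
  - move=> a Ka; rewrite -scaleNr; apply: (Kl); first exact: corner_loop.
    by rewrite -[_ *: _]addr0; apply: Kl; [exact: corner_star|exact: corner_subspace.1].
  - move=> a Ka; rewrite dotpBl !dotpZl rep_starV (dotpC a).
    have := real a Ka; set g := dotp (sigma u a) a.
    have -> : al * g^* = (al^* * g)^* by rewrite rmorphM /= conjcK.
    by case: (al^* * g) => p q /= ->; rewrite oppr0 subrr.
pose c := al / al^*.
have uc xi : corner xi -> sigma u xi = c *: sigma (star u) xi.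
  move=> Kxi; apply: (scalerI aJ0); rewrite skew // scalerA.
  by rewrite /c mulrC divfK.
have u2 xi : corner xi -> sigma u (sigma u xi) = c *: xi.
  by move=> Kxi; rewrite {1}(uc xi Kxi) rep_opZ Vuni.
have c1 : `|c| = 1 by rewrite normrM normfV normcJ divff // normr_eq0.
pose d := sqrtC c; have dd : d * d = c by rewrite -expr2 sqrtCK.
have d1 : `|d| = 1.
  by apply/eqP; rewrite -(@eqrXn2 _ 2) ?normr_ge0 ?ler01 // -normrX sqrtCK c1 expr1n.
have d0 : d != 0 by rewrite -normr_eq0 d1 oner_neq0.
pose N : set K := corner `&` [set xi | sigma (u - d *: 1) xi = 0].
have NE xi : N xi <-> corner xi /\ sigma u xi = d *: xi.
  have E : sigma (u - d *: 1) xi = sigma u xi - d *: xi by rewrite repB repZ rep_one.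
  split=> -[Kxi H]; split=> //; last by rewrite /= E H subrr.
  by apply/eqP; rewrite -subr_eq0 -E; apply/eqP.
have Nsub : Defs.subspace N.
  split; first by split; [exact: corner_subspace.1|exact: rep_op0].
  move=> k p q [Kp Np] [Kq Nq]; split; first exact: Kl.
  by move: Np Nq; rewrite /= rep_opD rep_opZ => -> ->; rewrite scaler0 addr0.
have Ncl : closed N by apply: closedI; [exact: corner_closed|exact: rep_ker_closed].
have Nu e : at_loop v e -> forall xi, N xi -> N (sigma (x (inr e)) xi).
  move=> le xi /NE[Kxi E]; apply/NE; split; first exact: corner_loop.
  by rewrite (loop_uniq le) E rep_opZ E.
have Nsu e : at_loop v e -> forall xi, N xi -> N (sigma (star (x (inr e))) xi).
  move=> le xi /NE[Kxi E]; apply/NE; split; first exact: corner_star.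
  rewrite (loop_uniq le) Vuni //.
  by apply: (scalerI d0); rewrite scalerA dd -uc.
have [N0|NT] := corner_irreducible Nsub Ncl (@subIsetl _ _ _) Nu Nsu; last first.
  by exists d => // xi /NT/NE[].
exists (- d) => [|xi Kxi]; first by rewrite normrN.
(* From [u ^ 2 = d ^ 2] on the corner, [u + d] maps it into the kernel of [u - d]; if this is 0,
   then [u = - d]. *)
have : N (d *: xi + sigma u xi).
  apply/NE; split; first by apply: Kl => //; exact: corner_loop.
  by rewrite rep_opD rep_opZ u2 // scalerDr scalerA dd addrC.
by move=> /N0/eqP; rewrite addrC addr_eq0 -scaleNr => /eqP.
Qed.
End LoopUnitary.
End Corner.

Section Exhaustion.
Variables (L : digraph) (h : vert L -> nat) (Lh : only_loops h).
Variables (R : realType) (O : cstarAlgType R) (x : vert L + edge L -> O).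
Hypothesis xU : is_cuntz_krieger x.

(* [v] is a vertex of least height not annihilated by [sigma]. *)
Lemma model_rep_exhaust (sigma : rep O) : irreducible sigma ->
  exists (v : vert L) (z : R[i]) (z1 : `|z| = 1),
    unitarily_equivalent sigma (model_rep Lh xU v z1).
Proof.
move=> irr; have [[xi xi0] _] := irr.
have [heights loop_ex loop_uniq] := Lh.
pose P w := `[< exists eta, sigma (x (inl w)) eta != 0 >].
have [w0 Pw0] : exists w, P w.
  apply: contrapT => no; case/eqP: xi0.
  rewrite -[xi](@rep_one _ _ sigma) -(ck_vert_sum xU) rep_sum big1 // => w _.
  by apply/eqP/negPn/negP => H; apply: no; exists w; apply/asboolP; exists xi.
have [v /asboolP[eta eta0] vmin] := arg_minnP h Pw0.
have vertical w : (h w < h v)%N -> forall zeta, sigma (x (inl w)) zeta = 0.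
  move=> wv zeta; apply/eqP/negPn/negP => H.
  have : P w by apply/asboolP; exists zeta.
  by move=> /vmin; rewrite leqNgt wv.
have other0 e : rng e = v -> ~~ at_loop v e -> forall zeta, sigma (x (inr e)) zeta = 0.
  move=> re nle zeta; rewrite -(rep_edge_src xU) vertical ?rep_op0 // -re.
  case: (heights e) => // se; move: nle; by rewrite /at_loop se re eqxx.
have Keta : corner x v (sigma (x (inl v)) eta) by exact: corner_vert.
(* [z] is the conjugate of the eigenvalue, since the loop acts by [z^*] in the model. Without a loop
   at [v] any unimodular number would do, and 1 is taken. *)
have [z z1 zloop] : exists2 z : R[i], `|z| = 1 & forall e, at_loop v e ->
    forall xi, corner x v xi -> sigma (x (inr e)) xi = z^* *: xi.
  have [[l hl]|no] := pselect (exists l, at_loop v l); last first.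
    by exists 1; [exact: normr1|move=> e le; case: no; exists e].
  have uniq e : at_loop v e -> e = l.
    move: hl => /andP[/eqP sl /eqP rl] /andP[/eqP se /eqP re].
    by apply: loop_uniq; rewrite ?sl ?rl ?se ?re.
  have [|m m1 hm] := loop_scalar xU irr other0 hl uniq.
    by exists (sigma (x (inl v)) eta).
  exists m^*; first by rewrite normcJ.
  by move=> e /uniq -> zeta /hm ->; congr (_ *: _); exact: esym (conjcK m).
set xi1 := sigma (x (inl v)) eta in eta0 Keta.
pose xi2 := ((rnorm xi1)^-1)%:C *: xi1.
have K2 : corner x v xi2 by rewrite /corner /= rep_opZ Keta.
exists v, z, z1; apply: (@model_rep_recognition _ _ _ _ _ _ _ _ _ _ _ xi2) => //.
- rewrite -rnorm_sqr rnormZ rnorm_real ger0_norm ?invr_ge0 ?rnorm_ge0 //.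
  by rewrite mulVf ?rnorm_eq0 // expr1n.
- by move=> e le; exact: zloop.
- move=> e re nle; apply: dotp_inj => zeta.
  by rewrite rep_starV other0 // dotp0r dotp0l.
Qed.
End Exhaustion.

Lemma unitarily_equivalent_trans (R : realType) (A : cstarAlgType R) (rho sigma tau : rep A) :
  unitarily_equivalent rho sigma -> unitarily_equivalent sigma tau ->
  unitarily_equivalent rho tau.
Proof.
move=> [U [Ul Ui Uo Ux]] [V [Vl Vi Vo Vx]]; exists (V \o U); split.
- by move=> k a b /=; rewrite Ul Vl.
- by move=> a b /=; rewrite Vi Ui.
- by move=> c; have [b <-] := Vo c; have [a <-] := Uo b; exists a.
- by move=> a b /=; rewrite Ux Vx.
Qed.

(** * Transport of the spectrum along an isomorphism *)

Section Pullback.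
Variables (R : realType) (A B : cstarAlgType R) (phi : starHom A B).
Hypothesis phi_bij : bijective phi.

Lemma starHom_inverse : exists psi : starHom B A, cancel phi psi /\ cancel psi phi.
Proof.
case: phi_bij => g phiK gK.
have inj := can_inj phiK.
have gl : linear g by move=> k a b; apply: inj; rewrite star_fun_linear !gK.
have gm : monoid_morphism g.
  split; first by apply: inj; rewrite gK (star_fun_monoid phi).1.
  by move=> a b; apply: inj; rewrite (star_fun_monoid phi).2 !gK.
have gs : {morph g : a / star a} by move=> a; apply: inj; rewrite star_fun_star !gK.
by exists (StarHom gl gm gs).
Qed.

Lemma pullback_irreducible (rho : rep B) :
  irreducible rho -> irreducible (rep_pullback phi rho).
Proof.
move=> [nz irr]; split=> // S Ssub Scl Sinv; apply: irr => // b xi.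
by case: phi_bij => g _ gK; rewrite -[b]gK; exact: Sinv.
Qed.

Lemma pullback_equivalent (rho sigma : rep B) :
  unitarily_equivalent (rep_pullback phi rho) (rep_pullback phi sigma) ->
  unitarily_equivalent rho sigma.
Proof.
move=> [U [Ul Uiso Uonto UA]]; exists U; split=> // b xi.
by case: phi_bij => g _ gK; rewrite -[b]gK; exact: UA.
Qed.
End Pullback.

Lemma pullback_parametrises (R : realType) (A B : cstarAlgType R) (phi : starHom A B)
    (I : Type) (rho : I -> rep B) : bijective phi ->
  parametrises_spectrum rho -> parametrises_spectrum (fun i => rep_pullback phi (rho i)).
Proof.
move=> phi_bij [irr inj onto]; split.
- by move=> i; apply: pullback_irreducible.
- by move=> i j /(pullback_equivalent phi_bij)/inj.
move=> sigma sirr; have [psi [phiK psiK]] := starHom_inverse phi_bij.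
have [i [U [Ul Uiso Uonto UB]]] := onto _ (pullback_irreducible (Bijective psiK phiK) sirr).
exists i, U; split=> // a xi; by rewrite -{1}[a]phiK; exact: UB.
Qed.

Lemma parametrises_reindex (R : realType) (A : cstarAlgType R) (I J : Type)
    (rho : I -> rep A) (f : J -> I) : bijective f ->
  parametrises_spectrum rho -> parametrises_spectrum (fun j => rho (f j)).
Proof.
move=> [g fK gK] [irr inj onto]; split=> [j|j k|sigma sirr]; first exact: irr.
  by move=> /inj/(can_inj fK).
by have [i E] := onto _ sirr; exists (g i); rewrite gK.
Qed.

(** * The spectrum of a graph algebra whose cycles are loops *)

Section Classification.
Variables (L : digraph) (h : vert L -> nat) (Lh : only_loops h).
Variables (R : realType) (O : cstarAlgType R) (x : vert L + edge L -> O).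
Hypothesis xU : is_cuntz_krieger x.

Section Vacuum.
Variables (v : vert L) (z : R[i]) (z1 : `|z| = 1).
Local Notation rho := (model_rep Lh xU v z1).

Let xi0 : rep_space rho := delta R (reduced v) [::].

Let xi0_unit : dotp xi0 xi0 = 1.
Proof. by apply: etrans (dotp_delta _ _) _; rewrite deltaE. Qed.

Let xi0_vert : rho (x (inl v)) xi0 = xi0.
Proof.
by rewrite -[RHS]scale1r; apply: etrans (model_rep_source Lh xU z1 xi0) _; rewrite deltaE.
Qed.

Let xi0_loop e : at_loop v e -> rho (x (inr e)) xi0 = z^* *: xi0.
Proof. exact: model_rep_loop. Qed.

Let xi0_other e : rng e = v -> ~~ at_loop v e -> rho (star (x (inr e))) xi0 = 0.
Proof.
move=> _ /negPf nl; apply: l2P => es; apply: etrans (model_rep_star e xi0 es) _.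
by rewrite nl andbF deltaE andbF.
Qed.

(** The vacuum of the model meets the hypotheses of the recognition, so the model itself serves as
    Pi(M_{v,z}). *)
Lemma line_module_Pi : is_Pi (line_module Lh v z1) x rho.
Proof.
exact: (@line_module_is_Pi _ _ Lh _ _ _ xU v z z1 rho xi0
  (model_rep_irreducible Lh xU v z1) xi0_unit xi0_vert xi0_loop xi0_other).
Qed.

(** Without a loop at [v], the condition that involves [z'] is empty, so the vacuum of one model is
    recognised as that of the other. *)
Lemma model_rep_no_loop z' (z1' : `|z'| = 1 :> R[i]) :
  (forall e, ~~ at_loop v e) -> unitarily_equivalent rho (model_rep Lh xU v z1').
Proof.
move=> nl; apply: (@model_rep_recognition _ _ Lh _ _ _ xU v z' z1' rho xi0
  (model_rep_irreducible Lh xU v z1) xi0_unit xi0_vert _ xi0_other).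
by move=> e; rewrite (negPf (nl e)).
Qed.
End Vacuum.

Variables (A : cstarAlgType R) (phi : starHom A O) (phi_bij : bijective phi).
(** The parameter [iz i] matters only when [iv i] carries a loop and is a dummy elsewhere. In this
    way one index type covers circles and isolated points together. *)
Variables (I : Type) (iv : I -> vert L) (iz : I -> circle R).
Hypothesis index_inj : forall i j,
  iv i = iv j -> ((exists e, at_loop (iv i) e) -> iz i = iz j) -> i = j.
Hypothesis index_onto : forall v z,
  exists i, iv i = v /\ ((exists e, at_loop v e) -> iz i = z).

Let iz1 i : `|val (iz i)| = 1.
Proof. exact/eqP/(valP (iz i)). Qed.

Lemma only_loops_Pi_parametrises : exists M : I -> ped_module R L,
  (forall i, one_dimensional (M i)) /\ Pi_parametrises x phi M.
Proof.
exists (fun i => line_module Lh (iv i) (iz1 i)); split.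
  by move=> i; exact: line_module_one_dimensional.
exists (fun i => model_rep Lh xU (iv i) (iz1 i)); first by move=> i; exact: line_module_Pi.
apply: pullback_parametrises => //; split=> [i|i j E|sigma sirr].
- exact: model_rep_irreducible.
- have Ev := model_rep_equiv_vert E; apply: index_inj => // -[e le].
  apply: val_inj; move: (iz1 i) (iz1 j) E => zi zj; move: zj; rewrite -Ev => zj E.
  exact: model_rep_equiv_loop le E.
have [v [z [z1 E]]] := model_rep_exhaust Lh xU sirr.
have [i [iE zE]] := index_onto v (exist _ z (introT eqP z1)); exists i.
move: (iz1 i); rewrite iE => zi.
have [[e le]|nl] := pselect (exists e, at_loop v e).
  by move: zi; rewrite (zE (ex_intro _ e le)) /= => zi; rewrite (Prop_irrelevance zi z1).
have := model_rep_no_loop z1 zi (fun e => introT negP (fun le => nl (ex_intro _ e le))).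
exact: unitarily_equivalent_trans E.
Qed.
End Classification.

(** * The graphs of the quantum spaces *)

Lemma looped_Pi_parametrises (L : digraph) (h : vert L -> nat) (R : realType)
    (O : cstarAlgType R) (x : vert L + edge L -> O) (A : cstarAlgType R) (phi : starHom A O) :
  only_loops h -> (forall v : vert L, exists e, at_loop v e) ->
  is_cuntz_krieger x -> bijective phi ->
  exists M : vert L * circle R -> ped_module R L,
    (forall i, one_dimensional (M i)) /\ Pi_parametrises x phi M.
Proof.
move=> Lh loops xU phi_bij.
apply: (@only_loops_Pi_parametrises _ _ Lh _ _ _ xU _ _ phi_bij _ (fun i => i.1) (fun i => i.2)).
  by move=> [v z] [w z'] /= <- /(_ (loops v)) <-.
by move=> v z; exists (v, z).
Qed.

Lemma only_loops_odd_sphere n : @only_loops (odd_sphere_graph n) (fun i => val i).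
Proof.
split=> /=.
- move=> [[i j] /= ij]; case: (ltngtP i j) ij => //= [lt _|eq _]; first by right.
  by left; exact: val_inj.
- by move=> w _; exists (exist _ (w, w) (leqnn w)).
- move=> [[i j] /= ij] [[i' j'] /= ij'] E E' jj'; apply: val_inj => /=.
  by rewrite E E' jj'.
Qed.

Lemma odd_sphere_at_loop n (v : vert (odd_sphere_graph n)) : exists e, at_loop v e.
Proof. by exists (exist _ (v, v) (leqnn v)); rewrite /at_loop /= eqxx. Qed.

(** Along a path of length two the vertices do not decrease, so a path that returns to its source
    stays there: it is the square of a loop. *)
Lemma only_loops_projective n : @only_loops (path2_graph (odd_sphere_graph n)) (fun i => val i).
Proof.
have loop_path (l : edge (path2_graph (odd_sphere_graph n))) : src l = rng l ->
    src (val l).1 = rng l /\ src (val l).2 = rng (val l).2 /\ rng (val l).2 = rng l.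
  case: l => [[[[i j] ij] [[i' j'] ij']] /= /eqP E] E'.
  have E2 : i = j by apply: val_inj; apply/eqP; rewrite eqn_leq ij /= E -E'.
  by rewrite -E E' -E2.
split=> /=.
- move=> [[[[i j] /= ij] [[i' j'] /= ij']] /= /eqP E]; rewrite -E in ij'.
  case: (ltngtP i' j) (leq_trans ij' ij) => //= [lt _|eq _]; first by right.
  by left; exact: val_inj.
- move=> w _; pose l : edge (odd_sphere_graph n) := exist _ (w, w) (leqnn w).
  by exists (exist _ (l, l) (eqxx _)).
- move=> l l' /loop_path [a [b c]] /loop_path [a' [b' c']] E.
  have [_ _ uni] := only_loops_odd_sphere n.
  apply: val_inj; rewrite [val l]surjective_pairing [val l']surjective_pairing.
  by congr (_, _); apply: uni => //; rewrite ?c ?c'.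
Qed.

Lemma projective_at_loop n (v : vert (path2_graph (odd_sphere_graph n))) :
  exists e, at_loop v e.
Proof.
pose l : edge (odd_sphere_graph n) := exist _ (v, v) (leqnn v).
by exists (exist _ (l, l) (eqxx _)); rewrite /at_loop /= eqxx.
Qed.

(** [n_edges] counts a classical set, with membership through [asbool]; the boolean predicate is
    what the cardinality lemmas of finite types apply to. *)
Lemma n_edgesE (L : digraph) (v w : vert L) :
  n_edges v w = #|[pred e : edge L | (src e == v) && (rng e == w)]|.
Proof. by apply: eq_card => e; apply/asboolP/idP. Qed.

Lemma n_edges_gt0 (L : digraph) (e : edge L) : (0 < n_edges (src e) (rng e))%N.
Proof. by rewrite n_edgesE; apply/card_gt0P; exists e; rewrite inE !eqxx. Qed.

Lemma n_edges1 (L : digraph) (v : vert L) : n_edges v v = 1%N ->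
  exists e, at_loop v =1 pred1 e.
Proof. by rewrite n_edgesE => /mem_card1[e eE]; exists e => f; exact: eE. Qed.

Section LensGraph.
Variables (n : nat) (E : 'I_n -> finType) (G : digraph) (v : {i : 'I_n & E i} -> vert G).
Hypothesis Gv : lens_graph_shape v.

Lemma lens_at_loop (w : vert G) : exists e, at_loop w e.
Proof.
have [[g vK gK] _ _ _ one] := Gv; rewrite -[w]gK; case: (g w) => i s.
by have [e eE] := n_edges1 (one i s); exists e; rewrite eE /=.
Qed.

(** The height of [v_i^s] is its level [i]: no edge descends, and within a level the only edges are
    the loops. *)
Lemma only_loops_lens : exists h, @only_loops G h.
Proof.
have [[g vK gK] _ lower same one] := Gv; exists (fun w => val (tag (g w))); split.
- move=> e; have := n_edges_gt0 e; rewrite -[src e]gK -[rng e]gK !vK.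
  case: (g (src e)) (g (rng e)) => i s [j t] /=.
  case: (ltngtP i j) => [_ _|ji|/val_inj ij]; first by right.
    by rewrite lower.
  case: _ / ij t => t; have [->|st] := eqVneq s t; first by left.
  by rewrite same.
- by move=> w _; have [e /andP[/eqP se /eqP re]] := lens_at_loop w; exists e.
move=> e e' le le' ee'.
have := one (tag (g (rng e))) (tagged (g (rng e))); rewrite taggedK gK => /n_edges1[f fE].
have /eqP -> : pred1 f e by rewrite -fE /at_loop le !eqxx.
by apply/esym/eqP; rewrite -[_ == _]/(pred1 f e') -fE /at_loop le' ee' !eqxx.
Qed.

Lemma card_lens : #|vert G| = (\sum_(i < n) #|E i|)%N.
Proof.
have [vb _ _ _ _] := Gv.
by rewrite -(bij_eq_card vb) card_tagged sumnE big_map big_enum.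
Qed.
End LensGraph.

Lemma ord_bijection (T : finType) k : #|T| = k -> exists f : 'I_k -> T, bijective f.
Proof.
by move=> <-; exists enum_val; exists enum_rank; [exact: enum_valK|exact: enum_rankK].
Qed.

Lemma ord_parametrises (R : realType) (A : cstarAlgType R) (T : finType) (C : Type)
    (rho : T * C -> rep A) k : #|T| = k -> parametrises_spectrum rho ->
  exists rho' : 'I_k * C -> rep A, parametrises_spectrum rho'.
Proof.
move=> /ord_bijection[f [g fK gK]] rhoP; exists (fun p => rho (f p.1, p.2)).
apply: (@parametrises_reindex _ _ _ _ rho (fun p => (f p.1, p.2))) => //.
by exists (fun p => (g p.1, p.2)) => -[a b] /=; rewrite ?fK ?gK.
Qed.

Section EvenSphere.
Variable n : nat.
Local Notation L := (even_sphere_graph n).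

(** The two extra vertices come last in the numbering but only emit edges, so they get height 0 and
    all other vertices move up by one. *)
Lemma only_loops_even_sphere : @only_loops L (fun i => if (i < n)%N then i.+1 else 0%N).
Proof.
split=> /=.
- move=> [[i j] /= /andP[jn ij]]; rewrite jn; case: (ltnP i n) ij => [lt|_ _]; last by right.
  rewrite orbF => ij.
  case: (ltngtP i j) ij => //= [lt' _|eq _]; first by right.
  by left; exact: val_inj.
- move=> w [[[i j] /= ij] <-].
  have jj : (j < n)%N && ((j <= j)%N || (n <= j)%N) by case/andP: ij => -> _; rewrite leqnn.
  by exists (exist _ (j, j) jj).
- move=> [[i j] /= ij] [[i' j'] /= ij'] E E' jj'; apply: val_inj => /=.
  by rewrite E E' jj'.
Qed.

Lemma even_sphere_at_loop (v : vert L) : (v < n)%N <-> exists e : edge L, at_loop v e.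
Proof.
split=> [vn|[[[i j] /= ij] /andP[_ /eqP /= <-]]]; last by case/andP: ij.
have vv : (v < n)%N && ((v <= v)%N || (n <= v)%N) by rewrite vn leqnn.
by exists (exist _ (v, v) vv); rewrite /at_loop /= eqxx.
Qed.

Lemma even_sphere_Pi_parametrises (R : realType) (O : cstarAlgType R)
    (x : vert L + edge L -> O) (A : cstarAlgType R) (phi : starHom A O) :
  is_cuntz_krieger x -> bijective phi ->
  exists M : 'I_n * circle R + bool -> ped_module R L,
    (forall i, one_dimensional (M i)) /\ Pi_parametrises x phi M.
Proof.
move=> xU phi_bij.
pose one : circle R := exist _ 1 (introT eqP (normr1 _)).
pose iv (i : 'I_n * circle R + bool) : vert L :=
  match i with inl p => inord p.1 | inr b => inord (n + b) end.
(* The circle parameter at the two vertices without a loop is the dummy [one]. *)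
pose iz (i : 'I_n * circle R + bool) := if i is inl p then p.2 else one.
have ivE i : iv i = (match i with inl p => val p.1 | inr b => n + b end)%N :> nat.
  case: i => [p|b] /=; rewrite inordK //; last by rewrite -addn2 ltn_add2l; case: b.
  by apply: ltn_trans (ltn_ord p.1) _; rewrite leqW.
apply: (@only_loops_Pi_parametrises _ _ only_loops_even_sphere _ _ _ xU _ _ phi_bij _ iv iz).
- move=> i j /(congr1 val); rewrite /= !ivE.
  case: i j => [[a z]|b] [[a' z']|b'] /= E.
  + have /= -> // := val_inj E; move=> H; congr (inl (_, _)); apply: H.
    by apply/even_sphere_at_loop; rewrite [nat_of_ord _](ivE (inl (a', z))) /=.
  + by have := ltn_ord a; lia.
  + by have := ltn_ord a'; lia.
  + by move=> _; congr inr; move/addnI: E; case: b b' => -[].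
- move=> v z; have [vn|vn] := ltnP v n.
    by exists (inl (Ordinal vn, z)); split=> //; apply: val_inj; apply: etrans (ivE _) _.
  exists (inr (n < v)%N); split.
    apply: val_inj; apply: etrans (ivE _) _.
    by move: (ltn_ord v) vn; rewrite !ltnS; case: (ltngtP n v) => //= [lt v1 _|<- _ _]; lia.
  by move/even_sphere_at_loop; rewrite ltnNge vn.
Qed.
End EvenSphere.

Theorem theorem1 (R : realType) (n : nat) (q : R) (n_ge1 : (1 <= n)%N)
    (q_gt0 : 0 < q) (q_lt1 : q < 1) :
  [/\
   (* (a) *)
   forall (A : cstarAlgType R) (z : 'I_n -> A)
          (O : cstarAlgType R)
          (x : vert (odd_sphere_graph n) + edge (odd_sphere_graph n) -> O)
          (phi : starHom A O),
     is_odd_sphere q z -> is_cuntz_krieger x -> bijective phi ->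
     exists M : 'I_n * circle R -> ped_module R (odd_sphere_graph n),
       (forall i, one_dimensional (M i)) /\ Pi_parametrises x phi M,
   (* (b) *)
   forall (A : cstarAlgType R) (z : 'I_n -> A) (B : cstarAlgType R)
          (iota : starHom B A)
          (O : cstarAlgType R)
          (x : vert (path2_graph (odd_sphere_graph n)) +
               edge (path2_graph (odd_sphere_graph n)) -> O)
          (phi : starHom B O),
     is_projective_space q z iota -> is_cuntz_krieger x -> bijective phi ->
     exists M : 'I_n * circle R -> ped_module R (path2_graph (odd_sphere_graph n)),
       (forall i, one_dimensional (M i)) /\ Pi_parametrises x phi M,
   (* (c) *)
   forall (p : nat) (m : 'I_n -> nat)
          (A : cstarAlgType R) (z : 'I_n -> A) (B : cstarAlgType R)
          (iota : starHom B A)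
          (E : 'I_n -> finType) (G : digraph) (v : {i : 'I_n & E i} -> vert G)
          (O : cstarAlgType R) (x : vert G + edge G -> O) (phi : starHom B O),
     (1 <= p)%N -> is_lens_space q p m z iota -> lens_graph_shape v ->
     is_cuntz_krieger x -> bijective phi ->
     [/\ exists M : vert G * circle R -> ped_module R G,
           (forall i, one_dimensional (M i)) /\ Pi_parametrises x phi M,
         exists rho : 'I_(\sum_(i < n) #|E i|) * circle R -> rep B,
           parametrises_spectrum rho
       & (forall i, #|E i| = 1%N) ->
         exists rho : 'I_n * circle R -> rep B, parametrises_spectrum rho]
   (* (d) *)
   & forall (A : cstarAlgType R) (z : 'I_n.+1 -> A)
            (O : cstarAlgType R)
            (x : vert (even_sphere_graph n) + edge (even_sphere_graph n) -> O)
            (phi : starHom A O),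
     is_even_sphere q z -> is_cuntz_krieger x -> bijective phi ->
     (* inl (j, z) indexes M_{j,z}; inr false and inr true index M_{n+1}
        and M_{n+2} *)
     exists M : 'I_n * circle R + bool -> ped_module R (even_sphere_graph n),
       (forall i, one_dimensional (M i)) /\ Pi_parametrises x phi M].

Proof.
split.
- move=> A z O x phi _.
  exact: looped_Pi_parametrises (@only_loops_odd_sphere n) (@odd_sphere_at_loop n).
- move=> A z B iota O x phi _.
  exact: looped_Pi_parametrises (@only_loops_projective n) (@projective_at_loop n).
- move=> p m A z B iota E G v O x phi _ _ Gv xU phi_bij.
  have [h Lh] := only_loops_lens Gv.
  have [M [M1 MP]] := looped_Pi_parametrises Lh (lens_at_loop Gv) xU phi_bij.
  have [rho _ rhoP] := MP; split; first by exists M.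
    exact: ord_parametrises (card_lens Gv) rhoP.
  move=> E1; apply: ord_parametrises rhoP.
  rewrite (card_lens Gv) (eq_bigr (fun=> 1%N)) => [|i _]; last exact: E1.
  by rewrite sum1_card card_ord.
move=> A z O x phi _; exact: even_sphere_Pi_parametrises.
Qed.
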